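(* Let $\vec X=(X_1,\dots,X_m)$ be an $m$-tuple of quasi-Banach function spaces with product $X:=\prod_{j=1}^mX_j$, let $\vec r\in(0,\infty)^m$ with $\frac1r:=\sum_{j=1}^m\frac1{r_j}$, and let $q\in[r,\infty)$. Suppose that $\vec X\in\mathrm{HL}_{\vec r}$ and that $X$ is an order-continuous $q$-convex quasi-Banach function space. Then for any $f_j\in L^{r_j}_{\mathrm{loc}}(\mathbb{R}^d;X_j)$, $1\le j\le m$, and $g\in L^q_{\mathrm{loc}}(\mathbb{R}^d)$ we have $$\Big\|\big\|\widetilde M_{\vec r}(\vec f)\big\|_X\cdot g\Big\|_{L^q(\mathbb{R}^d)}\lesssim_{\vec X,\vec r}\Big\|M_{(\vec r,q)}\big(\|f_1\|_{X_1},\dots,\|f_m\|_{X_m},g\big)\Big\|_{L^q(\mathbb{R}^d)}.$$ In particular, $$\big\|\widetilde M_{\vec r}(\vec f)\big\|_{L^q(\mathbb{R}^d;X)}\lesssim_{\vec X,\vec r}\big\|M_{\vec r}\big(\|f_1\|_{X_1},\dots,\|f_m\|_{X_m}\big)\big\|_{L^q(\mathbb{R}^d)}.$$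
   Context: Function spaces. Measure spaces $(\Omega,\mu)$ are $\sigma$-finite. A quasi-Banach function space over $\Omega$ is an order ideal $X\subseteq L^0(\Omega)$ with a quasi-norm such that: $|\xi|\le|\eta|$ implies $\|\xi\|_X\le\|\eta\|_X$; there is $\xi\in X$ with $\xi>0$ a.e.; and (Fatou) if $0\le\xi_n\uparrow\xi$, $\xi_n\in X$, $\sup_n\|\xi_n\|_X<\infty$, then $\xi\in X$ and $\|\xi\|_X=\sup_n\|\xi_n\|_X$. It is order-continuous if $0\le\xi_n\uparrow\xi\in X$ implies $\|\xi_n-\xi\|_X\to0$. $X$ is $p$-convex, $p\in(0,\infty)$, if $\|(\sum_k|\xi_k|^p)^{1/p}\|_X\le(\sum_k\|\xi_k\|_X^p)^{1/p}$ for all finite families. The product $\prod_jX_j$ is the space of $\xi$ with $|\xi|\le\prod_j\xi_j$ for some $0\le\xi_j\in X_j$, with $\|\xi\|:=\inf\prod_j\|\xi_j\|_{X_j}$ over such $\xi_j$. An $m$-tuple of quasi-Banach function spaces consists of such spaces over the same measure space whose product is a quasi-Banach function space. Maximal operators. Cubes are half-open with sides parallel to the axes. For scalar $f$, $\langle f\rangle_{r,Q}:=(\frac1{|Q|}\int_Q|f|^r\mathrm dx)^{1/r}$; for $f\in L^{r}_{\mathrm{loc}}(\mathbb{R}^d;X)$ with $X$ $r$-convex, $\langle f\rangle_{r,Q}\in X$ is the function $\omega\mapsto(\frac1{|Q|}\int_Q|f(x,\omega)|^{r}\mathrm dx)^{1/r}$. For $\vec\rho\in(0,\infty)^n$ and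 scalar functions, $M_{\vec\rho}(h_1,\dots,h_n)(x):=\sup_Q\prod_{j=1}^n\langle h_j\rangle_{\rho_j,Q}\mathbf 1_Q(x)$, supremum over all cubes $Q\subseteq\mathbb{R}^d$; $M_{(\vec r,q)}$ is this operator for $(r_1,\dots,r_m,q)$. For $X_j$-valued $f_j$, with each $X_j$ $r_j$-convex, $\widetilde M_{\vec r}(\vec f)(x):=\sup_Q\prod_{j=1}^m\langle f_j\rangle_{r_j,Q}\mathbf 1_Q(x)$, where the supremum over all cubes is taken in the lattice sense (a.e. on $\Omega$), with $\|\xi\|_X:=\infty$ if $\xi\notin X$; for a finite collection of cubes $\mathcal{D}$, $\widetilde M^{\mathcal{D}}_{\vec r}$ is the same with supremum over $Q\in\mathcal{D}$. Hardy–Littlewood property. $\vec X\in\mathrm{HL}_{\vec r}$ means that each $X_j$ is $r_j$-convex and for some $\vec p$ with $\vec r<\vec p\le\infty$ (coordinatewise), with $\frac1p:=\sum_j\frac1{p_j}$, one has $\sup_{\mathcal{D}}\|\widetilde M^{\mathcal{D}}_{\vec r}\|_{L^{p_1}(\mathbb{R};X_1)\times\cdots\times L^{p_m}(\mathbb{R};X_m)\to L^p(\mathbb{R};X)}<\infty$, the supremum being over all finite collections of cubes (intervals) in $\mathbb{R}$. (One may equivalently use $\mathbb{R}^d$ in place of $\mathbb{R}$.) $\lesssim_{a,b,\dots}$: up to a constant depending only on $a,b,\dots$ and possibly $d,m$. *)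

(* Defs.v *)
From HB Require Import structures.
From mathcomp Require Import all_boot all_order all_algebra.
From mathcomp Require Import all_classical all_reals all_analysis.
From mathcomp Require Import measurable_realfun.

Set Implicit Arguments.
Unset Strict Implicit.
Unset Printing Implicit Defensive.
Import Order.TTheory GRing.Theory Num.Theory.
Import numFieldNormedType.Exports.

Local Open Scope classical_set_scope.
Local Open Scope ring_scope.

(* R^n is the measurable type n.-tuple R, whose sigma-algebra is generated by
   the coordinates; leb n is Lebesgue measure on its Borel sets, built as an
   iterated product measure (see leb_box). *)
Section lebesgue_Rn.
Context {R : realType}.

Definition Rn_cons n (p : n.-tuple R * R) : n.+1.-tuple R :=
  [the n.+1.-tuple R of p.2 :: p.1].

Lemma measurable_Rn_cons n : measurable_fun [set: n.-tuple R * R] (@Rn_cons n).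
Proof. by apply: measurable_cons; [exact: measurable_snd|exact: measurable_fst]. Qed.

Definition leb_step n (m : {measure set (n.-tuple R) -> \bar R}) :
    set (n.+1.-tuple R) -> \bar R :=
  pushforward (m \x lebesgue_measure)%E (@Rn_cons n).

Section leb_step_measure.
Variables (n : nat) (m : {measure set (n.-tuple R) -> \bar R}).

Let leb_step0 : leb_step m set0 = 0%E.
Proof. by rewrite /leb_step /pushforward preimage_set0 measure0. Qed.

Let leb_step_ge0 A : (0 <= leb_step m A)%E.
Proof. exact: integral_ge0. Qed.

Let leb_step_sigma_additive : semi_sigma_additive (leb_step m).
Proof.
exact: (@measure_semi_sigma_additive _ _ _
  (measure_function_pushforward__canonical__measure_function_Measure
    (m \x lebesgue_measure)%E (@measurable_Rn_cons n))).
Qed.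

HB.instance Definition _ := isMeasure.Build _ _ _ (leb_step m)
  leb_step0 leb_step_ge0 leb_step_sigma_additive.

End leb_step_measure.

Fixpoint leb n : {measure set (n.-tuple R) -> \bar R} :=
  if n is k.+1 then leb_step (leb k) else dirac ([tuple] : 0.-tuple R).

Definition box n (a b : n.-tuple R) : set (n.-tuple R) :=
  [set x | forall i, tnth a i <= tnth x i < tnth b i].

Lemma measurable_box n (a b : n.-tuple R) : measurable (box a b).
Proof.
have -> : box a b = \bigcap_(i in [set: 'I_n])
    ((fun x : n.-tuple R => tnth x i) @^-1` `[tnth a i, tnth b i[%classic).
  by apply/seteqP; split => x /= H i; [move=> _|]; have := H i;
    rewrite /= in_itv/=; [|exact].
apply: fin_bigcap_measurable; first exact: finite_finset.
move=> i _; rewrite -[X in measurable X]setTI.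
exact: (measurable_tnth i) => //.
Qed.

Lemma leb_box n (a b : n.-tuple R) : (forall i, tnth a i <= tnth b i) ->
  leb n (box a b) = (\prod_(i < n) (tnth b i - tnth a i))%:E.
Proof.
elim: n a b => [|n IH] a b ab.
  rewrite big_ord0 /= diracE mem_set// => -[] //.
pose a' : n.-tuple R := [tuple of behead a].
pose b' : n.-tuple R := [tuple of behead b].
have tl (t : n.+1.-tuple R) i : tnth [tuple of behead t] i = tnth t (lift ord0 i).
  by rewrite [in RHS](tuple_eta t) tnthS.
rewrite /= /leb_step /pushforward.
have -> : @Rn_cons n @^-1` box a b =
    box a' b' `*` `[tnth a ord0, tnth b ord0[%classic.
  apply/seteqP; split => -[x y]; rewrite /box /Rn_cons /=.
    move=> H; split=> [i|]; first by have := H (lift ord0 i); rewrite !tl tnthS.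
    by have := H ord0; rewrite in_itv.
  move=> [H1 H2] i; case: (unliftP ord0 i) => [j|] ->.
    by have := H1 j; rewrite !tl tnthS.
  by rewrite in_itv in H2.
rewrite product_measure1E//; last exact: measurable_box.
rewrite IH; last by move=> i; rewrite !tl.
rewrite -[X in (_ * X)%E]/(lebesgue_measure `[tnth a ord0, tnth b ord0[%classic).
rewrite lebesgue_measure_itv/= lte_fin big_ord_recl.
under eq_bigr do rewrite !tl.
case: ltP => [_|ba]; first by rewrite -EFinD -EFinM mulrC.
by rewrite (le_anti (introT andP (conj ba (ab ord0)))) subrr mul0r mule0.
Qed.

End lebesgue_Rn.

Definition cubes {R : realType} n : set (set (n.-tuple R)) :=
  [set Q | exists (a : n.-tuple R) (l : R),
    0 < l /\ Q = box a [tuple tnth a i + l | i < n]].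
Arguments cubes {R} n _.

(* Elements of L^0 are represented by real-valued measurable functions, and all
   identities and inequalities between them hold almost everywhere; fnorm is
   only meaningful on fcarrier. *)
Record fspace (R : realType) (T : Type) := FSpace {
  fcarrier :> (T -> R) -> Prop;
  fnorm : (T -> R) -> R }.

Section function_spaces.
Context {R : realType} {dT : measure_display} {T : measurableType dT}.
Variable mu : {measure set T -> \bar R}.
Implicit Types (X : fspace R T) (xi eta : T -> R).

Definition increases_to (xi_ : nat -> T -> R) xi :=
  {ae mu, forall w, [/\ forall k, 0 <= xi_ k w,
    {homo xi_ ^~ w : k l / (k <= l)%N >-> k <= l} &
    xi_ k w @[k --> \oo] --> xi w]}.

Record quasi_banach X : Prop := QuasiBanach {
  qb_measurable : forall xi, X xi -> measurable_fun [set: T] xi;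
  qb_add : forall xi eta, X xi -> X eta -> X (fun w => xi w + eta w);
  qb_scale : forall (a : R) xi, X xi -> X (fun w => a * xi w);
  qb_ideal : forall xi eta, measurable_fun [set: T] xi -> X eta ->
    {ae mu, forall w, `|xi w| <= `|eta w|} ->
    X xi /\ fnorm X xi <= fnorm X eta;
  qb_ge0 : forall xi, X xi -> 0 <= fnorm X xi;
  qb_eq0 : forall xi, X xi -> fnorm X xi = 0 -> {ae mu, forall w, xi w = 0};
  qb_normZ : forall (a : R) xi, X xi ->
    fnorm X (fun w => a * xi w) = `|a| * fnorm X xi;
  qb_quasi_triangle : exists K : R, forall xi eta, X xi -> X eta ->
    fnorm X (fun w => xi w + eta w) <= K * (fnorm X xi + fnorm X eta);
  qb_unit : exists2 xi, X xi & {ae mu, forall w, 0 < xi w};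
  qb_fatou : forall (xi_ : nat -> T -> R) xi,
    measurable_fun [set: T] xi -> (forall k, X (xi_ k)) ->
    increases_to xi_ xi -> (exists B, forall k, fnorm X (xi_ k) <= B) ->
    X xi /\ fnorm X xi = sup (range (fun k => fnorm X (xi_ k))) }.

Definition order_continuous X :=
  forall (xi_ : nat -> T -> R) xi,
    (forall k, measurable_fun [set: T] (xi_ k)) -> X xi ->
    increases_to xi_ xi ->
    fnorm X (fun w => xi_ k w - xi w) @[k --> \oo] --> 0.

Definition pconvex (p : R) X :=
  forall (n : nat) (xi : 'I_n -> T -> R), (forall k, X (xi k)) ->
    fnorm X (fun w => (\sum_(k < n) `|xi k w| `^ p) `^ p^-1)
      <= (\sum_(k < n) fnorm X (xi k) `^ p) `^ p^-1.

Definition factors m (X : 'I_m -> fspace R T) xi (xs : 'I_m -> T -> R) :=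
  (forall j, X j (xs j)) /\
  {ae mu, forall w, (forall j, 0 <= xs j w) /\ `|xi w| <= \prod_(j < m) xs j w}.

Definition prod_space m (X : 'I_m -> fspace R T) : fspace R T := FSpace
  [set xi | measurable_fun [set: T] xi /\ exists xs, factors X xi xs]
  (fun xi => inf [set \prod_(j < m) fnorm (X j) (xs j) | xs in factors X xi]).

(* ||xi||_X for xi with values in [-oo, +oo], equal to +oo when xi is not in X *)
Definition enorm X (xi : T -> \bar R) : \bar R :=
  if `[< {ae mu, forall w, xi w \is a fin_num} /\ X (fine \o xi) >]
  then (fnorm X (fine \o xi))%:E else +oo%E.

(* s is the least upper bound of F in the lattice of a.e. classes of
   [0, +oo]-valued measurable functions; in particular lattice_sup set0 = 0. *)
Definition is_lattice_sup (F : set (T -> \bar R)) (s : T -> \bar R) :=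
  let L := [set t : T -> \bar R |
    measurable_fun [set: T] t /\ forall w, (0 <= t w)%E] in
  let ub := [set t | L t /\
    forall f, F f -> {ae mu, forall w, (f w <= t w)%E}] in
  ub s /\ forall t, ub t -> {ae mu, forall w, (s w <= t w)%E}.

Definition lattice_sup (F : set (T -> \bar R)) : T -> \bar R :=
  xget (cst +oo%E) (is_lattice_sup F).

(* An X-valued function on R^n is given by a jointly measurable representative
   f, with f x : T -> R in X for every x. *)
Definition simple_valued n X (s : n.-tuple R -> T -> R) :=
  exists (N : nat) (A : 'I_N -> set (n.-tuple R)) (xi : 'I_N -> T -> R),
    (forall k, measurable (A k) /\ X (xi k)) /\
    s = (fun x w => \sum_(k < N) \1_(A k) x * xi k w).

Definition strongly_measurable n X (f : n.-tuple R -> T -> R) :=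
  [/\ measurable_fun [set: n.-tuple R * T] (fun z => f z.1 z.2),
      forall x, X (f x) &
      exists s_ : nat -> n.-tuple R -> T -> R,
        (forall k, simple_valued X (s_ k)) /\
        {ae leb n, forall x,
          fnorm X (fun w => s_ k x w - f x w) @[k --> \oo] --> 0}].

Definition efnorm n X (f : n.-tuple R -> T -> R) : n.-tuple R -> \bar R :=
  fun x => (fnorm X (f x))%:E.

Definition in_Lp n (p : \bar R) X (f : n.-tuple R -> T -> R) :=
  strongly_measurable X f /\ (Lnorm (leb n) p (efnorm X f) < +oo)%E.

Definition in_Lploc n (p : R) X (f : n.-tuple R -> T -> R) :=
  strongly_measurable X f /\
  forall Q, cubes n Q -> (\int[leb n]_(x in Q) (efnorm X f x `^ p) < +oo)%E.

End function_spaces.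

Definition in_Lploc_scalar {R : realType} n (p : R) (g : n.-tuple R -> R) :=
  measurable_fun [set: n.-tuple R] g /\
  forall Q, cubes n Q -> (\int[leb n]_(x in Q) (`|g x| `^ p)%:E < +oo)%E.

Section maximal_operators.
Context {R : realType}.
Local Open Scope ereal_scope.

Definition average n (p : R) (Q : set (n.-tuple R)) (h : n.-tuple R -> \bar R) :
    \bar R :=
  ((leb n Q)^-1 * \int[leb n]_(x in Q) (`|h x| `^ p)) `^ p^-1.

Definition maximal n m (rho : 'I_m -> R) (h : 'I_m -> n.-tuple R -> \bar R)
    (x : n.-tuple R) : \bar R :=
  ereal_sup [set (\prod_(j < m) average (rho j) Q (h j)) * (\1_Q x)%:E
            | Q in cubes n].

Context {dT : measure_display} {T : measurableType dT}.
Variable mu : {measure set T -> \bar R}.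

Definition lattice_maximal n (D : set (set (n.-tuple R))) m (r : 'I_m -> R)
    (f : 'I_m -> n.-tuple R -> T -> R) (x : n.-tuple R) : T -> \bar R :=
  lattice_sup mu
    [set (fun w => (\prod_(j < m) average (r j) Q (fun y => (f j y w)%:E))
                   * (\1_Q x)%:E)
    | Q in D].

Definition HL m (r : 'I_m -> R) (X : 'I_m -> fspace R T) :=
  (forall j, pconvex (r j) (X j)) /\
  exists (p : 'I_m -> \bar R) (K : R), (forall j, (r j)%:E < p j) /\
    forall D : set (set (1.-tuple R)), finite_set D -> D `<=` cubes 1 ->
    forall f : 'I_m -> 1.-tuple R -> T -> R,
      (forall j, in_Lp (p j) (X j) (f j)) ->
      Lnorm (leb 1) (\sum_(j < m) (p j)^-1)^-1
        (fun x => enorm mu (prod_space mu X) (lattice_maximal D r f x))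
      <= K%:E * \prod_(j < m) Lnorm (leb 1) (p j) (efnorm (X j) (f j)).

End maximal_operators.

(* snoc a b = (a_0, ..., a_(m-1), b) *)
Definition snoc (A : Type) m (a : 'I_m -> A) (b : A) : 'I_m.+1 -> A :=
  fun i => oapp a b (unlift ord_max i).

(* Main.v *)
(* By Fatou's lemma it suffices to treat maxima over finitely many cubes, and the
   one-third trick places these in finitely many dyadic trees of cubes.  On a tree,
   descend from a cube until some average of ||f_j|| grows by a large factor, or
   until the norm of the running lattice maximum exceeds a large multiple of the
   product of the averages of the ||f_j|| over the initial cube.  The weak type
   (1,1) inequality bounds the mass stopped for the first reason.  For the second,
   one may replace f_j by its conditional expectation (in the l^(r_j) sense) at
   the cubes of the first kind, which is bounded by the initial averages; then
   the Hardy-Littlewood property, transported to the tree by realizing it as a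
   nested partition of [0,1), and Chebyshev's inequality apply.  Hence at most half of
   the mass stops, and iterating, with q-convexity to split off the part of the
   maximum found so far, bounds the weighted q-th power by a sparse sum that the
   maximal operator M_(r,q) dominates.  Minkowski's inequality in the form
   ||<f_j>||_(X_j) <= <||f_j||>, a consequence of r_j-convexity, passes from
   f_j to ||f_j||. *)

From HB Require Import structures.
Require Import Defs.
From mathcomp Require Import all_boot all_order all_algebra.
From mathcomp Require Import all_classical all_reals all_analysis.
From mathcomp Require Import measurable_realfun ess_sup_inf.
From mathcomp Require Import ring lra.

Set Implicit Arguments.
Unset Strict Implicit.
Unset Printing Implicit Defensive.
Import Order.TTheory GRing.Theory Num.Theory.
Import numFieldNormedType.Exports.

Local Open Scope classical_set_scope.
Local Open Scope ring_scope.

(** * Quasi-Banach function spaces *)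

(** Two obstacles shape the proof: the norm of the lattice maximal function is not known to be
    measurable in x, and a quasi-norm need not be continuous. Against the first, integrals are
    suprema over simple functions, monotone without measurability, and estimates in x come with a
    measurable majorant [Psi]. Against the second, perturbations cost a factor c > 1 that tends to 1
    in the end. No sparse family is formed. Trees are an inductive type and the stopping argument is
    a structural induction: mass that does not stop keeps the value g of its initial cube as a
    credit, and [treeH], an average of running maxima, pays for these credits. Only the masses of
    nodes matter, so a cube with its 2^d children is modelled by an interval cut into 2^d equal
    pieces; thus a property on R serves R^d. The pruned functions are bounded and live on an
    interval of length 1, so one bound controls their L^(p_j) norms for every p_j. Before the q-th
    root is taken, the constant is a q-th power times 2^(d+1); since 1/q <= 1/r, the root of the
    latter is bounded independently of q. *)

Section function_space.
Context {R : realType} {dT : measure_display} {T : measurableType dT}.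
Variable mu : {measure set T -> \bar R}.
Variable X : fspace R T.
Hypothesis hX : quasi_banach mu X.
Implicit Types xi eta : T -> R.

Lemma fs_le xi eta : measurable_fun [set: T] xi -> X eta ->
  {ae mu, forall w, `|xi w| <= `|eta w|} -> X xi /\ fnorm X xi <= fnorm X eta.
Proof. exact: (qb_ideal hX). Qed.

Lemma fs_ae_eq xi eta : measurable_fun [set: T] xi -> X eta ->
  {ae mu, forall w, `|xi w| = `|eta w|} -> X xi /\ fnorm X xi = fnorm X eta.
Proof.
move=> mxi Xeta h.
have [|X1 le1] := fs_le mxi Xeta _; first by apply: filterS h => w ->.
split => //; apply/le_anti; rewrite le1/=.
have [|//] := fs_le (qb_measurable hX Xeta) X1 _.
by apply: filterS h => w ->.
Qed.

Lemma fs_abs xi : X xi -> X (fun w => `|xi w|) /\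
  fnorm X (fun w => `|xi w|) = fnorm X xi.
Proof.
move=> Xxi; apply: fs_ae_eq => //.
  apply: measurableT_comp => //; exact: (qb_measurable hX).
by apply: nearW => w; rewrite normr_id.
Qed.

Lemma fs_normZ (a : R) xi : 0 <= a -> X xi ->
  fnorm X (fun w => a * xi w) = a * fnorm X xi.
Proof. by move=> a0 Xxi; rewrite (qb_normZ hX)// ger0_norm. Qed.

Lemma fs_0 : X (fun=> 0).
Proof.
have [xi Xxi _] := qb_unit hX.
by have := qb_scale hX 0 Xxi; under eq_fun do rewrite mul0r.
Qed.

Lemma fs_norm0 : fnorm X (fun=> 0) = 0.
Proof.
have [xi Xxi _] := qb_unit hX.
have := fs_normZ (lexx 0) Xxi; rewrite mul0r => h; rewrite -[RHS]h.
by congr (fnorm X _); apply/funext => w; rewrite mul0r.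
Qed.

Lemma fs_max xi eta : X xi -> X eta -> X (fun w => Num.max (xi w) (eta w)).
Proof.
move=> Xxi Xeta.
have [||//] := fs_le (xi := fun w => Num.max (xi w) (eta w))
  (eta := fun w => `|xi w| + `|eta w|) _ (qb_add hX (fs_abs Xxi).1 (fs_abs Xeta).1).
  by apply: measurable_maxr; apply: (qb_measurable hX).
apply: nearW => w; rewrite [leRHS]ger0_norm ?addr_ge0//.
by rewrite /Num.max; case: ifP => _; rewrite ?lerDl ?lerDr.
Qed.

Lemma fs_sum n (xi : 'I_n -> T -> R) : (forall k, X (xi k)) ->
  X (fun w => \sum_(k < n) xi k w).
Proof.
elim: n xi => [|n IH] xi Xxi.
  by under eq_fun do rewrite big_ord0; exact: fs_0.
under eq_fun do rewrite big_ord_recl.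
by apply: (qb_add hX) => //; exact: IH.
Qed.

Lemma fs_bigmax n (xi : 'I_n -> T -> R) : (forall k, X (xi k)) ->
  X (fun w => \big[Num.max/0]_(k < n) xi k w).
Proof.
elim: n xi => [|n IH] xi Xxi.
  by under eq_fun do rewrite big_ord0; exact: fs_0.
under eq_fun do rewrite big_ord_recl.
by apply: fs_max => //; exact: IH.
Qed.

Lemma measurable_powR_sum (I : finType) (p : R) (xi : I -> T -> R) :
  (forall k, measurable_fun [set: T] (xi k)) ->
  measurable_fun [set: T] (fun w => (\sum_k `|xi k w| `^ p) `^ p^-1).
Proof.
move=> mxi; apply: (measurableT_comp (measurable_powR _)).
apply: measurable_sum => k.
apply: (measurableT_comp (measurable_powR _)).
exact: measurableT_comp.
Qed.

Lemma fs_powR_sum (p : R) n (xi : 'I_n -> T -> R) : 0 < p ->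
  (forall k, X (xi k)) -> X (fun w => (\sum_k `|xi k w| `^ p) `^ p^-1).
Proof.
move=> p0 Xxi.
have Xa k : X (fun w => `|xi k w|) by exact: (fs_abs (Xxi k)).1.
have Xm := fs_bigmax Xa.
apply: (fun m h => (fs_le m (qb_scale hX (n%:R `^ p^-1) Xm) h).1).
  by apply: measurable_powR_sum => k; exact: (qb_measurable hX).
apply: nearW => w.
have M0 : 0 <= \big[Num.max/0]_(k < n) `|xi k w|.
  by elim/big_ind : _ => // x y x0 y0; rewrite le_max x0.
rewrite [leLHS]ger0_norm ?powR_ge0// [leRHS]ger0_norm ?mulr_ge0 ?powR_ge0//.
have -> : \big[Num.max/0]_(k < n) `|xi k w| =
  ((\big[Num.max/0]_(k < n) `|xi k w|) `^ p) `^ p^-1.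
  by rewrite -powRrM divff ?gt_eqF// powRr1.
rewrite -powRM ?powR_ge0//; apply: ge0_ler_powR => //.
- by rewrite invr_ge0 ltW.
- by rewrite nnegrE; apply: sumr_ge0 => k _; exact: powR_ge0.
- by rewrite nnegrE mulr_ge0 ?powR_ge0.
apply: (@le_trans _ _ (\sum_(k < n) (\big[Num.max/0]_(k < n) `|xi k w|) `^ p)).
  apply: ler_sum => k _; apply: ge0_ler_powR => //.
  - exact: ltW.
  - exact: (le_bigmax _ (fun k => `|xi k w|)).
by rewrite sumr_const card_ord -[leLHS]mulr_natl.
Qed.

Lemma pconvexE (p : R) n (xi : 'I_n -> T -> R) : 0 < p -> pconvex p X ->
  (forall k, X (xi k)) ->
  fnorm X (fun w => (\sum_k `|xi k w| `^ p) `^ p^-1) `^ p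
  <= \sum_k fnorm X (xi k) `^ p.
Proof.
move=> p0 cX Xxi.
have S0 : 0 <= \sum_k fnorm X (xi k) `^ p.
  by apply: sumr_ge0 => k _; exact: powR_ge0.
have -> : \sum_k fnorm X (xi k) `^ p =
    ((\sum_k fnorm X (xi k) `^ p) `^ p^-1) `^ p.
  by rewrite -powRrM mulVf ?gt_eqF// powRr1.
apply: ge0_ler_powR.
- exact: ltW.
- by rewrite nnegrE; apply: (qb_ge0 hX); exact: fs_powR_sum.
- by rewrite nnegrE powR_ge0.
- exact: cX.
Qed.

(** The absolute value of the maximum is below the l^p sum. With constant 1, this is the form of
    convexity that later separates the past of a running maximum from its future. *)
Lemma pconvex_max (p : R) xi eta : 0 < p -> pconvex p X -> X xi -> X eta ->
  fnorm X (fun w => Num.max (xi w) (eta w)) `^ p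
  <= fnorm X xi `^ p + fnorm X eta `^ p.
Proof.
move=> p0 cX Xxi Xeta.
pose z (i : 'I_2) := if i == ord0 then xi else eta.
have Xz i : X (z i) by rewrite /z; case: ifP.
have := pconvexE p0 cX Xz; rewrite !big_ord_recl big_ord0 addr0 /z/=.
apply: le_trans; apply: ge0_ler_powR.
- exact: ltW.
- by rewrite nnegrE; apply: (qb_ge0 hX); exact: fs_max.
- by rewrite nnegrE; apply: (qb_ge0 hX); exact: (fs_powR_sum p0 Xz).
have [|//] := fs_le (qb_measurable hX (fs_max Xxi Xeta)) (fs_powR_sum p0 Xz) _.
apply: nearW => w; rewrite [leRHS]ger0_norm ?powR_ge0//.
rewrite !big_ord_recl big_ord0 addr0 /z/=.
have E : `|Num.max (xi w) (eta w)| =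
    (`|Num.max (xi w) (eta w)| `^ p) `^ p^-1.
  by rewrite -powRrM divff ?gt_eqF// powRr1.
rewrite E; apply: ge0_ler_powR.
- by rewrite invr_ge0 ltW.
- by rewrite nnegrE powR_ge0.
- by rewrite nnegrE addr_ge0 ?powR_ge0.
by rewrite /Num.max; case: ifP => _; rewrite ?lerDl ?lerDr ?powR_ge0.
Qed.

(* |a + b| <= max((1+e)|a|, (1+1/e)|b|), so p-convexity makes the quasi-norm
   continuous even when it is not subadditive *)
Lemma pconvex_add (p e : R) xi eta : 0 < p -> 0 < e -> pconvex p X ->
  X xi -> X eta ->
  fnorm X (fun w => xi w + eta w) `^ p
  <= ((1 + e) * fnorm X xi) `^ p + ((1 + e^-1) * fnorm X eta) `^ p.
Proof.
move=> p0 e0 cX Xxi Xeta.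
have e1 : 0 <= 1 + e by rewrite addr_ge0// ltW.
have e2 : 0 <= 1 + e^-1 by rewrite addr_ge0// invr_ge0 ltW.
have Xa := qb_scale hX (1 + e) (fs_abs Xxi).1.
have Xb := qb_scale hX (1 + e^-1) (fs_abs Xeta).1.
have := pconvex_max p0 cX Xa Xb.
rewrite !fs_normZ//; try exact: (fs_abs _).1.
rewrite (fs_abs Xxi).2 (fs_abs Xeta).2; apply: le_trans.
apply: ge0_ler_powR.
- exact: ltW.
- by rewrite nnegrE; apply: (qb_ge0 hX); exact: (qb_add hX).
- by rewrite nnegrE; apply: (qb_ge0 hX); exact: fs_max.
have [|//] := fs_le (qb_measurable hX (qb_add hX Xxi Xeta)) (fs_max Xa Xb) _.
apply: nearW => w.
apply: (le_trans (ler_normD _ _)).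
rewrite [leRHS]ger0_norm; last by rewrite le_max mulr_ge0.
rewrite le_max; case: (leP `|eta w| (e * `|xi w|)) => h.
  by rewrite mulrDl mul1r lerD2l h.
apply/orP; right; rewrite mulrDl mul1r addrC lerD2l.
by rewrite mulrC ler_pdivlMr// mulrC ltW.
Qed.

End function_space.

(** * Extended norms and the Fatou property *)

Section extended_norm.
Context {R : realType} {dT : measure_display} {T : measurableType dT}.
Variable mu : {measure set T -> \bar R}.
Variable X : fspace R T.
Hypothesis hX : quasi_banach mu X.
Implicit Types (xi eta : T -> R) (phi psi : T -> \bar R).

Lemma enorm_ge0 phi : (0 <= enorm mu X phi)%E.
Proof.
rewrite /enorm; case: asboolP => // -[_ Xphi].
by rewrite lee_fin; exact: (qb_ge0 hX).
Qed.

Lemma enorm_fin phi (B : R) : (enorm mu X phi <= B%:E)%E ->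
  [/\ {ae mu, forall w, phi w \is a fin_num}, X (fine \o phi) &
      fnorm X (fine \o phi) <= B].
Proof. by rewrite /enorm; case: asboolP => // -[]. Qed.

Lemma enorm_EFin xi : X xi -> enorm mu X (EFin \o xi) = (fnorm X xi)%:E.
Proof.
move=> Xxi; rewrite /enorm; case: asboolP => //= h; exfalso; apply: h.
by split => //; exact: nearW.
Qed.

Lemma measurable_fine_comp phi : measurable_fun [set: T] phi ->
  measurable_fun [set: T] (fine \o phi).
Proof. by move=> mphi; exact: (measurableT_comp (@fine_measurable R _ measurableT)). Qed.

Lemma enorm_le phi psi : measurable_fun [set: T] phi ->
  {ae mu, forall w, 0 <= phi w <= psi w}%E ->
  (enorm mu X phi <= enorm mu X psi)%E.
Proof.
move=> mphi h; rewrite [leRHS]/enorm; case: asboolP => [[fpsi Xpsi]|_]; last first.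
  by rewrite leey.
have fphi : {ae mu, forall w, phi w \is a fin_num}.
  apply: filterS2 fpsi h => w psifin /andP[phi0 phipsi].
  by rewrite ge0_fin_numE// (le_lt_trans phipsi)// -ge0_fin_numE// (le_trans phi0).
have mf := measurable_fine_comp mphi.
have [|X1 le1] := fs_le hX mf Xpsi.
  near=> w.
  have /andP[phi0 phipsi] : (0 <= phi w <= psi w)%E by near: w.
  rewrite /= !ger0_norm ?fine_ge0// ?(le_trans phi0)//.
  by apply: fine_le => //; near: w.
rewrite /enorm; case: asboolP => [_|H]; first by rewrite lee_fin.
by exfalso; apply: H.
Unshelve. all: by end_near. Qed.

(* Fatou is only assumed for real-valued limits; the set A where the supremum is
   infinite is null because ||c u 1_A|| stays bounded as c grows, u > 0 in X. *)
Lemma enorm_fatou (phi : nat -> T -> \bar R) (B : R) :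
  (forall k, measurable_fun [set: T] (phi k)) ->
  (forall k w, 0 <= phi k w)%E ->
  (forall w, {homo phi ^~ w : k l / (k <= l)%N >-> (k <= l)%E}) ->
  (forall k, enorm mu X (phi k) <= B%:E)%E ->
  (enorm mu X (fun w => ereal_sup (range (phi ^~ w))) <= B%:E)%E.
Proof.
move=> mphi phi0 mono bnd.
pose s w := ereal_sup (range (phi ^~ w)).
have s0 w : (0 <= s w)%E.
  by apply: (le_trans (phi0 0%N w)); apply: ereal_sup_ubound; exists 0%N.
have phis k w : (phi k w <= s w)%E by apply: ereal_sup_ubound; exists k.
pose x k := fine \o phi k.
have Xx k : X (x k) by have [] := enorm_fin (bnd k).
have nx k : fnorm X (x k) <= B by have [] := enorm_fin (bnd k).
have mx k : measurable_fun [set: T] (x k) by exact: measurable_fine_comp.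
have fphi : {ae mu, forall w, forall k, phi k w \is a fin_num}.
  by apply/ae_foralln => k; have [] := enorm_fin (bnd k).
have cvphi w : phi k w @[k --> \oo] --> s w.
  by apply: ereal_nondecreasing_cvgn => a b ab; exact: mono.
have ms : measurable_fun [set: T] s.
  by apply: (emeasurable_fun_cvg (fun k => phi k)) => // w _; exact: cvphi.
have [u Xu upos] := qb_unit hX.
pose A := [set w | s w = +oo%E].
have mA : measurable A.
  by rewrite -[A]setTI; exact: (ms measurableT _ (emeasurable_set1 _)).
have mu_ : measurable_fun [set: T] u by exact: (qb_measurable hX).
pose v w := `|u w| * \1_A w.
have mv : measurable_fun [set: T] v.
  by apply: measurable_funM; [exact: measurableT_comp|exact: measurable_indic].
have v0 w : 0 <= v w by rewrite mulr_ge0.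
have Xv : X v.
  have [//|//] := fs_le hX mv Xu; apply: nearW => w.
  rewrite ger0_norm// /v indicE; case: (w \in A); rewrite ?mulr1 ?mulr0//.
have B0 : 0 <= B by exact: le_trans (qb_ge0 hX (Xx 0%N)) (nx 0%N).
have key (c : R) : 0 <= c -> c * fnorm X v <= B.
  move=> c0.
  (* On [A] the [x k] tend to infinity and overtake [c * v]; off [A] both [v] and [y k] vanish. So
     [y k] increases to the real-valued [c * v], to which the Fatou property applies. *)
  pose y k w := Num.min (x k w) (c * v w).
  have my k : measurable_fun [set: T] (y k).
    by apply: measurable_minr => //; exact: measurable_funM.
  have x0 k w : 0 <= x k w by rewrite fine_ge0.
  have y0 k w : 0 <= y k w by rewrite le_min x0 mulr_ge0.
  have Xy k : X (y k) /\ fnorm X (y k) <= fnorm X (x k).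
    apply: (fs_le hX) => //; apply: nearW => w.
    by rewrite !ger0_norm// ge_min lexx.
  have mcv : measurable_fun [set: T] (fun w => c * v w) by exact: measurable_funM.
  have inc : increases_to mu y (fun w => c * v w).
    apply: filterS fphi => w fw; split => //.
      move=> k l kl; rewrite /y le_min !ge_min lexx orbT andbT; apply/orP; left.
      by apply: fine_le => //; exact: mono.
    case: (pselect (A w)) => Aw; last first.
      rewrite /y /v indicE memNset// !mulr0.
      by apply: cvg_near_cst; apply: nearW => k; exact: min_r.
    apply: cvg_near_cst.
    have := cvphi w; rewrite Aw => /cvgeyPge/(_ (c * v w)); apply: filterS => k.
    by rewrite -(fineK (fw k)) lee_fin => h; exact: min_r.
  have [|_ cvE] := qb_fatou hX mcv (fun k => (Xy k).1) inc.
    by exists B => k; exact: le_trans (Xy k).2 (nx k).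
  rewrite -(fs_normZ hX)// cvE; apply: ge_sup.
    by exists (fnorm X (y 0%N)); exists 0%N.
  by move=> _ [k _ <-]; exact: le_trans (Xy k).2 (nx k).
have nv0 : fnorm X v = 0.
  apply/eqP; rewrite eq_le (qb_ge0 hX Xv) andbT leNgt; apply/negP => nv.
  have c0 : 0 <= (B + 1) / fnorm X v by rewrite divr_ge0 ?addr_ge0// ltW.
  by have := key _ c0; rewrite divfK ?gt_eqF// leNgt ltrDl ltr01.
have fs : {ae mu, forall w, s w \is a fin_num}.
  apply: filterS2 upos (qb_eq0 hX Xv nv0) => w uw vw.
  rewrite ge0_fin_numE// ltey; apply/eqP => Aw; move: vw.
  by rewrite /v indicE mem_set// mulr1 => /normr0_eq0 u0; rewrite u0 ltxx in uw.
have inc : increases_to mu x (fine \o s).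
  apply: filterS2 fphi fs => w fw sw; split => [k|k l kl|].
  - by rewrite fine_ge0.
  - by apply: fine_le => //; exact: mono.
  - by apply: fine_cvg; rewrite fineK//; exact: cvphi.
have [|Xs nsE] := qb_fatou hX (measurable_fine_comp ms) Xx inc; first by exists B.
rewrite /enorm; case: asboolP => [_|H]; last by exfalso; apply: H.
rewrite lee_fin nsE; apply: ge_sup; first by exists (fnorm X (x 0%N)); exists 0%N.
by move=> _ [k _ <-].
Qed.

(** The infima over tails increase to the lower limit, and each lies below a single bounded term; a
    bound at arbitrarily late indices is enough. *)
Lemma enorm_einf (phi : nat -> T -> \bar R) (B : R) :
  (forall k, measurable_fun [set: T] (phi k)) ->
  (forall k w, 0 <= phi k w)%E ->
  (forall k, exists2 l, (k <= l)%N & enorm mu X (phi l) <= B%:E)%E ->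
  (enorm mu X (fun w => limn_einf (phi ^~ w)) <= B%:E)%E.
Proof.
move=> mphi phi0 bnd.
have -> : (fun w => limn_einf (phi ^~ w)) =
    (fun w => ereal_sup (range ((fun k w => einfs (phi ^~ w) k) ^~ w))).
  apply/funext => w; rewrite limn_einf_lim; apply/cvg_lim => //.
  exact: cvg_einfs_sup.
have me k : measurable_fun [set: T] (fun w => einfs (phi ^~ w) k).
  exact: measurable_fun_einfs.
have e0 k w : (0 <= einfs (phi ^~ w) k)%E.
  by apply: le_ereal_inf_tmp => _ [l _ <-].
apply: enorm_fatou => //.
- by move=> w k l kl; exact: nondecreasing_einfs.
- move=> k; have [l kl hl] := bnd k.
  apply: le_trans hl; apply: enorm_le => //.
  apply: nearW => w; rewrite e0/=.
  by apply: ereal_inf_lbound; exists l.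
Qed.

End extended_norm.

Lemma pconvex_fin {R : realType} {dT : measure_display} {T : measurableType dT}
    (mu : {measure set T -> \bar R}) (X : fspace R T) (I : finType) (p : R)
    (xi : I -> T -> R) :
  quasi_banach mu X -> 0 < p -> pconvex p X -> (forall i, X (xi i)) ->
  X (fun w => (\sum_i `|xi i w| `^ p) `^ p^-1) /\
  fnorm X (fun w => (\sum_i `|xi i w| `^ p) `^ p^-1) `^ p
  <= \sum_i fnorm X (xi i) `^ p.
Proof.
move=> hX p0 cX Xxi.
pose z (k : 'I_#|I|) := xi (enum_val k).
have Xz k : X (z k) by exact: Xxi.
have E (F : I -> R) : \sum_i F i = \sum_(k < #|I|) F (enum_val k).
  by rewrite [LHS](reindex (@enum_val I I)) //; apply: onW_bij; exact: enum_val_bij.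
have -> : (fun w => (\sum_i `|xi i w| `^ p) `^ p^-1) =
    (fun w => (\sum_k `|z k w| `^ p) `^ p^-1).
  by apply/funext => w; rewrite E.
rewrite E; split; [exact: (fs_powR_sum hX)|exact: (pconvexE hX)].
Qed.

Lemma fs_prod_le {R : realType} {dT : measure_display} {T : measurableType dT}
    (mu : {measure set T -> \bar R}) m (X : 'I_m -> fspace R T)
    (xi : 'I_m -> T -> R) :
  (forall j, quasi_banach mu (X j)) ->
  (forall j, X j (xi j)) -> (forall j w, 0 <= xi j w) ->
  prod_space mu X (fun w => \prod_j xi j w) /\
  fnorm (prod_space mu X) (fun w => \prod_j xi j w) <= \prod_j fnorm (X j) (xi j).
Proof.
move=> hX Xxi xi0.
have f : factors mu X (fun w => \prod_j xi j w) xi.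
  split => //; apply: nearW => w; split => //.
  by rewrite ger0_norm// prodr_ge0.
split.
  split; last by exists xi.
  by apply: measurable_prod => j _; exact: (qb_measurable (hX j)).
apply: ge_inf; last by exists xi.
exists 0 => _ [xs [Xxs _] <-]; apply: prodr_ge0 => j _.
exact: (qb_ge0 (hX j)).
Qed.

Lemma powRVK {R : realType} (a p : R) : 0 < p -> 0 <= a -> (a `^ p^-1) `^ p = a.
Proof. by move=> p0 a0; rewrite -powRrM mulVf ?gt_eqF// powRr1. Qed.

Lemma powRKV {R : realType} (a p : R) : 0 < p -> 0 <= a -> (a `^ p) `^ p^-1 = a.
Proof. by move=> p0 a0; rewrite -powRrM divff ?gt_eqF// powRr1. Qed.

Lemma le_powR {R : realType} (a b p : R) : 0 <= p -> 0 <= a -> a <= b -> a `^ p <= b `^ p.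
Proof.
by move=> p0 a0 ab; apply: ge0_ler_powR => //; rewrite nnegrE// (le_trans a0).
Qed.

(** * Finite martingale trees *)

Section mean.
Context {R : realType} (E : finType).
Implicit Types F G : E -> R.

Definition mean F : R := #|E|%:R^-1 * \sum_e F e.

Lemma mean_ge0 F : (forall e, 0 <= F e) -> 0 <= mean F.
Proof. by move=> F0; rewrite mulr_ge0// sumr_ge0. Qed.

Lemma le_mean F G : (forall e, F e <= G e) -> mean F <= mean G.
Proof. by move=> FG; rewrite ler_wpM2l// ler_sum. Qed.

Lemma meanD F G : mean (fun e => F e + G e) = mean F + mean G.
Proof. by rewrite /mean big_split mulrDr. Qed.

Lemma meanZ (k : R) F : mean (fun e => k * F e) = k * mean F.
Proof. by rewrite /mean -mulr_sumr mulrCA. Qed.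

Lemma meanB F G : mean (fun e => F e - G e) = mean F - mean G.
Proof. by rewrite /mean sumrB mulrBr. Qed.

Lemma mean_sum (I : finType) (F : I -> E -> R) :
  mean (fun e => \sum_i F i e) = \sum_i mean (F i).
Proof. by rewrite /mean exchange_big mulr_sumr. Qed.

Lemma mean_cst (e0 : E) (k : R) : mean (fun=> k) = k.
Proof.
rewrite /mean sumr_const -(mulr_natl k) mulrA mulVf ?mul1r// pnatr_eq0.
by rewrite -lt0n; apply/card_gt0P; exists e0.
Qed.

Lemma mean_onem (e0 : E) F (k : R) :
  mean (fun e => (1 - F e) * k) = (1 - mean F) * k.
Proof.
have -> : mean (fun e => (1 - F e) * k) = mean (fun e => k + - k * F e).
  by congr mean; apply/funext => e; ring.
by rewrite meanD meanZ (mean_cst e0); ring.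
Qed.

Lemma le_mean_card F e : (forall e, 0 <= F e) -> F e <= #|E|%:R * mean F.
Proof.
move=> F0; rewrite /mean mulrA divff ?mul1r.
  by rewrite (bigD1 e)//= lerDl sumr_ge0.
by rewrite pnatr_eq0 -lt0n; apply/card_gt0P; exists e.
Qed.

Lemma mean_eq0 F e : (forall e, 0 <= F e) -> mean F = 0 -> F e = 0.
Proof.
move=> F0 F1; apply/le_anti; rewrite F0 andbT.
by have := le_mean_card e F0; rewrite F1 mulr0.
Qed.

End mean.

(* Finite martingale trees.  A leaf carries a vector (a_j) with a_j in X_j,
   upper bounds v_j for the norms of the a_j, and a weight; every node has the
   children (c e), e in E, of equal mass. *)
Section tree.
Context {R : realType} (T : Type) (E : finType) (m : nat).

Inductive tree :=
  | Leaf of ('I_m -> T -> R) & ('I_m -> R) & R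
  | Node of (E -> tree).

Variable r : 'I_m -> R.

Fixpoint powA j t (w : T) : R := match t with
  | Leaf a _ _ => a j w `^ r j
  | Node c => mean (fun e => powA j (c e) w)
  end.

Definition treeA j t w := powA j t w `^ (r j)^-1.

Fixpoint powN j t : R := match t with
  | Leaf _ v _ => v j `^ r j
  | Node c => mean (fun e => powN j (c e))
  end.

Definition treeN j t := powN j t `^ (r j)^-1.

Fixpoint treeW t : R := match t with
  | Leaf _ _ w => w
  | Node c => mean (fun e => treeW (c e))
  end.

Definition prodA t w := \prod_j treeA j t w.
Definition prodN t := \prod_j treeN j t.
Definition supA (xi : T -> R) t w := Num.max (xi w) (prodA t w).
(** When the weights are averages of |g|^q, this is the q-th power of the term of M_(r,q) at the
    cube of the node. *)
Definition treeG q t := prodN t `^ q * treeW t.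

(* H q t g is the average over the leaves of the maximum of g and of the
   numbers G q u for u above the leaf *)
Fixpoint treeH q t g : R := match t with
  | Leaf _ _ _ => Num.max g (treeG q t)
  | Node c => mean (fun e => treeH q (c e) (Num.max g (treeG q t)))
  end.

Variable P : fspace R T.

(* S q t xi is the weighted average over the leaves of the q-th power of the
   norm of the maximum of xi and of the functions prodA u for u above the leaf *)
Fixpoint treeS q t xi : R := match t with
  | Leaf _ _ w => fnorm P (supA xi t) `^ q * w
  | Node c => mean (fun e => treeS q (c e) (supA xi t))
  end.

(** Testing at the leaves loses nothing on good trees: the running maximum grows downwards, so an
    excess at a node persists at all leaves below it. *)
Fixpoint exceed (s : R) t xi : R := match t with
  | Leaf _ _ _ => if s < fnorm P (supA xi t) then 1 else 0
  | Node c => mean (fun e => exceed s (c e) (supA xi t))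
  end.

Definition stop1 (tau : 'I_m -> R) t := [exists j, tau j < treeN j t].

Fixpoint massN (tau : 'I_m -> R) j t : R :=
  if tau j < treeN j t then 1 else
  match t with
  | Leaf _ _ _ => 0
  | Node c => mean (fun e => massN tau j (c e))
  end.

(* proportion of the leaves lying below a node where either some treeN or the
   norm of the maximum jumps over its threshold *)
Fixpoint stopped (tau : 'I_m -> R) (s : R) t xi : R :=
  if stop1 tau t || (s < fnorm P (supA xi t)) then 1 else
  match t with
  | Leaf _ _ _ => 0
  | Node c => mean (fun e => stopped tau s (c e) (supA xi t))
  end.

(** Conditional expectation at the first nodes where some [treeN] jumps: the new leaf keeps the
    averages of the subtree it replaces, so no average at or above it changes. *)
Fixpoint prune (tau : 'I_m -> R) t : tree :=
  if stop1 tau t then Leaf (treeA^~ t) (treeN^~ t) (treeW t) else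
  match t with
  | Leaf _ _ _ => t
  | Node c => Node (fun e => prune tau (c e))
  end.

Variable X : 'I_m -> fspace R T.

Fixpoint good t : Prop := match t with
  | Leaf a v w => [/\ forall j, X j (a j), forall j x, 0 <= a j x,
      forall j, fnorm (X j) (a j) <= v j & 0 <= w]
  | Node c => forall e, good (c e)
  end.

Fixpoint leaves_le (B : 'I_m -> R) t : Prop := match t with
  | Leaf _ v _ => forall j, v j <= B j
  | Node c => forall e, leaves_le B (c e)
  end.

End tree.

Arguments Leaf {R T E m}.
Arguments Node {R T E m}.

Section tree_theory.
Context {R : realType} {dT : measure_display} {T : measurableType dT}.
Variable mu : {measure set T -> \bar R}.
Context (E : finType) (m : nat) (e0 : E).
Variables (X : 'I_m -> fspace R T) (r : 'I_m -> R).
Hypothesis hX : forall j, quasi_banach mu (X j).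
Hypothesis r0 : forall j, 0 < r j.
Hypothesis cX : forall j, pconvex (r j) (X j).
Variable P : fspace R T.
Hypothesis hP : quasi_banach mu P.
Hypothesis PX : forall xi : 'I_m -> T -> R,
  (forall j, X j (xi j)) -> (forall j w, 0 <= xi j w) ->
  P (fun w => \prod_j xi j w) /\
  fnorm P (fun w => \prod_j xi j w) <= \prod_j fnorm (X j) (xi j).

Notation tree := (@tree R T E m).
Implicit Types (t u : tree) (xi eta : T -> R).

Lemma powA_ge0 j t w : 0 <= powA r j t w.
Proof. by elim: t => [a v u|c IH]/=; [exact: powR_ge0|exact: mean_ge0]. Qed.

Lemma powN_ge0 j t : 0 <= powN r j t.
Proof. by elim: t => [a v u|c IH]/=; [exact: powR_ge0|exact: mean_ge0]. Qed.

Lemma treeA_ge0 j t w : 0 <= treeA r j t w. Proof. exact: powR_ge0. Qed.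
Lemma treeN_ge0 j t : 0 <= treeN r j t. Proof. exact: powR_ge0. Qed.
Lemma prodA_ge0 t w : 0 <= prodA r t w.
Proof. by apply: prodr_ge0 => j _; exact: treeA_ge0. Qed.
Lemma prodN_ge0 t : 0 <= prodN r t.
Proof. by apply: prodr_ge0 => j _; exact: treeN_ge0. Qed.

Lemma treeW_ge0 t : good X t -> 0 <= treeW t.
Proof. by elim: t => [a v w []//|c IH gc]/=; apply: mean_ge0 => e; exact: IH. Qed.

Lemma treeG_ge0 q t : good X t -> 0 <= treeG r q t.
Proof. by move=> gt; rewrite mulr_ge0 ?powR_ge0 ?treeW_ge0. Qed.

Lemma treeN_powR j t : treeN r j t `^ r j = powN r j t.
Proof. by rewrite powRVK ?powN_ge0. Qed.

Lemma treeA_powR j t w : treeA r j t w `^ r j = powA r j t w.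
Proof. by rewrite powRVK ?powA_ge0. Qed.

(** Minkowski's inequality on a tree: with the factor #|E|^(-1/r_j) put on each child, the mean of
    r_j-th powers becomes the l^(r_j) sum to which r_j-convexity applies. *)
Lemma treeA_norm j t : good X t ->
  X j (treeA r j t) /\ fnorm (X j) (treeA r j t) `^ r j <= powN r j t.
Proof.
elim: t => [a v w [Xa a_ge0 av _]|c IH gc].
  have -> : treeA r j (Leaf a v w : tree) = a j.
    by apply/funext => x; rewrite /treeA/= powRKV.
  split => //=; apply: le_powR => //; first exact: ltW.
  by apply: (qb_ge0 (hX j)).
pose k : R := #|E|%:R^-1 `^ (r j)^-1.
have k0 : 0 <= k by exact: powR_ge0.
pose z e w := k * treeA r j (c e) w.
have Xc e : X j (treeA r j (c e)) by have [] := IH e (gc e).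
have Xz e : X j (z e) by exact: (qb_scale (hX j)).
have zE : treeA r j (Node c) = (fun w => (\sum_e `|z e w| `^ r j) `^ (r j)^-1).
  apply/funext => w; rewrite /treeA/=; congr (_ `^ _).
  rewrite /mean mulr_sumr; apply: eq_bigr => e _.
  rewrite ger0_norm ?mulr_ge0 ?treeA_ge0//.
  by rewrite powRM ?treeA_ge0// treeA_powR powRVK.
have [X1 n1] := pconvex_fin (hX j) (r0 j) (@cX j) Xz.
rewrite zE; split => //; apply: (le_trans n1) => /=.
rewrite /mean mulr_sumr; apply: ler_sum => e _.
rewrite (fs_normZ (hX j))// powRM//; last exact: (qb_ge0 (hX j)).
rewrite powRVK// ler_wpM2l//.
by have [] := IH e (gc e).
Qed.

Lemma treeA_le j t : good X t -> fnorm (X j) (treeA r j t) <= treeN r j t.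
Proof.
move=> gt; have [Xa na] := treeA_norm j gt.
rewrite -[leLHS](@powRKV _ _ (r j))//; last exact: (qb_ge0 (hX j)).
by apply: le_powR => //; rewrite ?powR_ge0// invr_ge0 ltW.
Qed.

Lemma prodA_norm t : good X t -> P (prodA r t) /\ fnorm P (prodA r t) <= prodN r t.
Proof.
move=> gt.
have [X1 n1] := PX (fun j => (treeA_norm j gt).1)
  (fun j w => treeA_ge0 j t w).
split => //; apply: (le_trans n1); apply: ler_prod => j _.
by rewrite treeA_le// andbT; apply: (qb_ge0 (hX j)); exact: (treeA_norm j gt).1.
Qed.

Lemma supA_in xi t : good X t -> P xi -> P (supA r xi t).
Proof. by move=> gt Pxi; apply: (fs_max hP) => //; have [] := prodA_norm gt. Qed.

Lemma supA_ge0 xi t w : 0 <= supA r xi t w.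
Proof. by rewrite le_max prodA_ge0 orbT. Qed.

Lemma fnorm_supA0 t : good X t -> fnorm P (supA r (fun=> 0) t) = fnorm P (prodA r t).
Proof.
move=> gt; congr (fnorm P _); apply/funext => w.
by rewrite /supA max_r// prodA_ge0.
Qed.

Lemma fnorm_supA_ge xi t : good X t -> P xi -> (forall w, 0 <= xi w) ->
  fnorm P xi <= fnorm P (supA r xi t).
Proof.
move=> gt Pxi xi0.
have [|//] := fs_le hP (qb_measurable hP Pxi) (supA_in gt Pxi).
by apply: nearW => w; rewrite !ger0_norm ?supA_ge0// le_max lexx.
Qed.

Lemma fnorm_ge0 xi : P xi -> 0 <= fnorm P xi.
Proof. exact: (qb_ge0 hP). Qed.

Section domination.
Variable q : R.
Hypothesis q0 : 0 < q.
Hypothesis cP : pconvex q P.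

(** By q-convexity the running maximum can forget its past: at each leaf [xi] costs the q-th power
    of its own norm times the weight, and the rest runs on from [eta]. At stopping nodes this is
    used with [eta] equal to 0. *)
Lemma treeS_max t xi eta : good X t -> P xi -> P eta ->
  treeS r P q t (fun w => Num.max (xi w) (eta w))
  <= fnorm P xi `^ q * treeW t + treeS r P q t eta.
Proof.
elim: t xi eta => [a v w|c IH] xi eta gt Pxi Peta.
  have E1 : supA r (fun w => Num.max (xi w) (eta w)) (Leaf a v w : tree) =
    fun x => Num.max (xi x) (supA r eta (Leaf a v w : tree) x).
    by apply/funext => x; rewrite /supA maxA.
  case: (gt) => _ _ _ w0.
  rewrite /= E1 -mulrDl ler_wpM2r//.
  by apply: (pconvex_max hP) => //; exact: supA_in.
have E1 : supA r (fun w => Num.max (xi w) (eta w)) (Node c) =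
    fun x => Num.max (xi x) (supA r eta (Node c) x).
  by apply/funext => x; rewrite /supA maxA.
rewrite /= E1 -meanZ -meanD; apply: le_mean => e.
by apply: IH => //; exact: supA_in.
Qed.

(** Settles the trees on which thresholds proportional to the averages would vanish. A zero average
    is inherited by every node below, so all products there have norm 0 and the norm of the maximum
    never grows. *)
Lemma treeS_zero t xi j : good X t -> P xi -> powN r j t = 0 ->
  treeS r P q t xi <= fnorm P xi `^ q * treeW t.
Proof.
have zero (s : tree) eta : good X s -> P eta -> powN r j s = 0 ->
    fnorm P (supA r eta s) `^ q <= fnorm P eta `^ q.
  move=> gs Peta N0; have [PA nA] := prodA_norm gs.
  apply: (le_trans (pconvex_max hP q0 cP Peta PA)).
  suff -> : fnorm P (prodA r s) = 0 by rewrite powR0 ?gt_eqF// addr0.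
  apply/le_anti; rewrite fnorm_ge0// andbT; apply: (le_trans nA).
  by rewrite /prodN (bigD1 j)//= /treeN N0 powR0 ?mul0r// gt_eqF// invr_gt0.
elim: t xi => [a v w|c IH] xi gt Pxi N0.
  by case: (gt) => _ _ _ w0; rewrite /= ler_wpM2r//; exact: (zero (Leaf a v w) xi).
have Nc e : powN r j (c e) = 0.
  exact: (@mean_eq0 _ _ (fun e => powN r j (c e)) e (fun e => powN_ge0 j (c e)) N0).
rewrite /= -meanZ; apply: le_mean => e.
apply: (le_trans (IH e _ (gt e) (supA_in gt Pxi) (Nc e))).
rewrite ler_wpM2r//; [exact: (treeW_ge0 (gt e))|exact: (zero (Node c) xi)].
Qed.

Lemma treeH_ge t g : g <= treeH r q t g.
Proof.
elim: t g => [a v w|c IH] g /=; first by rewrite le_max lexx.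
rewrite -[leLHS](mean_cst e0); apply: le_mean => e; apply: le_trans (IH _ _).
by rewrite le_max lexx.
Qed.

Lemma le_treeH t g g' : g <= g' -> treeH r q t g <= treeH r q t g'.
Proof.
elim: t g g' => [a v w|c IH] g g' gg' /=; first by rewrite ge_max !le_max gg' lexx orbT.
by apply: le_mean => e; apply: IH; rewrite ge_max !le_max gg' lexx orbT.
Qed.

Lemma massN_ge0 tau j t : 0 <= massN r tau j t.
Proof. by elim: t => [a v u|c IH]/=; case: ifP => // _; exact: mean_ge0. Qed.

Lemma exceed_ge0 s t xi : 0 <= exceed r P s t xi.
Proof. by elim: t xi => [a v u|c IH] xi /=; [case: ifP|exact: mean_ge0]. Qed.

(* weak type (1,1) for the scalar martingale maximal function *)
Lemma massN_weak tau j t : 0 <= tau j ->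
  massN r tau j t * tau j `^ r j <= powN r j t.
Proof.
move=> tau0.
have stop (s : tree) : tau j < treeN r j s -> 1 * tau j `^ r j <= powN r j s.
  move=> h; rewrite mul1r -treeN_powR; apply: le_powR => //; exact: ltW.
elim: t => [a v u|c IH]; rewrite [massN _ _ _ _]/=; case: ifPn => h; try exact: stop.
  by rewrite mul0r powN_ge0.
by rewrite mulrC -meanZ; apply: le_mean => e; rewrite mulrC.
Qed.

Lemma exceed_one s t xi : good X t -> P xi -> (forall w, 0 <= xi w) ->
  s < fnorm P (supA r xi t) -> exceed r P s t xi = 1.
Proof.
elim: t xi => [a v u|c IH] xi gt Pxi xi0 h /=; first by rewrite h.
rewrite (_ : (fun e => _) = fun=> 1) ?(mean_cst e0)//; apply/funext => e.
have Ps := supA_in gt Pxi.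
apply: IH => //; first by move=> w; exact: supA_ge0.
by apply: (lt_le_trans h); apply: fnorm_supA_ge => // w; exact: supA_ge0.
Qed.

Lemma powA_prune tau j t w : powA r j (prune r tau t) w = powA r j t w.
Proof.
have cut (s : tree) : powA r j (Leaf (treeA r ^~ s) (treeN r ^~ s) (treeW s) : tree) w =
    powA r j s w by rewrite /= treeA_powR.
elim: t => [a v u|c IH]; rewrite [prune _ _ _]/=; case: ifP => _ //.
by rewrite /=; congr mean; apply/funext => e; exact: IH.
Qed.

Lemma prodA_prune tau t : prodA r (prune r tau t) = prodA r t.
Proof.
by apply/funext => w; apply: eq_bigr => j _; rewrite /treeA powA_prune.
Qed.

Lemma good_prune tau t : good X t -> good X (prune r tau t).
Proof.
have cut (s : tree) : good X s -> good X (Leaf (treeA r ^~ s) (treeN r ^~ s) (treeW s) : tree).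
  move=> gs; split=> [j|j w|j|]; [exact: (treeA_norm j gs).1|exact: treeA_ge0| |].
    exact: treeA_le.
  exact: treeW_ge0.
elim: t => [a v u|c IH] gt; rewrite [prune _ _ _]/=; case: ifP => _ //; try exact: cut.
by move=> e; exact: IH.
Qed.

(** The parent of a node reached by the pruning did not stop, and passing to one of #|E| children
    multiplies a mean by at most #|E|. The assumption on [powN] is this bound at the current root,
    in the form that the induction carries. *)
Lemma leaves_prune tau t : (forall j, 0 <= tau j) -> good X t ->
  (forall j, powN r j t <= #|E|%:R * tau j `^ r j) ->
  leaves_le (fun j => #|E|%:R `^ (r j)^-1 * tau j) (prune r tau t).
Proof.
move=> tau0.
have root (s : tree) : (forall j, powN r j s <= #|E|%:R * tau j `^ r j) ->
    forall j, treeN r j s <= #|E|%:R `^ (r j)^-1 * tau j.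
  move=> h j; rewrite -[X in _ * X](@powRKV _ _ (r j))// -powRM ?powR_ge0//.
  by apply: le_powR; rewrite ?powN_ge0// invr_ge0 ltW.
elim: t => [a v u|c IH] gt h; rewrite [prune _ _ _]/=; case: ifPn => sp; try exact: root.
  move=> /= j; have := root _ h j; rewrite /treeN/= powRKV//.
  by case: gt => Xa _ /(_ j) av _; apply: le_trans av; apply: (qb_ge0 (hX j)).
move=> e; apply: IH => // j.
apply: (@le_trans _ _ (#|E|%:R * powN r j (Node c))).
  by apply: le_mean_card => e'; exact: powN_ge0.
rewrite ler_wpM2l// -treeN_powR.
apply: le_powR; [exact: ltW|exact: treeN_ge0|].
by rewrite leNgt; move: sp; rewrite negb_exists => /forallP/(_ j).
Qed.

(** Mass stopped by some [treeN] is charged to [massN]. Where the norm jumps first, pruning has not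
    altered the averages met so far ([prodA_prune]), so the same excess occurs in the pruned
    tree. *)
Lemma stopped_le tau s t xi : good X t -> P xi -> (forall w, 0 <= xi w) ->
  stopped r P tau s t xi <= \sum_j massN r tau j t + exceed r P s (prune r tau t) xi.
Proof.
have st1 (u : tree) y : stop1 r tau u -> 0 <= y -> 1 <= \sum_j massN r tau j u + y.
  move=> /existsP[j hj] y0; rewrite (bigD1 j)//= -addrA.
  have -> : massN r tau j u = 1 by case: u hj => [a v w|c] /= ->.
  by rewrite lerDl addr_ge0// sumr_ge0// => i _; exact: massN_ge0.
have S0 (u : tree) : 0 <= \sum_j massN r tau j u by apply: sumr_ge0 => j _; exact: massN_ge0.
have st2 (u : tree) eta : good X u -> P eta -> (forall w, 0 <= eta w) ->
    s < fnorm P (supA r eta u) ->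
    1 <= \sum_j massN r tau j u + exceed r P s (prune r tau u) eta.
  move=> gu Peta eta0 h; rewrite (@exceed_one _ _ eta) ?lerDr//; first exact: good_prune.
  suff -> : supA r eta (prune r tau u) = supA r eta u by [].
  by rewrite /supA prodA_prune.
elim: t xi => [a v u|c IH] xi gt Pxi xi0.
  rewrite [stopped _ _ _ _ _ _]/=; case: ifP => [/orP[h|h]|_].
  - by apply: st1 => //; exact: exceed_ge0.
  - exact: st2.
  - by rewrite addr_ge0 ?exceed_ge0.
rewrite [stopped _ _ _ _ _ _]/=; case: ifPn => [/orP[h|h]|].
- by apply: st1 => //; exact: exceed_ge0.
- exact: st2.
rewrite negb_or => /andP[h1 h2].
have Pc : prune r tau (Node c) = Node (fun e => prune r tau (c e)).
  by rewrite [LHS]/= (negbTE h1).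
have E2 : supA r xi (prune r tau (Node c)) = supA r xi (Node c).
  by rewrite /supA prodA_prune.
rewrite Pc /= -Pc E2.
have -> : \sum_j massN r tau j (Node c) = mean (fun e => \sum_j massN r tau j (c e)).
  rewrite mean_sum; apply: eq_bigr => j _ /=; rewrite ifF//.
  by apply/negbTE; move: h1; rewrite negb_exists => /forallP/(_ j).
rewrite -meanD; apply: le_mean => e; apply: IH => //; first exact: supA_in.
by move=> w; exact: supA_ge0.
Qed.

Variables (K Lam : R).
Hypothesis K1 : 1 <= K.
Hypothesis Lam1 : 1 <= Lam.
Hypothesis LamE : \sum_j Lam `^ (- r j) <= 4^-1.

Hypothesis HT : forall (t : tree) (B : 'I_m -> R), good X t ->
  (forall j, 0 < B j) -> leaves_le B t ->
  exceed r P (K * \prod_j B j) t (fun=> 0) <= 4^-1.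

(** With thresholds [Lam * treeN] the pruned leaves overshoot by at most #|E|^(1/r_j), so [HT]
    applies to the pruned tree at height [Lam' * prodN]. *)
Let Lam' := K * \prod_j (#|E|%:R `^ (r j)^-1 * Lam).

Lemma tree_const_ge1 : 1 <= Lam'.
Proof.
rewrite /Lam' -[leLHS]mul1r; apply: ler_pM => //.
have F1 j : 1 <= #|E|%:R `^ (r j)^-1 * Lam.
  rewrite -[leLHS]mul1r; apply: ler_pM => //.
  rewrite -[leLHS](powRr0 (#|E|%:R : R)).
  apply: ler_powR; last by rewrite invr_ge0; exact: ltW.
  by rewrite ler1n; apply/card_gt0P; exists e0.
by elim/big_ind : _ => // x y x1 y1; rewrite -[leLHS]mul1r ler_pM.
Qed.

Lemma stopped_half t : good X t -> (forall j, 0 < treeN r j t) ->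
  stopped r P (fun j => Lam * treeN r j t) (Lam' * prodN r t) t (fun=> 0) <= 2^-1.
Proof.
move=> gt N0.
set tau := fun j => _.
have L0 : 0 < Lam by exact: lt_le_trans Lam1.
have tau0 j : 0 <= tau j by rewrite mulr_ge0 ?treeN_ge0//; exact: ltW.
apply: (le_trans (stopped_le _ _ gt (fs_0 hP) _)) => //.
(* One quarter for each reason to stop: [massN_weak] with [LamE] for the averages, [HT] on the
   pruned tree for the norm. *)
have -> : 2^-1 = 4^-1 + 4^-1 :> R by lra.
apply: lerD.
  apply: le_trans LamE; apply: ler_sum => j _.
  have := massN_weak t (tau0 j).
  rewrite -treeN_powR [tau j]/(_ * _) powRM; [|exact: ltW|exact: treeN_ge0].
  have P0 : 0 < treeN r j t `^ r j by rewrite powR_gt0.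
  rewrite mulrA -[X in _ <= X]mul1r (ler_pM2r P0) powRN => h.
  by rewrite -[X in _ <= X]mul1r ler_pdivlMr// powR_gt0.
have E1 : #|E| != 0%N by rewrite -lt0n; apply/card_gt0P; exists e0.
have E0 : 0 < #|E|%:R :> R by rewrite ltr0n lt0n.
have -> : Lam' * prodN r t = K * \prod_j (#|E|%:R `^ (r j)^-1 * tau j).
  rewrite /Lam' -mulrA -big_split/=; congr (_ * _); apply: eq_bigr => j _.
  by rewrite /tau !mulrA.
apply: HT.
- exact: good_prune.
- by move=> j; rewrite mulr_gt0 ?powR_gt0 ?mulr_gt0.
- apply: leaves_prune => // j; rewrite -treeN_powR.
  rewrite -[leLHS]mul1r; apply: ler_pM; rewrite ?powR_ge0//.
    by rewrite ler1n lt0n.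
  apply: le_powR; [exact: ltW|exact: treeN_ge0|].
  by rewrite ler_peMl ?treeN_ge0.
Qed.

Let kappa := 2 * Lam' `^ q.

(* The second estimate is relative to thresholds: until a stopping node the
   maximum has norm at most s, which costs s^q * treeW t; a stopping node restarts
   the first estimate, and the mass that does not stop is credited back as
   (1 - stopped) * g.  At the root the thresholds are chosen so that at most half
   of the mass stops, and this credit then absorbs s^q * treeW t. *)
Lemma treeS_descent t : good X t ->
  treeS r P q t (fun=> 0) <= kappa * treeH r q t 0 /\
  forall tau s g xi, P xi -> (forall w, 0 <= xi w) -> fnorm P xi <= s -> 0 <= g ->
    treeS r P q t xi <= s `^ q * treeW t
      + kappa * (treeH r q t g - (1 - stopped r P tau s t xi) * g).
Proof.
have L1 := tree_const_ge1.
have L0 : 0 <= Lam' by exact: le_trans L1.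
have kappa1 : 1 <= kappa.
  rewrite /kappa -[leLHS]mul1r; apply: ler_pM => //; first by rewrite ler1n.
  by have := le_powR (ltW q0) ler01 L1; rewrite powR1.
have k0 : 0 <= kappa by exact: le_trans kappa1.
(* At a stopping node the past is split off and the first estimate restarts from 0. The factor 1 - 1
   says that no credit is left there, and [treeH] only grows when it starts from g instead of 0. *)
have stopcase (u : tree) s g xi : good X u -> treeS r P q u (fun=> 0) <= kappa * treeH r q u 0 ->
    P xi -> (forall w, 0 <= xi w) -> fnorm P xi <= s -> 0 <= g ->
    treeS r P q u xi <= s `^ q * treeW u + kappa * (treeH r q u g - (1 - 1) * g).
  move=> gu mu_ Pxi xi0 xis g0.
  have -> : xi = (fun w => Num.max (xi w) 0) by apply/funext => w; rewrite max_l.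
  apply: (le_trans (treeS_max gu Pxi (fs_0 hP))); apply: lerD.
    rewrite ler_wpM2r ?treeW_ge0//.
    by apply: le_powR xis; [exact: ltW|exact: fnorm_ge0].
  rewrite subrr mul0r subr0; apply: (le_trans mu_).
  by rewrite ler_wpM2l//; exact: le_treeH.
elim: t => [a v u|c IH] gt.
  have main : treeS r P q (Leaf a v u : tree) (fun=> 0)
      <= kappa * treeH r q (Leaf a v u : tree) 0.
    have [_ _ _ u0] := gt.
    rewrite [treeS _ _ _ _ _]/= [treeH _ _ _ _]/= max_r; last exact: treeG_ge0.
    rewrite -[leLHS]mul1r; apply: ler_pM => //.
      by rewrite mulr_ge0// powR_ge0.
    rewrite /treeG/= ler_wpM2r// le_powR//; first exact: ltW.
      by apply: fnorm_ge0; apply: supA_in => //; exact: (fs_0 hP).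
    by rewrite fnorm_supA0//; have [] := prodA_norm gt.
  split => // tau s g xi Pxi xi0 xis g0.
  rewrite [stopped _ _ _ _ _ _]/=; case: ifPn => [_|]; first exact: stopcase.
  rewrite negb_or => /andP[_ h2].
  have [_ _ _ u0] := gt.
  rewrite [treeS _ _ _ _ _]/= -[leLHS]addr0; apply: lerD.
    rewrite ler_wpM2r// le_powR//; first exact: ltW.
      by apply: fnorm_ge0; apply: supA_in.
    by rewrite leNgt.
  by rewrite subr0 mul1r mulr_ge0// subr_ge0; exact: treeH_ge.
have main : treeS r P q (Node c) (fun=> 0) <= kappa * treeH r q (Node c) 0.
  have H0 : 0 <= kappa * treeH r q (Node c) 0 by rewrite mulr_ge0//; exact: treeH_ge.
  have [[j Nj0]|N0] := pselect (exists j, treeN r j (Node c) = 0).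
    have Nj : powN r j (Node c) = 0.
      by rewrite -treeN_powR Nj0 powR0// gt_eqF.
    apply: (le_trans (treeS_zero gt (fs_0 hP) Nj)).
    by rewrite (fs_norm0 hP) powR0 ?gt_eqF// mul0r.
  have Npos j : 0 < treeN r j (Node c).
    rewrite lt_def treeN_ge0 andbT; apply/eqP => h; apply: N0; by exists j.
  set tau := fun j => Lam * treeN r j (Node c).
  set s := Lam' * prodN r (Node c).
  set g := treeG r q (Node c).
  have g0 : 0 <= g by exact: treeG_ge0.
  have nA : fnorm P (supA r (fun=> 0) (Node c)) <= s.
    rewrite fnorm_supA0//; apply: (le_trans (prodA_norm gt).2).
    by rewrite ler_peMl ?prodN_ge0.
  (* The root itself does not stop, because [Lam] and [Lam'] are at least 1 and both tests are
     strict. Hence the stopped mass is the mean [M] over the children. *)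
  have := stopped_half gt Npos; rewrite -/tau -/s [stopped _ _ _ _ _ _]/= ifF; last first.
    apply/negbTE; rewrite negb_or negb_exists -leNgt nA andbT.
    by apply/forallP => j; rewrite -leNgt ler_peMl ?treeN_ge0.
  set M := mean _ => Mle.
  have E3 : treeH r q (Node c) 0 = mean (fun e => treeH r q (c e) g).
    by rewrite [LHS]/= -/g max_r.
  have step : treeS r P q (Node c) (fun=> 0) <=
      s `^ q * treeW (Node c) + kappa * (treeH r q (Node c) 0 - (1 - M) * g).
    rewrite E3 [treeS _ _ _ _ _]/=.
    have -> : s `^ q * treeW (Node c) +
        kappa * (mean (fun e => treeH r q (c e) g) - (1 - M) * g) =
      mean (fun e => s `^ q * treeW (c e) + kappa * (treeH r q (c e) g -
        (1 - stopped r P tau s (c e) (supA r (fun=> 0) (Node c))) * g)).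
      by rewrite meanD !meanZ meanB mean_onem.
    apply: le_mean => e; apply: (IH e (gt e)).2 => //.
      by apply: supA_in => //; exact: (fs_0 hP).
    by move=> w; exact: supA_ge0.
  apply: (le_trans step).
  (* The debt is Lam'^q g, the credit is kappa (1 - M) g with M <= 1/2; this is why [kappa] contains
     the factor 2. *)
  have -> : s `^ q * treeW (Node c) = Lam' `^ q * g.
    by rewrite /s powRM ?prodN_ge0// -mulrA.
  have Lq : 0 <= Lam' `^ q * g by rewrite mulr_ge0 ?powR_ge0.
  have : 2 * (Lam' `^ q * g) * (1 - M) >= Lam' `^ q * g.
    have -> : 2 * (Lam' `^ q * g) * (1 - M) = (Lam' `^ q * g) * (2 * (1 - M)) by ring.
    by rewrite ler_peMr//; lra.
  by rewrite /kappa; lra.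
split => // tau s g xi Pxi xi0 xis g0.
rewrite [stopped _ _ _ _ _ _]/=; case: ifPn => [_|]; first exact: stopcase.
rewrite negb_or -leNgt => /andP[_ h2].
have E1 : s `^ q * treeW (Node c) +
    kappa * (mean (fun e => treeH r q (c e) g)
      - (1 - mean (fun e => stopped r P tau s (c e) (supA r xi (Node c)))) * g) =
  mean (fun e => s `^ q * treeW (c e) + kappa * (treeH r q (c e) g -
    (1 - stopped r P tau s (c e) (supA r xi (Node c))) * g)).
  by rewrite meanD !meanZ meanB mean_onem.
apply: (@le_trans _ _ (s `^ q * treeW (Node c) +
    kappa * (mean (fun e => treeH r q (c e) g)
      - (1 - mean (fun e => stopped r P tau s (c e) (supA r xi (Node c)))) * g))).
  rewrite E1 [treeS _ _ _ _ _]/=; apply: le_mean => e; apply: (IH e (gt e)).2 => //.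
    exact: supA_in.
  by move=> w; exact: supA_ge0.
rewrite lerD2l ler_wpM2l// lerD2r /=; apply: le_mean => e.
by apply: le_treeH; rewrite le_max lexx.
Qed.

End domination.
End tree_theory.

(** * Lattice suprema, cubes and averages *)

Section lower_integral.
Local Open Scope ereal_scope.
Context d (T : measurableType d) (R : realType) (mu : {measure set T -> \bar R}).
Import HBNNSimple.

(* the integral of a nonnegative function is a supremum over simple functions,
   so that monotonicity needs no measurability *)
Lemma le_lower_integral (D : set T) (f g : T -> \bar R) :
  (forall x, D x -> 0 <= f x) -> (forall x, D x -> f x <= g x) ->
  \int[mu]_(x in D) f x <= \int[mu]_(x in D) g x.
Proof.
move=> f0 fg; rewrite !ge0_integralE//; last first.
  by move=> x Dx; exact: le_trans (f0 x Dx) (fg x Dx).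
apply: ereal_sup_le => _ [h hf <-]; exists h => // x; apply: (le_trans (hf x)).
by rewrite /patch; case: ifPn => // /set_mem; exact: fg.
Qed.

(** A simple function below f, set to 0 on a measurable null set, keeps its integral and then lies
    below g; neither f nor g has to be approximated. *)
Lemma ae_le_lower_integral (D : set T) (f g : T -> \bar R) :
  (forall x, D x -> 0 <= f x) -> (forall x, D x -> 0 <= g x) ->
  {ae mu, forall x, D x -> f x <= g x} ->
  \int[mu]_(x in D) f x <= \int[mu]_(x in D) g x.
Proof.
move=> f0 g0 [N [mN N0 sN]].
rewrite {1}ge0_integralE//; apply: ge_ereal_sup => _ [h hf <-].
have mNC : measurable (~` N) by exact: measurableC.
pose h' := proj_nnsfun h mNC.
have -> : sintegral mu h = \int[mu]_x (h' x)%:E.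
  rewrite -integralT_nnsfun; apply: ae_eq_integral => //.
  - exact/measurable_EFinP.
  - exact/measurable_EFinP.
  exists N; split => // x /=; apply: contra_notP => Nx _.
  by rewrite /h' /= mindicE mem_set// mulr1.
rewrite [leRHS]integral_mkcond; apply: le_lower_integral => [x _|x _].
  by rewrite lee_fin.
rewrite /h' /= mindicE; have [Nx|Nx] := boolP (x \in ~` N); last first.
  rewrite mulr0 /patch; case: ifPn => // /set_mem; exact: g0.
rewrite mulr1; apply: (le_trans (hf x)).
rewrite /patch; case: ifPn => // /set_mem Dx.
apply: contrapT => h1; move/set_mem : Nx; apply; apply: sN => /=.
by move/(_ Dx).
Qed.

Lemma ae_eq_lower_integral (D : set T) (f g : T -> \bar R) :
  (forall x, D x -> 0 <= f x) -> (forall x, D x -> 0 <= g x) ->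
  {ae mu, forall x, f x = g x} ->
  \int[mu]_(x in D) f x = \int[mu]_(x in D) g x.
Proof.
move=> f0 g0 fg; apply/le_anti/andP; split; apply: ae_le_lower_integral => //;
  by apply: filterS fg => x ->.
Qed.

End lower_integral.

Section lattice_sup.
Context {R : realType} {dT : measure_display} {T : measurableType dT}.
Variable mu : {measure set T -> \bar R}.
Implicit Types (F : set (T -> \bar R)).
Local Open Scope ereal_scope.

Lemma measurable_ereal_sup (h : nat -> T -> \bar R) :
  (forall k, measurable_fun [set: T] (h k)) ->
  measurable_fun [set: T] (fun w => ereal_sup (range (h ^~ w))).
Proof.
move=> mh; have := measurable_fun_esups mh 0%N; congr (measurable_fun _ _).
apply/funext => w; rewrite /esups/= /sdrop; congr ereal_sup.
by apply/seteqP; split => _ [k _ <-]; exists k.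
Qed.

(** A lattice supremum is a pointwise one as soon as countably many members dominate each member
    almost everywhere. The alternative [cst 0] pads a finite family to a sequence, in accordance
    with the supremum of the empty family being 0. *)
Lemma lattice_supP F (h : nat -> T -> \bar R) :
  (forall k, measurable_fun [set: T] (h k)) ->
  (forall k w, 0 <= h k w) ->
  (forall k, F (h k) \/ h k = cst 0) ->
  (forall f, F f -> {ae mu, forall w, f w <= ereal_sup (range (h ^~ w))}) ->
  [/\ measurable_fun [set: T] (lattice_sup mu F),
      forall w, 0 <= lattice_sup mu F w &
      {ae mu, forall w, lattice_sup mu F w = ereal_sup (range (h ^~ w))}].
Proof.
move=> mh h0 hF Fh.
pose s w := ereal_sup (range (h ^~ w)).
have ss : is_lattice_sup mu F s.
  split.
    split => //; split; first exact: measurable_ereal_sup.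
    by move=> w; apply: le_trans (h0 0%N w) _; apply: ereal_sup_ubound; exists 0%N.
  move=> t [[mt t0] Ft].
  have : {ae mu, forall w, forall k, h k w <= t w}.
    apply/ae_foralln => k; have [/Ft//|->] := hF k.
    by apply: nearW => w; exact: t0.
  by apply: filterS => w ht; apply: ge_ereal_sup => _ [k _ <-].
have [[[ml l0] ul] ll] : is_lattice_sup mu F (lattice_sup mu F) by apply: xgetPex; exists s.
split => //; have [us ls] := ss.
apply: filterS2 (ls _ (conj (conj ml l0) ul)) (ll _ us) => w h1 h2.
by apply/le_anti/andP.
Qed.

End lattice_sup.

Section cubes.
Context {R : realType}.

Definition translate n (c : n.-tuple R) (l : R) : n.-tuple R := [tuple tnth c i + l | i < n].
Definition cube n (c : n.-tuple R) (l : R) : set (n.-tuple R) := box c (translate c l).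

Lemma cubeP n (c : n.-tuple R) l x :
  cube c l x <-> forall i, tnth c i <= tnth x i < tnth c i + l.
Proof. by split => h i; have := h i; rewrite tnth_mktuple. Qed.

Lemma measurable_cube n (c : n.-tuple R) l : measurable (cube c l).
Proof. exact: measurable_box. Qed.

Lemma cubes_cube n (c : n.-tuple R) l : 0 < l -> cubes n (cube c l).
Proof. by move=> l0; exists c, l. Qed.

Lemma leb_cube n (c : n.-tuple R) l : 0 <= l -> leb n (cube c l) = (l ^+ n)%:E.
Proof.
move=> l0; rewrite leb_box; last by move=> i; rewrite tnth_mktuple lerDl.
congr EFin; under eq_bigr do rewrite tnth_mktuple addrC addKr.
by rewrite prodr_const card_ord.
Qed.

Lemma leb_sigma_finite n : sigma_finite [set: n.-tuple R] (leb n).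
Proof.
pose F (k : nat) := cube [tuple - k%:R | i < n] (k%:R *+ 2 : R).
exists F.
  apply/seteqP; split => // x _.
  pose k := Num.bound (\sum_i `|tnth x i|).
  exists k => //; apply/cubeP => i; rewrite tnth_mktuple mulr2n addKr.
  have : `|tnth x i| < k%:R.
    apply: le_lt_trans (archi_boundP _); last by apply: sumr_ge0.
    by rewrite (bigD1 i)//= lerDl sumr_ge0.
  by rewrite ltr_norml => /andP[/ltW -> ->].
move=> k; split; first exact: measurable_cube.
by rewrite leb_cube ?ltry// mulrn_wge0.
Qed.

(** An alias of [leb n] that carries the sigma-finite structure required by Tonelli's theorem. *)
Definition leb_sf n : set (n.-tuple R) -> \bar R := leb n.

HB.instance Definition _ n := Measure.copy (@leb_sf n) (leb n).

HB.instance Definition _ n :=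
  Measure_isSigmaFinite.Build _ _ _ (@leb_sf n) (leb_sigma_finite n).

End cubes.

Lemma measurable_comp_fst d1 d2 d3 (T1 : measurableType d1)
    (T2 : measurableType d2) (T3 : measurableType d3) (g : T1 -> T3) :
  measurable_fun [set: T1] g -> measurable_fun [set: T1 * T2] (fun z => g z.1).
Proof. by move=> mg; exact: (measurableT_comp mg measurable_fst). Qed.

Lemma measurable_comp_snd d1 d2 d3 (T1 : measurableType d1)
    (T2 : measurableType d2) (T3 : measurableType d3) (g : T2 -> T3) :
  measurable_fun [set: T2] g -> measurable_fun [set: T1 * T2] (fun z => g z.2).
Proof. by move=> mg; exact: (measurableT_comp mg measurable_snd). Qed.

Section average.
Context {R : realType}.
Local Open Scope ereal_scope.

Lemma average_ge0 n p (Q : set (n.-tuple R)) h : 0 <= average p Q h.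
Proof. exact: poweR_ge0. Qed.

Lemma eq_average n p (Q : set (n.-tuple R)) (h k : n.-tuple R -> \bar R) :
  (forall y, Q y -> h y = k y) -> average p Q h = average p Q k.
Proof.
move=> hk; rewrite /average; congr ((_ * _) `^ _).
by apply: eq_integral => y /set_mem Qy; rewrite hk.
Qed.

Lemma eq_average_abs n p (Q : set (n.-tuple R)) (h k : n.-tuple R -> \bar R) :
  (forall y, Q y -> `|h y| = `|k y|) -> average p Q h = average p Q k.
Proof.
move=> hk; rewrite /average; congr ((_ * _) `^ _).
by apply: eq_integral => y /set_mem Qy; rewrite hk.
Qed.

Lemma measurable_average dT (T : measurableType dT) n p (Q : set (n.-tuple R))
    (f : n.-tuple R -> T -> R) :
  measurable Q -> measurable_fun [set: n.-tuple R * T] (fun z => f z.1 z.2) ->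
  measurable_fun [set: T] (fun w => average p Q (fun y => (f y w)%:E)).
Proof.
move=> mQ mf.
apply: (measurableT_comp (measurable_poweR _)).
apply: emeasurable_funM => //.
pose g (z : n.-tuple R * T) := (`|f z.1 z.2| `^ p * \1_Q z.1)%:E.
have mg : measurable_fun [set: n.-tuple R * T] g.
  apply/measurable_EFinP; apply: measurable_funM.
    by apply: (measurableT_comp (measurable_powR _)); exact: measurableT_comp.
  have mI : measurable_fun [set: n.-tuple R] (\1_Q : _ -> R) by exact: measurable_indic.
  exact: (measurable_comp_fst mI).
have g0 z : 0 <= g z by rewrite lee_fin mulr_ge0 ?powR_ge0.
have := measurable_fun_fubini_tonelli_G (m1 := @leb_sf R n) g mg g0.
congr (measurable_fun _ _); apply/funext => w; rewrite /fubini_G/=.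
rewrite [RHS]integral_mkcond; apply: eq_integral => y _.
rewrite /g /= patchE indicE; case: ifPn => _; rewrite ?mulr1 ?mulr0//.
Qed.

End average.

Section simple.
Context {R : realType} {dT : measure_display} {T : measurableType dT}.
Variable mu : {measure set T -> \bar R}.
Variable X : fspace R T.
Hypothesis hX : quasi_banach mu X.

Lemma simple_valued_cst n (A : set (n.-tuple R)) xi : measurable A -> X xi ->
  simple_valued X (fun x w => \1_A x * xi w).
Proof.
move=> mA Xxi; exists 1%N, (fun=> A), (fun=> xi); split => //.
by apply/funext => x; apply/funext => w; rewrite big_ord_recl big_ord0 addr0.
Qed.

Lemma simple_valued_add n (s1 s2 : n.-tuple R -> T -> R) :
  simple_valued X s1 -> simple_valued X s2 ->
  simple_valued X (fun x w => s1 x w + s2 x w).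
Proof.
move=> [N1 [A1 [x1 [h1 ->]]]] [N2 [A2 [x2 [h2 ->]]]].
exists (N1 + N2)%N, (fun k => match fintype.split k with inl i => A1 i | inr i => A2 i end),
  (fun k => match fintype.split k with inl i => x1 i | inr i => x2 i end); split.
  by move=> k; case: fintype.split.
apply/funext => x; apply/funext => w; rewrite big_split_ord/=.
by congr (_ + _); apply: eq_bigr => i _; rewrite ?(unsplitK (inl i)) ?(unsplitK (inr i)).
Qed.

Lemma simple_valued_sum n (I : finType) (s : I -> n.-tuple R -> T -> R) :
  (forall i, simple_valued X (s i)) ->
  simple_valued X (fun x w => \sum_i s i x w).
Proof.
move=> hs; elim: (index_enum I) => [|i l IH].
  under eq_fun do under eq_fun do rewrite big_nil.
  exists 0%N, (fun=> set0), (fun=> fun=> 0); split; first by case.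
  by apply/funext => x; apply/funext => w; rewrite big_ord0.
under eq_fun do under eq_fun do rewrite big_cons.
exact: simple_valued_add.
Qed.

Lemma measurable_simple_valued n (s : n.-tuple R -> T -> R) : simple_valued X s ->
  measurable_fun [set: n.-tuple R * T] (fun z => s z.1 z.2).
Proof.
move=> [N [A [xi [h ->]]]] /=; apply: measurable_sum => k.
have [mA Xxi] := h k; apply: measurable_funM.
  have mI : measurable_fun [set: n.-tuple R] (\1_(A k) : _ -> R) by exact: measurable_indic.
  exact: (measurable_comp_fst mI).
exact: (measurable_comp_snd (qb_measurable hX Xxi)).
Qed.

Lemma simple_valued_in n (s : n.-tuple R -> T -> R) x : simple_valued X s -> X (s x).
Proof.
move=> [N [A [xi [h ->]]]]; apply: (fs_sum hX) => k.
by apply: (qb_scale hX); have [] := h k.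
Qed.

Lemma simple_valued_strongly n (s : n.-tuple R -> T -> R) :
  simple_valued X s -> strongly_measurable X s.
Proof.
move=> hs; split; first exact: measurable_simple_valued.
  by move=> x; exact: simple_valued_in.
exists (fun=> s); split => //; apply: nearW => x.
rewrite (_ : (fun _ => _) = fun=> 0); first exact: cvg_cst.
apply/funext => k; rewrite -[RHS](fs_norm0 hX); congr (fnorm X _).
by apply/funext => w; rewrite subrr.
Qed.

End simple.

(** * Cubes split into pieces of equal volume, and step functions realizing a tree *)

Section splitting.
Context {R : realType} (n : nat) (E : finType) (e0 : E).
Notation param := (n.-tuple R * R)%type.
Implicit Types (p : param).
Definition cubep p := cube p.1 p.2.
Definition vol p : R := p.2 ^+ n.

Variable ch : E -> param -> param.
Hypothesis ch_pos : forall e p, 0 < p.2 -> 0 < (ch e p).2.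
Hypothesis ch_cover : forall p y, 0 < p.2 ->
  cubep p y <-> exists e, cubep (ch e p) y.
Hypothesis ch_disj : forall p y e e', 0 < p.2 ->
  cubep (ch e p) y -> cubep (ch e' p) y -> e = e'.
Hypothesis ch_vol : forall p e, 0 < p.2 -> vol (ch e p) = #|E|%:R^-1 * vol p.

Lemma vol_gt0 p : 0 < p.2 -> 0 < vol p. Proof. exact: exprn_gt0. Qed.

Lemma leb_cubep p : 0 < p.2 -> leb n (cubep p) = (vol p)%:E.
Proof. by move=> p0; rewrite leb_cube// ltW. Qed.

Lemma measurable_cubep p : measurable (cubep p).
Proof. exact: measurable_cube. Qed.

Lemma cubep_split p : 0 < p.2 -> cubep p = \big[setU/set0]_(e <- enum E) cubep (ch e p).
Proof.
move=> p0; rewrite -bigcup_seq; apply/seteqP; split => y.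
  by move/(ch_cover _ p0) => [e he]; exists e => //=; rewrite mem_enum.
by move=> [e _ he]; apply/(ch_cover _ p0); exists e.
Qed.

Lemma integral_split p (f : n.-tuple R -> \bar R) : 0 < p.2 ->
  measurable_fun (cubep p) f -> (forall y, cubep p y -> 0 <= f y)%E ->
  (\int[leb n]_(y in cubep p) f y =
   \sum_(e <- enum E) \int[leb n]_(y in cubep (ch e p)) f y)%E.
Proof.
move=> p0; rewrite (cubep_split p0) => mf f0.
rewrite (@ge0_integral_bigsetU _ _ _ _ _ (fun e => cubep (ch e p)))//.
- by move=> e; exact: measurable_cubep.
- exact: enum_uniq.
- by move=> e e' _ _ [y [h1 h2]]; exact: ch_disj p0 h1 h2.
Qed.

Lemma mean_vol p (F : E -> R) : 0 < p.2 ->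
  \sum_e vol (ch e p) * F e = vol p * mean F.
Proof.
move=> p0; rewrite /mean mulrA mulr_sumr; apply: eq_bigr => e _.
by rewrite ch_vol// (mulrC (vol p)).
Qed.

Section tree_functions.
Context {dT : measure_display} {T : measurableType dT} (m : nat).
Notation tree := (@tree R T E m).
Implicit Types t : tree.

Fixpoint treeF (j : 'I_m) t p (y : n.-tuple R) (w : T) : R := match t with
  | Leaf a _ _ => \1_(cubep p) y * a j w
  | Node c => \sum_e treeF j (c e) (ch e p) y w
  end.

Fixpoint nodes t p : seq param := p :: match t with
  | Leaf _ _ _ => [::]
  | Node c => flatten [seq nodes (c e) (ch e p) | e <- enum E]
  end.

Lemma treeF_out j t p y w : 0 < p.2 -> ~ cubep p y -> treeF j t p y w = 0.
Proof.
elim: t p => [a v u|c IH] p p0 py /=; first by rewrite indicE memNset// mul0r.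
rewrite big1// => e _; apply: IH; first exact: ch_pos.
by move=> h; apply: py; apply/(ch_cover _ p0); exists e.
Qed.

Lemma treeF_child j c p e y w : 0 < p.2 -> cubep (ch e p) y ->
  treeF j (Node c) p y w = treeF j (c e) (ch e p) y w.
Proof.
move=> p0 ey /=; rewrite (bigD1 e)//= big1 ?addr0// => e' ee'.
apply: treeF_out; first exact: ch_pos.
by move=> h; move/eqP : ee'; apply; exact: ch_disj p0 h ey.
Qed.

Variable mu : {measure set T -> \bar R}.
Variables (X : 'I_m -> fspace R T) (r : 'I_m -> R).
Hypothesis hX : forall j, quasi_banach mu (X j).
Hypothesis r0 : forall j, 0 < r j.
Hypothesis cX : forall j, pconvex (r j) (X j).

Lemma treeF_simple j t p : good X t -> simple_valued (X j) (treeF j t p).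
Proof.
elim: t p => [a v u|c IH] p gt.
  by apply: simple_valued_cst; [exact: measurable_cubep|have [] := gt].
apply: simple_valued_sum => e; exact: IH.
Qed.

Lemma treeF_bound j t p y B : 0 < p.2 -> good X t -> leaves_le B t -> 0 <= B j ->
  fnorm (X j) (treeF j t p y) <= B j * \1_(cubep p) y.
Proof.
move=> p0 gt lt B0; have [py|py] := pselect (cubep p y); last first.
  rewrite indicE memNset// mulr0 (_ : treeF j t p y = fun=> 0) ?(fs_norm0 (hX j))//.
  by apply/funext => w; exact: treeF_out.
rewrite indicE mem_set// mulr1.
elim: t p p0 gt lt py => [a v u|c IH] p p0 gt lt py.
  have -> : treeF j (Leaf a v u) p y = a j.
    by apply/funext => w; rewrite /= indicE mem_set// mul1r.
  by have [_ _ av _] := gt; exact: le_trans (av j) (lt j).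
have [e ey] := (ch_cover y p0).1 py.
have -> : treeF j (Node c) p y = treeF j (c e) (ch e p) y.
  by apply/funext => w; exact: treeF_child.
by apply: IH => //; exact: ch_pos.
Qed.

Lemma measurable_treeF_slice j t p w : good X t ->
  measurable_fun [set: n.-tuple R] (fun y => (`|treeF j t p y w| `^ r j)%:E).
Proof.
move=> gt; apply/measurable_EFinP; apply: (measurableT_comp (measurable_powR _)).
apply: measurableT_comp => //.
exact: (measurableT_comp (measurable_simple_valued (hX j) (treeF_simple j p gt))
  (measurable_pair2 w)).
Qed.

Lemma treeF_integral j t p w : 0 < p.2 -> good X t ->
  (\int[leb n]_(y in cubep p) (`|treeF j t p y w| `^ r j)%:E
   = (vol p * powA r j t w)%:E)%E.
Proof.
elim: t p => [a v u|c IH] p p0 gt.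
  rewrite (eq_integral (cst ((`|a j w| `^ r j)%:E))); last first.
    by move=> y yp; rewrite /= indicE yp mul1r.
  rewrite integral_cst; last exact: measurable_cubep.
  rewrite leb_cubep// -EFinM mulrC /= ger0_norm//.
  by have [_ a0 _ _] := gt.
rewrite integral_split//; last first.
  exact: measurable_funTS (measurable_treeF_slice j p w gt).
transitivity (\sum_(e <- enum E) (vol (ch e p) * powA r j (c e) w)%:E)%E.
  apply: eq_bigr => e _; rewrite -(IH e (ch e p) (ch_pos e p0) (gt e)).
  apply: eq_integral => y /set_mem ey; by rewrite (treeF_child _ _ _ p0 ey).
by rewrite sumEFin big_enum /= mean_vol.
Qed.

Lemma treeF_average j t p w : 0 < p.2 -> good X t ->
  average (r j) (cubep p) (fun y => (treeF j t p y w)%:E) = (treeA r j t w)%:E.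
Proof.
move=> p0 gt; rewrite /average.
have -> : (fun y => `|(treeF j t p y w)%:E| `^ r j)%E =
    (fun y => (`|treeF j t p y w| `^ r j)%:E).
  by apply/funext => y; rewrite poweR_EFin.
rewrite treeF_integral// leb_cubep// inver gt_eqF ?vol_gt0//.
by rewrite -EFinM mulrA mulVf ?gt_eqF ?vol_gt0// mul1r poweR_EFin.
Qed.

Variable P : fspace R T.
Hypothesis hP : quasi_banach mu P.
Hypothesis PX : forall xi : 'I_m -> T -> R,
  (forall j, X j (xi j)) -> (forall j w, 0 <= xi j w) ->
  P (fun w => \prod_j xi j w) /\
  fnorm P (fun w => \prod_j xi j w) <= \prod_j fnorm (X j) (xi j).

Lemma supA_le_Phi (f : 'I_m -> n.-tuple R -> T -> R) (phi : T -> \bar R) t p xi :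
  0 < p.2 -> good X t ->
  (forall j y w, cubep p y -> f j y w = treeF j t p y w) ->
  {ae mu, forall w, (xi w)%:E <= phi w}%E ->
  {ae mu, forall w,
    \prod_j average (r j) (cubep p) (fun z => (f j z w)%:E) <= phi w}%E ->
  {ae mu, forall w, (supA r xi t w)%:E <= phi w}%E.
Proof.
move=> p0 gt fF; apply: filterS2 => w h1 h2.
rewrite /supA EFin_max ge_max h1/=; apply: le_trans h2.
rewrite /prodA -prodEFin le_eqVlt; apply/orP; left; apply/eqP.
apply: eq_bigr => j _; rewrite -(treeF_average j w p0 gt).
by apply: eq_average => y py; rewrite fF.
Qed.

(** The superlevel set is not known to be measurable, so a measurable part of it is built: the union
    of the leaf cells counted by [exceed]. There [Phi] lies above every product met on the way down,
    hence above the running maximum. *)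
Lemma exceed_set (f : 'I_m -> n.-tuple R -> T -> R) (Phi : n.-tuple R -> T -> \bar R)
    t p xi (s : R) :
  0 < p.2 -> good X t -> P xi -> (forall w, 0 <= xi w) ->
  (forall j y w, cubep p y -> f j y w = treeF j t p y w) ->
  (forall y, cubep p y -> {ae mu, forall w, (xi w)%:E <= Phi y w}%E) ->
  (forall q, q \in nodes t p -> forall y, cubep q y -> {ae mu, forall w,
    \prod_j average (r j) (cubep q) (fun z => (f j z w)%:E) <= Phi y w}%E) ->
  exists B, [/\ measurable B, B `<=` cubep p,
    leb n B = (exceed r P s t xi * vol p)%:E &
    forall y, B y -> (s%:E < enorm mu P (Phi y))%E].
Proof.
elim: t p xi => [a v u|c IH] p xi p0 gt Pxi xi0 fF xiPhi avPhi.
  set t : tree := Leaf a v u in gt fF avPhi *.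
  have supPhi y (py : cubep p y) :=
    supA_le_Phi p0 gt fF (xiPhi y py) (avPhi p (mem_head _ _) y py).
  have Ps : P (supA r xi t) by exact: (supA_in hX r0 cX hP PX).
  have [h|h] := boolP (s < fnorm P (supA r xi t)); last first.
    exists set0; split => //; rewrite measure0.
    by rewrite [exceed _ _ _ _ _]/= (negbTE h) mul0r.
  exists (cubep p); split => //; first exact: measurable_cubep.
    by rewrite leb_cubep// [exceed _ _ _ _ _]/= h mul1r.
  move=> y py; apply: (@lt_le_trans _ _ (fnorm P (supA r xi t))%:E) => //.
  rewrite -(enorm_EFin mu Ps); apply: (enorm_le hP).
    by apply/measurable_EFinP; exact: (qb_measurable hP).
  by apply: filterS (supPhi y py) => w h1; rewrite lee_fin supA_ge0.
set t : tree := Node c in gt fF avPhi *.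
have supPhi y (py : cubep p y) :=
  supA_le_Phi p0 gt fF (xiPhi y py) (avPhi p (mem_head _ _) y py).
have Ps : P (supA r xi t) by exact: (supA_in hX r0 cX hP PX).
have /choice[B hB] e : exists B, [/\ measurable B, B `<=` cubep (ch e p),
    leb n B = (exceed r P s (c e) (supA r xi t) * vol (ch e p))%:E &
    forall y, B y -> (s%:E < enorm mu P (Phi y))%E].
  apply: IH => //.
  - exact: ch_pos.
  - by move=> w; exact: supA_ge0.
  - move=> j y w ey; rewrite fF; first exact: treeF_child.
    by apply/(ch_cover _ p0); exists e.
  - by move=> y ey; apply: supPhi; apply/(ch_cover _ p0); exists e.
  - move=> q qn; apply: avPhi; rewrite inE; apply/orP; right.
    by apply/flattenP; exists (nodes (c e) (ch e p)) => //; apply/map_f; rewrite mem_enum.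
pose A := \bigcup_e B e.
have mA : measurable A.
  apply: fin_bigcup_measurable; first exact: finite_finset.
  by move=> e _; have [] := hB e.
have sA : A `<=` cubep p.
  move=> y [e _ Bey]; apply/(ch_cover _ p0); exists e.
  by have [_ sB _ _] := hB e; exact: sB.
exists A; split => //; last by move=> y [e _ Bey]; have [_ _ _ h] := hB e; exact: h.
rewrite -(setIidl sA) -integral_indic; [|exact: measurable_cubep|exact: mA].
rewrite integral_split//; last first.
  by apply/measurable_EFinP; apply: measurable_funTS; exact: measurable_indic.
transitivity (\sum_(e <- enum E) (vol (ch e p) * exceed r P s (c e) (supA r xi t))%:E)%E.
  apply: eq_bigr => e _; have [mB sB vB _] := hB e.
  rewrite integral_indic; [|exact: measurable_cubep|exact: mA].
  rewrite mulrC -vB; congr (leb n _); apply/seteqP; split => y.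
    move=> [[e' _ Be'] ey].
    have [_ sB' _ _] := hB e'.
    by rewrite (ch_disj p0 ey (sB' _ Be')).
  by move=> Bey; split; [exists e|exact: sB].
by rewrite sumEFin big_enum /= mean_vol// mulrC.
Qed.

End tree_functions.
End splitting.

(** * Trees realized on an interval *)

Section ereal_power.
Context {R : realType}.
Local Open Scope ereal_scope.
Implicit Types x y : \bar R.

Lemma le_poweR x y (p : R) : (0 <= p)%R -> 0 <= x -> x <= y -> x `^ p <= y `^ p.
Proof.
move=> p0 x0 xy; apply: gt0_ler_poweR => //.
  by rewrite in_itv/= x0 leey.
by rewrite in_itv/= leey andbT (le_trans x0).
Qed.

Lemma poweRVK x (p : R) : (0 < p)%R -> 0 <= x -> (x `^ p^-1) `^ p = x.
Proof. by move=> p0 x0; rewrite -poweRrM mulVf ?gt_eqF// poweRe1. Qed.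

Lemma poweRKV x (p : R) : (0 < p)%R -> 0 <= x -> (x `^ p) `^ p^-1 = x.
Proof. by move=> p0 x0; rewrite -poweRrM divff ?gt_eqF// poweRe1. Qed.

Lemma le_prode (I : finType) (F G : I -> \bar R) :
  (forall i, 0 <= F i <= G i) -> \prod_i F i <= \prod_i G i.
Proof.
move=> FG; suff : 0 <= \prod_i F i <= \prod_i G i by case/andP.
elim/big_rec2 : _ => [|i x y _ /andP[x0 xy]]; first by rewrite lee01 lexx.
have /andP[F0 FGi] := FG i.
by rewrite mule_ge0// lee_pmul.
Qed.

Lemma measurable_prode dT (T : measurableType dT) (I : finType) (F : I -> T -> \bar R) :
  (forall i, measurable_fun [set: T] (F i)) ->
  measurable_fun [set: T] (fun w => \prod_i F i w).
Proof.
move=> mF; elim: (index_enum I) => [|i l IH].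
  rewrite (_ : (fun w => _) = cst 1)//; by apply/funext => w; rewrite big_nil.
rewrite (_ : (fun w => _) = (fun w => F i w * \prod_(j <- l) F j w)).
  exact: emeasurable_funM.
by apply/funext => w; rewrite big_cons.
Qed.

End ereal_power.

Section interval_splitting.
Context {R : realType} (E : finType) (e0 : E).
Notation param := (1.-tuple R * R)%type.

Definition ch1 (e : E) (p : param) : param :=
  (translate p.1 (p.2 / #|E|%:R * (enum_rank e)%:R), p.2 / #|E|%:R).

Let E0 : 0 < #|E|%:R :> R.
Proof. by rewrite ltr0n; apply/card_gt0P; exists e0. Qed.

Lemma cubep1P (c : 1.-tuple R) (l : R) y :
  cubep (c, l) y <-> tnth c ord0 <= tnth y ord0 < tnth c ord0 + l.
Proof.
by split=> [/cubeP/(_ ord0)//|h]; apply/cubeP => i; rewrite (ord1 i).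
Qed.

Lemma ch1_pos e p : 0 < p.2 -> 0 < (ch1 e p).2.
Proof. by move=> p0; rewrite divr_gt0. Qed.

Lemma ch1_cubeP e (c : 1.-tuple R) (l : R) y : 0 < l ->
  cubep (ch1 e (c, l)) y <->
  (enum_rank e)%:R <= (tnth y ord0 - tnth c ord0) * #|E|%:R / l < (enum_rank e)%:R + 1.
Proof.
move=> l0; rewrite cubep1P tnth_mktuple ler_pdivlMr// ltr_pdivrMr//=.
set k : R := (enum_rank e)%:R; set b : R := #|E|%:R; set C := tnth c _; set Y := tnth y _.
have bE : l / b * b = l by rewrite divfK// gt_eqF.
have h1 : (C + l / b * k <= Y) = (k * l <= (Y - C) * b).
  by rewrite -(ler_pM2r E0) -/b mulrDl mulrAC bE mulrBl lerBrDl [l * k]mulrC.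
have h2 : (Y < C + l / b * k + l / b) = ((Y - C) * b < (k + 1) * l).
  by rewrite -(ltr_pM2r E0) -/b !mulrDl mul1r bE mulrAC bE mulNr ltrBlDl addrA [l * k]mulrC.
by rewrite h1 h2.
Qed.

Lemma ch1_cover p y : 0 < p.2 -> cubep p y <-> exists e, cubep (ch1 e p) y.
Proof.
case: p => c l l0 /=.
set u := (tnth y ord0 - tnth c ord0) * #|E|%:R / l.
have uP : cubep (c, l) y <-> 0 <= u < #|E|%:R.
  rewrite cubep1P /u ler_pdivlMr// ltr_pdivrMr// mul0r pmulr_lge0// subr_ge0.
  by rewrite [#|E|%:R * l]mulrC ltr_pM2r// ltrBlDl.
split=> [/uP/andP[u0 ub]|[e]].
  have kb : (Num.truncn u < #|E|)%N.
    by rewrite -(ltr_nat R) (le_lt_trans _ ub)// truncn_le.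
  exists (enum_val (Ordinal kb)); apply/(ch1_cubeP _ _ _ l0).
  by rewrite enum_valK/= natr1; exact: truncn_itv.
move=> /(ch1_cubeP _ _ _ l0)/andP[h1 h2]; apply/uP.
rewrite (le_trans _ h1)// (lt_le_trans h2)// natr1 ler_nat.
exact: ltn_ord.
Qed.

Lemma ch1_disj p y e e' : 0 < p.2 -> cubep (ch1 e p) y -> cubep (ch1 e' p) y -> e = e'.
Proof.
case: p => c l l0 /(ch1_cubeP _ _ _ l0)/andP[h1 h2] /(ch1_cubeP _ _ _ l0)/andP[h3 h4].
apply: enum_rank_inj; apply/val_inj/eqP; rewrite eqn_leq.
have := le_lt_trans h1 h4; have := le_lt_trans h3 h2.
by rewrite !natr1 !ltr_nat !ltnS => -> ->.
Qed.

Lemma ch1_vol p e : 0 < p.2 -> vol (ch1 e p) = #|E|%:R^-1 * vol p.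
Proof. by move=> _; rewrite /vol !expr1 mulrC. Qed.

End interval_splitting.

Section HL_tree.
Context {R : realType} {dT : measure_display} {T : measurableType dT}.
Variable mu : {measure set T -> \bar R}.
Context (m : nat) (E : finType) (e0 : E).
Variables (X : 'I_m -> fspace R T) (r : 'I_m -> R).
Hypothesis hX : forall j, quasi_banach mu (X j).
Hypothesis r0 : forall j, 0 < r j.
Hypothesis hP : quasi_banach mu (prod_space mu X).
Local Open Scope ereal_scope.

Lemma lattice_maximal_ge n (L : seq (n.-tuple R * R)) (f : 'I_m -> n.-tuple R -> T -> R) :
  (forall j, measurable_fun [set: n.-tuple R * T] (fun z => f j z.1 z.2)) ->
  let M := lattice_maximal mu [set cubep q | q in [set` L]] r f in
  (forall y w, 0 <= M y w) /\
  forall q, q \in L -> forall y, cubep q y ->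
  {ae mu, forall w, \prod_(j < m) average (r j) (cubep q) (fun z => (f j z w)%:E)
    <= M y w}.
Proof.
move=> mf M; suff H y : (forall w, 0 <= M y w) /\ forall q, q \in L -> cubep q y ->
    {ae mu, forall w, \prod_(j < m) average (r j) (cubep q) (fun z => (f j z w)%:E)
    <= M y w}.
  by split=> [y|q qL y qy]; [exact: (H y).1|exact: (H y).2].
pose g q' w := (\prod_(j < m) average (r j) (cubep q') (fun z => (f j z w)%:E))
  * (\1_(cubep q') y)%:E.
pose h k := if (k < size L)%N then g (nth (y, 0%R) L k) else cst 0.
have mg q' : measurable_fun [set: T] (g q').
  apply: emeasurable_funM => //; apply: measurable_prode => j.
  by apply: measurable_average => //; exact: measurable_cubep.
have g0 q' w : 0 <= g q' w.
  by rewrite mule_ge0 ?prode_ge0 ?lee_fin// => j _; exact: average_ge0.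
have mh k : measurable_fun [set: T] (h k) by rewrite /h; case: ifP.
have h0 k w : 0 <= h k w by rewrite /h; case: ifP.
have [||_ s0 supE] := @lattice_supP _ _ _ mu [set g q' | q' in [set` L]] h mh h0.
- move=> k; rewrite /h; case: ifPn => [kL|_]; last by right.
  by left; exists (nth (y, 0%R) L k) => //=; exact: mem_nth.
- move=> _ [q' /= q'L <-]; apply: nearW => w.
  apply: ereal_sup_ubound; exists (index q' L) => //.
  by rewrite /h index_mem q'L nth_index.
have -> : M y = lattice_sup mu [set g q' | q' in [set` L]].
  rewrite /M /lattice_maximal; congr lattice_sup; apply/seteqP; split.
    by move=> _ [_ [q' q'L <-] <-]; exists q'.
  by move=> _ [q' q'L <-]; exists (cubep q') => //; exists q'.
split=> // q qL qy.
apply: filterS supE => w ->; apply: ereal_sup_ubound; exists (index q L) => //.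
rewrite /h index_mem qL nth_index// /g indicE mem_set//.
by rewrite mule1.
Qed.

(** As the support has measure 1, the bound is the same for all p, infinity included; the exponents
    of the Hardy-Littlewood property therefore do not enter the bounds on the realized functions. *)
Lemma Lnorm_indic_bound (p : \bar R) (rj : R) (f : 1.-tuple R -> \bar R) (B : R)
    (A : set (1.-tuple R)) : (0 < rj)%R -> rj%:E < p -> measurable A -> leb 1 A = 1 ->
  (0 < B)%R -> (forall y, 0 <= f y <= (B * \1_A y)%:E) ->
  Lnorm (leb 1) p f <= B%:E.
Proof.
move=> rj0 rp mA A1 B0 fB.
have fabs y : `|f y| = f y by rewrite gee0_abs//; have /andP[] := fB y.
rewrite Lnorm.unlock; case: p rp => [p rp| |//].
  have p0 : (0 < p)%R by rewrite -lte_fin (lt_trans _ rp).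
  have -> : B%:E = (B%:E `^ p) `^ p^-1.
    by rewrite -poweRrM divff ?gt_eqF// poweRe1// lee_fin ltW.
  apply: le_poweR.
  - by rewrite invr_ge0 ltW.
  - by apply: integral_ge0 => y _; exact: poweR_ge0.
  apply: (@le_trans _ _ (\int[leb 1]_y ((B `^ p)%:E * (\1_A y)%:E))).
    apply: le_lower_integral => y _; first exact: poweR_ge0.
    have /andP[f0 fBy] := fB y; rewrite fabs.
    apply: (@le_trans _ _ ((B * \1_A y)%:E `^ p)).
      by apply: le_poweR => //; exact: ltW.
    rewrite poweR_EFin -EFinM lee_fin indicE; case: (_ \in _); rewrite ?mulr1 ?mulr0//.
    by rewrite powR0// gt_eqF.
  rewrite ge0_integralZl//.
  - by rewrite integral_indic// setIT A1 mule1 poweR_EFin.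
  - by apply/measurable_EFinP; exact: measurable_indic.
  - by rewrite lee_fin powR_ge0.
case: ifP => _ _; last by rewrite lee_fin ltW.
apply/ess_supP; apply: nearW => y /=; rewrite fabs.
have /andP[_ /le_trans] := fB y; apply; rewrite lee_fin indicE.
by case: (_ \in _); rewrite ?mulr1 ?mulr0// ltW.
Qed.

Lemma HL_exceed : HL mu r X -> exists2 K : R, (1 <= K)%R &
  forall (t : @tree R T E m) (B : 'I_m -> R), good X t ->
  (forall j, (0 < B j)%R) -> leaves_le B t ->
  (exceed r (prod_space mu X) (K * \prod_j B j) t (fun=> 0) <= 4^-1)%R.
Proof.
move=> [cX [p [K0 [rp bnd]]]].
pose K1 := Num.max K0 1%R.
pose s : R := (\sum_j fine (p j)^-1)%R.
have pinv j : (p j)^-1 = (fine (p j)^-1)%:E /\ (0 <= fine (p j)^-1)%R.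
  have := rp j; case: (p j) => [pj|_|//].
    rewrite lte_fin => rpj; have pj0 : (0 < pj)%R by exact: lt_trans rpj.
    by rewrite inver gt_eqF//= invr_ge0 ltW.
  by rewrite invey.
have s0 : (0 <= s)%R by apply: sumr_ge0 => j _; exact: (pinv j).2.
have sE : \sum_(j < m) (p j)^-1 = s%:E.
  by rewrite -sumEFin; apply: eq_bigr => j _; exact: (pinv j).1.
(* Chebyshev's inequality with exponent 1/s, at 4^s times the norm bound, leaves measure at most
   1/4. The maximum [K1] makes the constant at least 1. *)
exists (4 `^ s * K1)%R.
  rewrite -[leLHS]mul1r ler_pM// ?le_max ?lexx ?orbT//.
  by rewrite -[leLHS](powRr0 (4 : R)) ler_powR// ler1n.
move=> t B gt B0 lt.
pose c0 : 1.-tuple R := [tuple 0%R | i < 1].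
pose p0 : 1.-tuple R * R := (c0, 1%R).
have p01 : (0 < p0.2)%R by [].
have v0 : vol p0 = 1%R by rewrite /vol expr1n.
pose ch := @ch1 R E.
pose F j := treeF ch j t p0.
have chp := @ch1_pos R E e0; have chc := @ch1_cover R E e0.
have chd := @ch1_disj R E e0; have chv := @ch1_vol R E.
have sF j : simple_valued (X j) (F j) by exact: treeF_simple.
pose L := nodes ch t p0.
pose D := [set cubep q | q in [set` L]].
have nodes_pos u q q' : (0 < q.2)%R -> q' \in nodes ch u q -> (0 < q'.2)%R.
  elim: u q => [a v x|c IH] q q0 /=; first by rewrite inE => /eqP ->.
  rewrite inE => /orP[/eqP -> //|/flattenP[_ /mapP[e _ ->]]].
  by apply: IH; exact: chp.
have fD : finite_set D by apply: finite_image; exact: finite_seq.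
have cD : D `<=` cubes 1.
  move=> _ [q qL <-]; apply: cubes_cube.
  exact: nodes_pos qL.
have inF j : in_Lp (p j) (X j) (F j) /\ Lnorm (leb 1) (p j) (efnorm (X j) (F j)) <= (B j)%:E.
  have le1 : Lnorm (leb 1) (p j) (efnorm (X j) (F j)) <= (B j)%:E.
    apply: (@Lnorm_indic_bound _ (r j) _ _ (cubep p0)) => //.
    - exact: measurable_cubep.
    - by rewrite leb_cubep// v0.
    - move=> y; rewrite /efnorm !lee_fin; apply/andP; split.
        by apply: (qb_ge0 (hX j)); exact: (simple_valued_in (hX j)).
      by apply: (treeF_bound chp chc chd hX) => //; exact: ltW.
  split => //; split; first exact: (simple_valued_strongly (hX j)).
  by rewrite (le_lt_trans le1)// ltry.
have := bnd D fD cD F (fun j => (inF j).1); rewrite sE.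
set Phi := fun x => lattice_maximal mu D r F x.
move=> HLb.
have {}HLb : Lnorm (leb 1) (s%:E)^-1 (fun x => enorm mu (prod_space mu X) (Phi x))
    <= (K1 * \prod_j B j)%:E.
  apply: (le_trans HLb); rewrite EFinM -prodEFin.
  apply: (@le_trans _ _ (K1%:E * \prod_(j < m) Lnorm (leb 1) (p j) (efnorm (X j) (F j)))).
    rewrite lee_wpmul2r ?lee_fin ?le_max ?lexx//.
    by apply: prode_ge0 => j _; exact: Lnorm_ge0.
  rewrite lee_wpmul2l ?lee_fin ?le_max ?ler01 ?orbT//.
  by apply: le_prode => j; rewrite Lnorm_ge0 (inF j).2.
have Pr0 : (0 < \prod_j B j)%R by exact: prodr_gt0.
have PX := @fs_prod_le R dT T mu m X^~ hX.
have [Phi0 avPhi] := lattice_maximal_ge L (fun j => measurable_simple_valued (hX j) (sF j)).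
set S := (4 `^ s * K1 * \prod_j B j)%R.
have [||A [mA sA lA hA]] := exceed_set chp chc chd chv hX r0 cX hP PX
  (f := F) (Phi := Phi) S p01 gt (fs_0 hP) (fun=> lexx 0%R) (fun j y w _ => erefl).
- by move=> y py; apply: nearW => w; exact: Phi0.
- exact: avPhi.
rewrite v0 mulr1 in lA; set ex := exceed _ _ _ _ _ in lA *.
have S0 : (0 <= S)%R by rewrite !mulr_ge0 ?powR_ge0 ?le_max ?ler01 ?orbT// ltW.
have S00 : (0 < K1 * \prod_j B j)%R by rewrite mulr_gt0// lt_max ltr01 orbT.
(* For s = 0 the target space is L^infinity: the set [A] is then null and [exceed] is 0. *)
have [s_eq0|s_neq0] := eqVneq s 0%R.
  move: HLb; rewrite s_eq0 inve0 Lnorm.unlock.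
  have leb_gt0 : 0 < leb 1 [set: 1.-tuple R].
    apply: (@lt_le_trans _ _ (leb 1 (cubep p0))).
      by rewrite leb_cubep// v0.
    by apply: le_measure => //; rewrite inE//; exact: measurable_cubep.
  rewrite leb_gt0 => /ess_supP [N [mN N0 sN]].
  have A0 : leb 1 A = 0.
    apply: (subset_measure0 mA mN _ N0) => y Ay; apply: sN => /=.
    apply/negP; rewrite -ltNge gee0_abs; last exact: enorm_ge0.
    have := hA y Ay; apply: le_lt_trans; rewrite lee_fin /S s_eq0 powRr0 mul1r//.
  by move: lA; rewrite A0 => -[<-]; rewrite invr_ge0.
have s_gt0 : (0 < s)%R by rewrite lt_def s_neq0.
move: HLb; rewrite inver (negbTE s_neq0) Lnorm.unlock invrK.
have I0 : 0 <= \int[leb 1]_x `|enorm mu (prod_space mu X) (Phi x)| `^ s^-1.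
  by apply: integral_ge0 => y _; exact: poweR_ge0.
move=> /(le_poweR _ (poweR_ge0 _ _)) => /(_ s^-1%R).
rewrite invr_ge0 => /(_ s0).
rewrite poweRKV// => HLb.
have : (S `^ s^-1)%:E * leb 1 A <= ((K1 * \prod_j B j) `^ s^-1)%:E.
  rewrite -poweR_EFin; apply: le_trans HLb.
  rewrite -integral_cst// integral_mkcond; apply: le_lower_integral => y _.
    by rewrite patchE; case: ifP => // _; exact: poweR_ge0.
  rewrite patchE; case: ifPn => [/set_mem Ay|_]; last exact: poweR_ge0.
  apply: le_poweR; rewrite ?invr_ge0// ?lee_fin//.
  by rewrite gee0_abs ?enorm_ge0// ltW// hA.
rewrite lA -EFinM lee_fin /S -mulrA powRM ?powR_ge0//; last exact: ltW.
rewrite -powRrM divff// powRr1// -mulrA [X in (4 * X)%R]mulrC mulrA => h.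
have : (4 * ex <= 1)%R.
  have Q0 : (0 < (K1 * \prod_j B j) `^ s^-1)%R by rewrite powR_gt0.
  by rewrite -(ler_pM2r Q0) mul1r.
by lra.
Qed.

End HL_tree.

(** * Minkowski's inequality *)

Section ereal_limits.
Context {R : realType}.
Local Open Scope ereal_scope.
Implicit Types (u : nat -> \bar R) (p : R).

Lemma poweR_ereal_sup u p : (0 < p)%R -> (forall k, 0 <= u k) ->
  ereal_sup (range u) `^ p <= ereal_sup (range (fun k => u k `^ p)).
Proof.
move=> p0 u0; set S := ereal_sup (range (fun k => u k `^ p)).
have S0 : 0 <= S.
  by apply: (@le_trans _ _ (u 0%N `^ p)); [exact: poweR_ge0|apply: ereal_sup_ubound; exists 0%N].
rewrite -[leRHS](poweRVK p0 S0); apply: le_poweR.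
- exact: ltW.
- by apply: (le_trans (u0 0%N)); apply: ereal_sup_ubound; exists 0%N.
apply: ge_ereal_sup => _ [k _ <-].
rewrite -[leLHS](poweRKV p0 (u0 k)); apply: le_poweR.
- by rewrite invr_ge0 ltW.
- exact: poweR_ge0.
- by apply: ereal_sup_ubound; exists k.
Qed.

Lemma limn_einf_ereal_sup u : limn_einf u = ereal_sup (range (einfs u)).
Proof. by rewrite limn_einf_lim; apply/cvg_lim => //; exact: cvg_einfs_sup. Qed.

Lemma einfs_ge0 u k : (forall k, 0 <= u k) -> 0 <= einfs u k.
Proof. by move=> u0; apply: le_ereal_inf_tmp => _ [l _ <-]. Qed.

Lemma limn_einf_ge0 u : (forall k, 0 <= u k) -> 0 <= limn_einf u.
Proof.
move=> u0; rewrite limn_einf_ereal_sup; apply: (le_trans (einfs_ge0 0%N u0)).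
by apply: ereal_sup_ubound; exists 0%N.
Qed.

Lemma poweR_limn_einf u p : (0 < p)%R -> (forall k, 0 <= u k) ->
  limn_einf u `^ p <= limn_einf (fun k => u k `^ p).
Proof.
move=> p0 u0; rewrite !limn_einf_ereal_sup.
apply: (le_trans (poweR_ereal_sup p0 (fun k => einfs_ge0 k u0))).
apply: ge_ereal_sup => _ [k _ <-].
apply: (@le_trans _ _ (einfs (fun l => u l `^ p) k)); last first.
  by apply: ereal_sup_ubound; exists k.
apply: le_ereal_inf_tmp => _ [l /= kl <-]; apply: le_poweR.
- exact: ltW.
- exact: einfs_ge0.
- by apply: ereal_inf_lbound; exists l.
Qed.

Lemma limn_einfZ_ge u (c : R) : (0 < c)%R ->
  c%:E * limn_einf u <= limn_einf (fun k => c%:E * u k).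
Proof.
move=> c0; rewrite !limn_einf_ereal_sup -ereal_sup_pZl//.
apply: ge_ereal_sup => _ [_ [k _ <-] <-].
apply: (@le_trans _ _ (einfs (fun k => c%:E * u k) k)); last first.
  by apply: ereal_sup_ubound; exists k.
apply: le_ereal_inf_tmp => _ [l /= kl <-]; rewrite lee_pmul2l//.
by apply: ereal_inf_lbound; exists l.
Qed.

Lemma measurable_limn_einf dT (T : measurableType dT) (f : nat -> T -> \bar R) :
  (forall k, measurable_fun [set: T] (f k)) ->
  measurable_fun [set: T] (fun w => limn_einf (f ^~ w)).
Proof.
move=> mf; under eq_fun do rewrite limn_einf_ereal_sup.
apply: (measurable_ereal_sup (h := fun k w => einfs (f ^~ w) k)) => k.
exact: measurable_fun_einfs.
Qed.

End ereal_limits.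

Section sections.
Context {R : realType} d1 d2 (T1 : measurableType d1) (T2 : measurableType d2).
Variables (m1 : {sigma_finite_measure set T1 -> \bar R})
  (m2 : {sigma_finite_measure set T2 -> \bar R}).

(** By Tonelli, both iterated integrals of the indicator of the complement vanish. *)
Lemma ae_swap (P : set (T1 * T2)) : measurable P ->
  {ae m1, forall x, {ae m2, forall y, P (x, y)}} ->
  {ae m2, forall y, {ae m1, forall x, P (x, y)}}.
Proof.
move=> mP h.
have mZ : measurable (~` P) by exact: measurableC.
have FE x : fubini_F m2 (EFin \o \1_(~` P)) x = m2 (xsection (~` P) x).
  by rewrite -/(_ \o _) indic_fubini_tonelli_FE.
have GE y : fubini_G m1 (EFin \o \1_(~` P)) y = m1 (ysection (~` P) y).
  by rewrite -/(_ \o _) indic_fubini_tonelli_GE.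
have F0 : (\int[m1]_x fubini_F m2 (EFin \o \1_(~` P)) x = 0)%E.
  transitivity (\int[m1]_x (cst 0%E x))%E; last exact: integral0.
  apply: ae_eq_integral => //.
    exact: indic_measurable_fun_fubini_tonelli_F.
  apply: filterS h => x [N [mN N0 sN]] _.
  rewrite FE; apply: (subset_measure0 _ mN _ N0); first exact: measurable_xsection.
  by move=> y /xsectionP; exact: sN.
have := indic_fubini_tonelli m1 m2 mZ; rewrite F0 => /esym G0.
have mG : measurable_fun [set: T2] (fubini_G m1 (EFin \o \1_(~` P))).
  exact: indic_measurable_fun_fubini_tonelli_G.
have /(ae_eq_integral_abs m2 measurableT mG) :
    (\int[m2]_y `|fubini_G m1 (EFin \o \1_(~` P)) y| = 0)%E.
  rewrite -[RHS]G0; apply: eq_integral => y _; rewrite gee0_abs// GE.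
  exact: measure_ge0.
apply: filterS => y /(_ I); rewrite GE => y0.
exists (ysection (~` P) y); split => //; first exact: measurable_ysection.
by move=> x nP; apply/ysectionP.
Qed.

End sections.

Section countably_valued.
Context {dT : measure_display} {T : measurableType dT}.
Implicit Types kap : T -> nat.

Definition fibers kap := forall i, measurable (kap @^-1` [set i]).

(** Preimages are countable unions of fibers, whatever g is. So norms of countably valued functions
    are measurable without any regularity of the quasi-norm. *)
Lemma fibers_comp d' (T' : measurableType d') kap (g : nat -> T') :
  fibers kap -> measurable_fun [set: T] (g \o kap).
Proof.
move=> fk _ Y mY; rewrite setTI.
have -> : (g \o kap) @^-1` Y = \bigcup_(i in [set i | Y (g i)]) (kap @^-1` [set i]).
  by apply/seteqP; split => [x Yx|x [i Yi /= ki]]; [exists (kap x)|rewrite /= ki].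
exact: bigcup_measurable.
Qed.

Lemma fibers_code (C : countType) (k : T -> C) :
  (forall c, measurable (k @^-1` [set c])) -> fibers (pickle \o k).
Proof.
move=> fk i; case E : (@unpickle C i) => [c|].
  have -> : (pickle \o k) @^-1` [set i] = (k @^-1` [set c] : set T) `&` [set x | pickle c = i].
    apply/seteqP; split => x /= h; last by case: h => ->.
    by have := E; rewrite -h pickleK => -[<-].
  apply: measurableI => //; have [ci|ci] := eqVneq (pickle c) i.
    by rewrite ci (_ : [set _ | _] = setT)//; apply/seteqP.
  rewrite (_ : [set _ | _] = set0)//; apply/seteqP; split => // x /= h.
  by rewrite h eqxx in ci.
rewrite (_ : _ @^-1` _ = set0)//; apply/seteqP; split => // x /= h.
by move: E; rewrite -h pickleK.
Qed.

(** Making the [B i] disjoint turns the choice of an index into a measurable one; off their union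
    [xget] falls back on 0. *)
Lemma first_index (B : nat -> set T) : (forall i, measurable (B i)) ->
  exists kap, fibers kap /\ forall x, (\bigcup_i B i) x -> B (kap x) x.
Proof.
move=> mB.
pose kap x := xget 0%N [set i | seqDU B i x].
have mD i : measurable (seqDU B i).
  by apply: measurableD => //; exact: bigsetU_measurable.
have kapP x : (\bigcup_i B i) x -> seqDU B (kap x) x.
  rewrite seqDU_bigcup_eq => -[i _ Bx].
  exact: (xgetI 0%N (P := [set i | seqDU B i x]) Bx).
exists kap; split; last by move=> x /kapP[].
move=> i.
have -> : kap @^-1` [set i] = seqDU B i `|` ((~` \bigcup_i B i) `&` [set x | 0%N = i]).
  apply/seteqP; split => x.
    move=> /= <-; have [Bx|Bx] := pselect ((\bigcup_i B i) x); first by left; exact: kapP.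
    right; split => //; rewrite /kap xgetPN// => j Bj; apply: Bx.
    by rewrite seqDU_bigcup_eq; exists j.
  move=> [Bi|[nB /= <-]].
    have /kapP Bk : (\bigcup_i B i) x by rewrite seqDU_bigcup_eq; exists i.
    by apply: (trivIset_seqDU B) => //; exists x.
  rewrite /kap xgetPN// => j Bj; apply: nB.
  by rewrite seqDU_bigcup_eq; exists j.
apply: measurableU => //; apply: measurableI.
  by apply: measurableC; exact: bigcup_measurable.
have [->|i0] := eqVneq 0%N i; first by rewrite (_ : [set _ | _] = setT)//; apply/seteqP.
rewrite (_ : [set _ | _] = set0)//; apply/seteqP; split => // x /= h.
by rewrite h eqxx in i0.
Qed.

End countably_valued.

(** The label of x is its pattern of memberships in the sets [A i], encoded as a natural number. *)
Lemma simple_valued_fibers {R : realType} {dT : measure_display}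
    {T : measurableType dT} (mu : {measure set T -> \bar R}) (X : fspace R T)
    n (s : n.-tuple R -> T -> R) : quasi_banach mu X -> simple_valued X s ->
  exists kap (eta : nat -> T -> R), [/\ fibers kap, forall i, X (eta i) &
    forall x, s x = eta (kap x)].
Proof.
move=> hX [N [A [xi [h ->]]]].
pose k (x : n.-tuple R) : {ffun 'I_N -> bool} := [ffun i => `[< A i x >]].
pose eta i (w : T) : R := if unpickle i is Some b then
  \sum_(k < N) ((b : {ffun 'I_N -> bool}) k)%:R * xi k w else 0.
exists (pickle \o k), eta; split.
- apply: fibers_code => b.
  have -> : k @^-1` [set b] = \bigcap_(i in [set: 'I_N]) (if b i then A i else ~` A i).
    apply/seteqP; split => x.
      move=> /= <- i _; rewrite ffunE; case: ifPn => [/asboolP//|].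
      by move/asboolP.
    move=> Hx; apply/ffunP => i; rewrite ffunE.
    by have := Hx i I; case: (b i) => [?|?]; [apply/asboolP|apply/asboolP].
  apply: fin_bigcap_measurable; first exact: finite_finset.
  by move=> i _; case: ifP => _; [|apply: measurableC]; have [] := h i.
- move=> i; rewrite /eta; case: (unpickle i) => [b|]; last exact: (fs_0 hX).
  by apply: (fs_sum hX) => j; apply: (qb_scale hX); have [] := h j.
move=> x; apply/funext => w; rewrite /eta /= pickleK; apply: eq_bigr => i _.
by rewrite ffunE indicE; congr (_%:R * _); apply/asboolP/idP => [/mem_set|/set_mem].
Qed.

Section norm_continuity.
Context {R : realType} {dT : measure_display} {T : measurableType dT}.
Variable mu : {measure set T -> \bar R}.
Variables (X : fspace R T) (r : R).
Hypothesis hX : quasi_banach mu X.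
Hypothesis r0 : 0 < r.
Hypothesis cX : pconvex r X.

(** A quasi-norm controls perturbations only up to a factor c > 1; two-sided control for all such c
    still forces convergence. *)
Lemma cvg_multiplicative_gap (a : nat -> R) (l : R) : 0 <= l ->
  (forall c e : R, 1 < c -> 0 < e ->
    \forall k \near \oo, a k <= c * l + e /\ l <= c * a k + e) ->
  a k @[k --> \oo] --> l.
Proof.
move=> l0 h; apply/cvgrPdist_le => e e0.
pose dl := Num.min 1 (e / (4 * (l + e + 1))).
have D0 : 0 < 4 * (l + e + 1) by rewrite mulr_gt0// -addrA ltr_wpDl// addr_gt0.
have dl0 : 0 < dl by rewrite lt_min ltr01 divr_gt0.
have dl1 : dl <= 1 by rewrite ge_min lexx.
have dle : dl * (4 * (l + e + 1)) <= e.
  by rewrite -ler_pdivlMr// ge_min lexx orbT.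
have e4 : 0 < e / 4 by rewrite divr_gt0.
have c1 : 1 < 1 + dl by rewrite ltrDl.
apply: filterS (h _ _ c1 e4) => k [h1 h2].
rewrite ler_norml; apply/andP; split; last first.
  nra.
nra.
Qed.

Lemma fnorm_gap (c : R) : 1 < c -> exists2 C, 0 < C &
  forall xi eta, X xi -> X eta ->
  fnorm X (fun w => xi w + eta w) `^ r <= c * fnorm X xi `^ r + C * fnorm X eta `^ r.
Proof.
move=> c1; have c0 : 0 < c by exact: lt_trans c1.
pose e := c `^ r^-1 - 1.
have e0 : 0 < e.
  have : 1 `^ r^-1 < c `^ r^-1.
    by apply: gt0_ltr_powR; rewrite ?invr_gt0 ?nnegrE// ltW.
  by rewrite powR1 subr_gt0.
exists ((1 + e^-1) `^ r).
  by rewrite powR_gt0// addr_gt0// invr_gt0.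
move=> xi eta Xxi Xeta; apply: (le_trans (pconvex_add hX r0 e0 cX Xxi Xeta)).
have e1 : 0 <= 1 + e by rewrite addr_ge0// ltW.
have e2 : 0 <= 1 + e^-1 by rewrite addr_ge0// invr_ge0 ltW.
rewrite !powRM//; try exact: (qb_ge0 hX).
have -> : 1 + e = c `^ r^-1 by rewrite /e; ring.
by rewrite powRVK// ltW.
Qed.

Lemma fnorm_cvg (xi : T -> R) (eta : nat -> T -> R) : X xi -> (forall k, X (eta k)) ->
  fnorm X (fun w => eta k w - xi w) @[k --> \oo] --> 0 ->
  fnorm X (eta k) `^ r @[k --> \oo] --> fnorm X xi `^ r.
Proof.
move=> Xxi Xeta cv.
have Xd k : X (fun w => eta k w - xi w).
  by have := qb_add hX (Xeta k) (qb_scale hX (-1) Xxi); under eq_fun do rewrite mulN1r.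
have Nd k : X (fun w => xi w - eta k w) /\
    fnorm X (fun w => xi w - eta k w) = fnorm X (fun w => eta k w - xi w).
  apply: (fs_ae_eq hX) => //.
    by apply: measurable_funB; exact: (qb_measurable hX).
  by apply: nearW => w; rewrite distrC.
apply: cvg_multiplicative_gap => [|c e c1 e0]; first exact: powR_ge0.
have [C C0 gap] := fnorm_gap c1.
have d0 : 0 < (e / C) `^ r^-1 by rewrite powR_gt0// divr_gt0.
have : \forall k \near \oo, C * fnorm X (fun w => eta k w - xi w) `^ r <= e.
  move/cvgrPdist_le : cv => /(_ _ d0); apply: filterS => k.
  rewrite sub0r normrN ger0_norm; last exact: (qb_ge0 hX).
  move=> h; rewrite mulrC -ler_pdivlMr//.
  rewrite -[leRHS](@powRVK _ _ r)//; last by rewrite divr_ge0// ltW.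
  by apply: le_powR => //; [exact: ltW|exact: (qb_ge0 hX)].
apply: filterS => k h; split.
  have := gap _ _ Xxi (Xd k).
  rewrite (_ : (fun w => _) = eta k); last by apply/funext => w; rewrite addrC subrK.
  by move/le_trans; apply; rewrite lerD2l.
have := gap _ _ (Xeta k) (Nd k).1.
rewrite (_ : (fun w => _) = xi); last by apply/funext => w; rewrite addrC subrK.
by move/le_trans; apply; rewrite lerD2l (Nd k).2.
Qed.

End norm_continuity.

(** The maxima of the 2^k |eta_k| stay bounded in X, since the r-th powers of the norms have partial
    sums 1 - 2^-J at most. The Fatou property makes their supremum S finite almost everywhere,
    whence |eta_k| <= S 2^-k. *)
Lemma weighted_null_seq {R : realType} {dT : measure_display}
    {T : measurableType dT} (mu : {measure set T -> \bar R}) (X : fspace R T)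
    (r : R) (eta : nat -> T -> R) : quasi_banach mu X -> 0 < r -> pconvex r X ->
  (forall k, X (eta k)) ->
  (forall k, (2 ^+ k * fnorm X (eta k)) `^ r <= 2^-1 ^+ k.+1) ->
  {ae mu, forall w, eta k w @[k --> \oo] --> 0}.
Proof.
move=> hX r0 cX Xeta small.
pose y k w := 2 ^+ k * `|eta k w|.
have Xy k : X (y k) by apply: (qb_scale hX); exact: (fs_abs hX (Xeta k)).1.
have ny k : fnorm X (y k) = 2 ^+ k * fnorm X (eta k).
  by rewrite (fs_normZ hX) ?exprn_ge0//; [rewrite (fs_abs hX (Xeta k)).2|exact: (fs_abs hX (Xeta k)).1].
have y0 k w : 0 <= y k w by rewrite mulr_ge0.
pose M := fix M J : T -> R :=
  if J is J'.+1 then fun w => Num.max (M J' w) (y J' w) else fun=> 0.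
have XM J : X (M J) by elim: J => [|J IH]; [exact: (fs_0 hX)|exact: (fs_max hX)].
have M0 J w : 0 <= M J w by elim: J => [|J IH] //=; rewrite le_max IH.
have nM J : fnorm X (M J) `^ r <= 1 - 2^-1 ^+ J.
  elim: J => [|J IH].
    by rewrite expr0 subrr (fs_norm0 hX) powR0 ?gt_eqF.
  apply: (le_trans (pconvex_max hX r0 cX (XM J) (Xy J))).
  have := small J; rewrite -ny exprS => h; lra.
have nM1 J : fnorm X (M J) <= 1.
  rewrite -[leLHS](@powRKV _ _ r)//; last exact: (qb_ge0 hX).
  have -> : 1 = 1 `^ r^-1 :> R by rewrite powR1.
  apply: le_powR; [by rewrite invr_ge0 ltW|exact: powR_ge0|].
  by apply: (le_trans (nM J)); rewrite gerBl exprn_ge0.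
pose phi J w := (M J w)%:E.
have mono w : {homo phi ^~ w : k l / (k <= l)%N >-> (k <= l)%E}.
  apply: homo_leq => [x|b a c|k]; [exact: lexx|exact: le_trans|].
  by rewrite /phi lee_fin le_max lexx.
have mphi k : measurable_fun [set: T] (phi k).
  by apply/measurable_EFinP; exact: (qb_measurable hX).
have phi0 k w : (0 <= phi k w)%E by rewrite lee_fin.
have nphi k : (enorm mu X (phi k) <= 1%:E)%E.
  by rewrite (enorm_EFin mu (XM k)) lee_fin.
have [fin _ _] := enorm_fin (enorm_fatou hX mphi phi0 mono nphi).
apply: filterS fin => w; set S := ereal_sup _ => Sfin.
have bound k : `|eta k w| <= fine S * 2^-1 ^+ k.
  rewrite exprVn ler_pdivlMr ?exprn_gt0// mulrC -lee_fin fineK//.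
  apply: (@le_trans _ _ (phi k.+1 w)); last by apply: ereal_sup_ubound; exists k.+1.
  by rewrite lee_fin /= le_max lexx orbT.
have g0 : fine S * 2^-1 ^+ k @[k --> \oo] --> 0.
  by apply: (@cvg_geometric R (fine S) 2^-1); rewrite ger0_norm ?invr_ge0// invf_lt1 ?ltr1n.
apply/norm_cvg0P; apply: (squeeze_cvgr _ (cvg_cst 0) g0).
by apply: nearW => k; rewrite normr_ge0 bound.
Qed.

Section strong_measurability.
Context {R : realType} {dT : measure_display} {T : measurableType dT}.
Variable mu : {sigma_finite_measure set T -> \bar R}.
Variables (X : fspace R T) (r : R).
Hypothesis hX : quasi_banach mu X.
Hypothesis r0 : 0 < r.
Hypothesis cX : pconvex r X.
Variables (n : nat) (f : n.-tuple R -> T -> R).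
Hypothesis sf : strongly_measurable X f.

(** [zeta] enumerates the values of all the approximating simple functions. Off [N] the norms are
    limits of functions of countable labels, because r-convexity makes the r-th power of the
    quasi-norm continuous along convergent sequences. *)
Lemma strongly_measurable_dense : exists (N : set (n.-tuple R)) (zeta : nat -> T -> R),
  [/\ measurable N /\ leb n N = 0%E, forall i, X (zeta i),
    forall x, ~ N x -> forall e, 0 < e ->
      exists i, fnorm X (fun w => zeta i w - f x w) < e,
    forall i, measurable_fun (~` N) (fun x => fnorm X (fun w => zeta i w - f x w)) &
    measurable_fun (~` N) (fun x => fnorm X (f x))].
Proof.
have [mf Xf [s [ss [N [mN N0 sN]]]]] := sf.
have /choice[ke hke] k : exists ke : (n.-tuple R -> nat) * (nat -> T -> R),
    [/\ fibers ke.1, forall i, X (ke.2 i) & forall x, s k x = ke.2 (ke.1 x)].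
  by have [kap [eta h]] := simple_valued_fibers hX (ss k); exists (kap, eta).
pose zeta i := if @unpickle (nat * nat)%type i is Some ab then (ke ab.1).2 ab.2 else fun=> 0.
have Xz i : X (zeta i).
  rewrite /zeta; case: (unpickle i) => [[a b]|]; last exact: (fs_0 hX).
  by have [_ Xb _] := hke a; exact: Xb.
have cv x : ~ N x -> fnorm X (fun w => s k x w - f x w) @[k --> \oo] --> 0.
  by move=> Nx; apply: contrapT => h; exact/Nx/sN.
have Xs k x : X (s k x) by have [_ Xb ->] := hke k; exact: Xb.
have mnorm (u : T -> R) : X u ->
    measurable_fun (~` N) (fun x => fnorm X (fun w => u w - f x w)).
  move=> Xu.
  have Xd (v : T -> R) : X v -> X (fun w => u w - v w).
    move=> Xv; have := qb_add hX Xu (qb_scale hX (-1) Xv).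
    by under eq_fun do rewrite mulN1r.
  have cvr x : ~ N x -> fnorm X (fun w => u w - s k x w) `^ r @[k --> \oo] -->
      fnorm X (fun w => u w - f x w) `^ r.
    move=> Nx; apply: (fnorm_cvg hX r0 cX); [exact: Xd|by move=> k; exact: Xd|].
    rewrite (_ : (fun k => _) = (fun k => fnorm X (fun w => s k x w - f x w))).
      exact: cv.
    apply/funext => k.
    apply: (fs_ae_eq hX _ _ _).2.
    - apply: measurable_funB; apply: (qb_measurable hX); exact: Xd.
    - have := qb_add hX (Xs k x) (qb_scale hX (-1) (Xf x)).
      by under eq_fun do rewrite mulN1r.
    - by apply: nearW => w; rewrite -normrN; congr (`| _ |); ring.
  have mk k : measurable_fun (~` N) (fun x => fnorm X (fun w => u w - s k x w) `^ r).
    have [fk _ sE] := hke k.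
    rewrite (_ : (fun x => _) =
      (fun i => fnorm X (fun w => u w - (ke k).2 i w) `^ r) \o (ke k).1).
      by apply: measurable_funTS; exact: fibers_comp.
    by apply/funext => x /=; rewrite sE.
  rewrite (_ : (fun x => _) = (fun x => (fnorm X (fun w => u w - f x w) `^ r) `^ r^-1)).
    apply: (measurableT_comp (measurable_powR _)).
    by apply: (measurable_fun_cvg mk) => x; exact: cvr.
  apply/funext => x; rewrite powRKV//; apply: (qb_ge0 hX); exact: Xd.
exists N, zeta; split => //.
- move=> x Nx e e0.
  have [k _ hk] : \forall k \near \oo, fnorm X (fun w => s k x w - f x w) < e.
    move/cvgrPdist_lt : (cv x Nx) => /(_ e e0); apply: filterS => k.
    rewrite sub0r normrN ger0_norm//; apply: (qb_ge0 hX).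
    have := qb_add hX (Xs k x) (qb_scale hX (-1) (Xf x)).
    by under eq_fun do rewrite mulN1r.
  exists (pickle (k, (ke k).1 x)); rewrite /zeta pickleK.
  by have [_ _ sE] := hke k; rewrite /= -sE; apply: hk => /=.
- by move=> i; exact: mnorm.
rewrite (_ : (fun x => _) = (fun x => fnorm X (fun w => 0 - f x w))).
  by apply: mnorm; exact: (fs_0 hX).
apply/funext => x; apply/esym; apply: (fs_ae_eq hX _ (Xf x) _).2.
  apply: measurable_funB => //; exact: (qb_measurable hX).
by apply: nearW => w; rewrite sub0r normrN.
Qed.

End strong_measurability.

Section minkowski.
Context {R : realType} {dT : measure_display} {T : measurableType dT}.
Variable mu : {sigma_finite_measure set T -> \bar R}.
Variables (X : fspace R T) (r : R).
Hypothesis hX : quasi_banach mu X.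
Hypothesis r0 : 0 < r.
Hypothesis cX : pconvex r X.
Variable n : nat.
Local Open Scope ereal_scope.

Definition fiber_weight (D : set (n.-tuple R)) (v : R) (kap : n.-tuple R -> nat) i : R :=
  (fine (leb n (D `&` kap @^-1` [set i])) / v)%R.

Lemma fiber_weight_ge0 D v kap i : (0 < v)%R -> (0 <= fiber_weight D v kap i)%R.
Proof. by move=> v0; rewrite divr_ge0 ?fine_ge0// ltW. Qed.

Lemma average_fibers (D : set (n.-tuple R)) (v : R) (kap : n.-tuple R -> nat)
    (F : nat -> R) : measurable D -> leb n D = v%:E -> (0 < v)%R -> fibers kap ->
  (forall i, (0 <= F i)%R) ->
  average r D (fun x => (F (kap x))%:E) =
  ereal_sup (range (fun K =>
    ((\sum_(i < K) fiber_weight D v kap i * F i `^ r)%R `^ r^-1)%:E)).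
Proof.
move=> mD Dv v0 fk F0.
pose A i := D `&` kap @^-1` [set i].
have mA i : measurable (A i) by apply: measurableI.
have finA i : leb n (A i) \is a fin_num.
  rewrite ge0_fin_numE//; apply: (@le_lt_trans _ _ (leb n D)); last by rewrite Dv ltry.
  by apply: le_measure; rewrite ?inE//; exact: subIsetl.
have tA : trivIset [set: nat] A.
  by move=> i j _ _ [x [[_ <-] [_ <-]]].
have DA : D = \bigcup_i A i.
  by apply/seteqP; split => [x Dx|x [i _ []]//]; exists (kap x).
pose S K : R := (\sum_(i < K) fiber_weight D v kap i * F i `^ r)%R.
have S0 K : (0 <= S K)%R.
  by apply: sumr_ge0 => i _; rewrite mulr_ge0 ?powR_ge0// fiber_weight_ge0.
have E1 : (leb n D)^-1 * \int[leb n]_(x in D) (`|(F (kap x))%:E| `^ r) =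
    ereal_sup (range (fun K => (S K)%:E)).
  rewrite {2}DA ge0_integral_bigcup//; last first.
    move=> x _; exact: poweR_ge0.
    apply: measurable_funTS.
    exact: (fibers_comp (fun i => `|(F i)%:E| `^ r) fk).
  have -> : \big[+%E/0]_(0 <= i <oo) \int[leb n]_(x in A i) (`|(F (kap x))%:E| `^ r) =
      \big[+%E/0]_(0 <= i <oo) (fine (leb n (A i)) * F i `^ r)%:E.
    apply: eq_eseriesr => i _.
    rewrite (eq_integral (cst (F i `^ r)%:E)); last first.
      by move=> x /set_mem[_ <-]; rewrite /cst -poweR_EFin gee0_abs// lee_fin.
    by rewrite integral_cst// EFinM fineK// muleC.
  have -> : \big[+%E/0]_(0 <= i <oo) (fine (leb n (A i)) * F i `^ r)%:E =
      ereal_sup (range (fun K => (\sum_(i < K) fine (leb n (A i)) * F i `^ r)%:E)).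
    apply/cvg_lim => //.
    rewrite (_ : (fun K => _) = (fun K => \sum_(0 <= i < K) (fine (leb n (A i)) * F i `^ r)%:E)); last first.
      by apply/funext => K; rewrite sumEFin big_mkord.
    rewrite (_ : (fun K => _ %:E) = (fun K => \sum_(0 <= i < K) (fine (leb n (A i)) * F i `^ r)%:E)); last first.
      by apply/funext => K; rewrite sumEFin big_mkord.
    apply: ereal_nondecreasing_cvgn; apply: ereal_nondecreasing_series => i _ _.
    by rewrite lee_fin mulr_ge0 ?powR_ge0// fine_ge0.
  rewrite Dv inver gt_eqF// -ereal_sup_pZl ?invr_gt0//; congr ereal_sup.
  apply/seteqP; split.
    move=> _ [_ [K _ <-] <-]; exists K => //; rewrite -EFinM; congr EFin.
    rewrite /S mulr_sumr; apply: eq_bigr => i _; rewrite /fiber_weight /A; ring.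
  move=> _ [K _ <-]; exists (\sum_(i < K) fine (leb n (A i)) * F i `^ r)%:E; first by exists K.
  rewrite -EFinM; congr EFin.
  rewrite /S mulr_sumr; apply: eq_bigr => i _; rewrite /fiber_weight /A; ring.
rewrite /average E1; apply/le_anti/andP; split.
  have r1 : (0 < r^-1)%R by rewrite invr_gt0.
  have S0e K : 0 <= (S K)%:E by rewrite lee_fin.
  exact: (poweR_ereal_sup r1 S0e).
apply: ge_ereal_sup => _ [K _ <-]; rewrite -poweR_EFin; apply: le_poweR.
- by rewrite invr_ge0 ltW.
- by rewrite lee_fin; exact: S0.
- by apply: ereal_sup_ubound; exists K.
Qed.

(** For finitely many fibers this is r-convexity, applied to the values scaled by the r-th roots of
    the relative measures of their fibers; [enorm_fatou] passes to all fibers. *)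
Lemma minkowski_fibers (D : set (n.-tuple R)) (v : R) (kap : n.-tuple R -> nat)
    (zeta : nat -> T -> R) : measurable D -> leb n D = v%:E -> (0 < v)%R ->
  fibers kap -> (forall i, X (zeta i)) ->
  enorm mu X (fun w => average r D (fun x => (zeta (kap x) w)%:E))
  <= average r D (fun x => (fnorm X (zeta (kap x)))%:E).
Proof.
move=> mD Dv v0 fk Xz.
have z0 i : (0 <= fnorm X (zeta i))%R by exact: (qb_ge0 hX).
rewrite (average_fibers mD Dv v0 fk z0).
pose k (i : nat) : R := (fiber_weight D v kap i `^ r^-1)%R.
have k0 i : (0 <= k i)%R by exact: powR_ge0.
pose y (i : nat) w := (k i * zeta i w)%R.
have Xy i : X (y i) by exact: (qb_scale hX).
pose phi K w := (((\sum_(i < K) `|y i w| `^ r)%R `^ r^-1)%R)%:E.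
have phiE K w : phi K w =
    ((\sum_(i < K) fiber_weight D v kap i * `|zeta i w| `^ r)%R `^ r^-1)%:E.
  congr EFin; congr (_ `^ _)%R; apply: eq_bigr => i _.
  by rewrite /y normrM (ger0_norm (k0 i)) powRM// powRVK// fiber_weight_ge0.
have -> : (fun w => average r D (fun x => (zeta (kap x) w)%:E)) =
    (fun w => ereal_sup (range (phi ^~ w))).
  apply/funext => w.
  transitivity (average r D (fun x => `|zeta (kap x) w|%:E)).
    by apply: eq_average_abs => x _; rewrite /= normr_id.
  rewrite (average_fibers (F := fun i => `|zeta i w|%R) mD Dv v0 fk)//.
  by congr ereal_sup; apply/seteqP; split => _ [K _ <-]; exists K; rewrite ?phiE.
set B := ereal_sup _; have B0 : 0 <= B.
  apply: (@le_trans _ _ ((\sum_(i < 0) fiber_weight D v kap i * fnorm X (zeta i) `^ r)%R `^ r^-1)%:E).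
    by rewrite lee_fin powR_ge0.
  by apply: ereal_sup_ubound; exists 0%N.
have XK K : X (fun w => (\sum_(i < K) `|y i w| `^ r)%R `^ r^-1)%R.
  by apply: (fs_powR_sum hX) => // i.
have nK K : enorm mu X (phi K) <= B.
  apply: (@le_trans _ _ ((\sum_(i < K) fiber_weight D v kap i * fnorm X (zeta i) `^ r)%R `^ r^-1)%:E); last first.
    by apply: ereal_sup_ubound; exists K.
  rewrite (enorm_EFin mu (XK K)) lee_fin.
  rewrite -[leLHS](@powRKV _ _ r)//; last exact: (qb_ge0 hX).
  apply: le_powR; [by rewrite invr_ge0 ltW|exact: powR_ge0|].
  apply: (le_trans (pconvexE hX r0 cX _)) => //.
  apply: ler_sum => i _.
  by rewrite (fs_normZ hX)// powRM// powRVK// fiber_weight_ge0.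
have [Bfin|] := boolP (B \is a fin_num); last first.
  by rewrite ge0_fin_numE// ltey negbK => /eqP ->; rewrite leey.
rewrite -(fineK Bfin); apply: (enorm_fatou hX).
- by move=> K; apply/measurable_EFinP; exact: (qb_measurable hX (XK K)).
- by move=> K w; rewrite lee_fin powR_ge0.
- move=> w; apply: homo_leq => [x|b a c|K]; [exact: lexx|exact: le_trans|].
  rewrite lee_fin; apply: le_powR; [by rewrite invr_ge0 ltW| |].
    by apply: sumr_ge0 => i _; exact: powR_ge0.
  by rewrite big_ord_recr/= lerDl powR_ge0.
- by move=> K; rewrite fineK.
Qed.

End minkowski.

Lemma measurable_fibers_joint {R : realType} d1 d2 (T1 : measurableType d1)
    (T2 : measurableType d2) (kap : T1 -> nat) (zeta : nat -> T2 -> R) :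
  fibers kap -> (forall i, measurable_fun [set: T2] (zeta i)) ->
  measurable_fun [set: T1 * T2] (fun z => zeta (kap z.1) z.2).
Proof.
move=> fk mz _ Y mY; rewrite setTI.
have -> : (fun z : T1 * T2 => zeta (kap z.1) z.2) @^-1` Y =
    \bigcup_i ((kap @^-1` [set i]) `*` (zeta i @^-1` Y)).
  apply/seteqP; split => [[x w] Yz|[x w] [i _ [/= ki Yz]]].
    by exists (kap x).
  by rewrite /= ki.
apply: bigcup_measurable => i _; apply: measurableX => //.
by rewrite -[X in measurable X]setTI; exact: mz.
Qed.

Section strong_minkowski.
Context {R : realType} {dT : measure_display} {T : measurableType dT}.
Variable mu : {sigma_finite_measure set T -> \bar R}.
Variables (X : fspace R T) (r : R).
Hypothesis hX : quasi_banach mu X.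
Hypothesis r0 : 0 < r.
Hypothesis cX : pconvex r X.
Variables (n : nat) (f : n.-tuple R -> T -> R).
Hypothesis sf : strongly_measurable X f.

Lemma fs_sub xi eta : X xi -> X eta -> X (fun w => xi w - eta w).
Proof.
move=> Xxi Xeta; have := qb_add hX Xxi (qb_scale hX (-1) Xeta).
by under eq_fun do rewrite mulN1r.
Qed.

Lemma efnorm_measurable : exists h : n.-tuple R -> R,
  [/\ measurable_fun [set: n.-tuple R] h, forall x, 0 <= h x &
    {ae leb n, forall x, fnorm X (f x) = h x}].
Proof.
have [_ Xf _] := sf.
have [N [zeta [[mN N0] _ _ _ mf]]] := strongly_measurable_dense hX r0 cX sf.
exists (fun x => fnorm X (f x) * \1_(~` N) x); split.
- have -> : (fun x => fnorm X (f x) * \1_(~` N) x) = (fun x => fnorm X (f x)) \_ (~` N).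
    apply/funext => x; rewrite patchE indicE; case: ifP => _; rewrite ?mulr1 ?mulr0//.
  by apply/(measurable_restrictT _ (measurableC mN)).
- by move=> x; rewrite mulr_ge0//; exact: (qb_ge0 hX).
exists N; split => // x /= h; apply: contrapT => Nx; apply: h.
by rewrite indicE mem_set// mulr1.
Qed.

Lemma approximation_ae (kap : nat -> n.-tuple R -> nat) (zeta : nat -> T -> R) x :
  (forall i, X (zeta i)) -> X (f x) ->
  (forall j, (2 ^+ j * fnorm X (fun w => zeta (kap j x) w - f x w)) `^ r <= 2^-1 ^+ j.+1) ->
  {ae mu, forall w, (`|f x w|%:E <= limn_einf (fun j => `|zeta (kap j x) w|%:E))%E}.
Proof.
move=> Xz Xf small.
have := weighted_null_seq hX r0 cX (fun j => fs_sub (Xz (kap j x)) Xf) small.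
apply: filterS => w cv0.
have cv : zeta (kap j x) w @[j --> \oo] --> f x w.
  rewrite -[X in _ --> X]add0r.
  rewrite (_ : (fun j => _) = (fun j => (zeta (kap j x) w - f x w) + f x w)).
    by apply: cvgD => //; exact: cvg_cst.
  by apply/funext => j; rewrite subrK.
have : (`|zeta (kap j x) w|%:E @[j --> \oo] --> `|f x w|%:E)%E.
  by apply: cvg_EFin; [exact: nearW|exact: cvg_norm].
by move=> /cvg_limn_einf_sup[-> _].
Qed.

Local Open Scope ereal_scope.

(** Countably valued approximants reduce the claim to [minkowski_fibers]. For almost every x they
    converge so fast that they converge almost everywhere in w; [ae_swap] exchanges the quantifiers,
    then Fatou's lemma acts in x for fixed w and [enorm_einf] acts in X. *)
Lemma strong_minkowski (D : set (n.-tuple R)) (v : R) :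
  measurable D -> leb n D = v%:E -> (0 < v)%R ->
  enorm mu X (fun w => average r D (fun x => (f x w)%:E)) <= average r D (efnorm X f).
Proof.
move=> mD Dv v0.
have [mf Xf _] := sf.
have [h [mh h0 fh]] := efnorm_measurable.
have [N [zeta [[mN N0] Xz dz mz _]]] := strongly_measurable_dense hX r0 cX sf.
(* The rate for which (2^j dl_j)^r = 2^-(j+1), as [weighted_null_seq] demands. *)
pose dl (j : nat) : R := ((2^-1 ^+ j.+1) `^ r^-1 / 2 ^+ j)%R.
have dl0 j : (0 < dl j)%R by rewrite divr_gt0 ?powR_gt0 ?exprn_gt0.
have dlr j : ((2 ^+ j * dl j) `^ r = 2^-1 ^+ j.+1)%R.
  by rewrite /dl mulrCA divff ?gt_eqF ?exprn_gt0// mulr1 powRVK// exprn_ge0.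
have /choice[kap hkap] j : exists kap, fibers kap /\ forall x, ~ N x ->
    (fnorm X (fun w => zeta (kap x) w - f x w) < dl j)%R.
  pose B i := ~` N `&` [set x | (fnorm X (fun w => zeta i w - f x w)%R < dl j)%R].
  have mB i : measurable (B i).
    have := measurable_lte (measurableC mN)
      (f := fun x => (fnorm X (fun w => zeta i w - f x w)%R)%:E) (g := cst (dl j)%:E).
    by apply; [apply/measurable_EFinP; exact: mz|exact: measurable_cst].
  have [kap [fk kB]] := first_index mB; exists kap; split => // x Nx.
  by have [i hi] := dz x Nx _ (dl0 j); have [] := kB x (ex_intro2 _ _ i I (conj Nx hi)).
pose g j x := zeta (kap j x).
have mg j : measurable_fun [set: n.-tuple R * T] (fun z => g j z.1 z.2).
  exact: (measurable_fibers_joint (hkap j).1 (fun i => qb_measurable hX (Xz i))).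
have r1 : (0 < r^-1)%R by rewrite invr_gt0.
pose P := [set z : n.-tuple R * T |
  `|f z.1 z.2|%:E <= limn_einf (fun j => `|g j z.1 z.2|%:E)].
have mP : measurable P.
  rewrite -[P]setTI; apply: measurable_lee => //.
    by apply/measurable_EFinP; exact: measurableT_comp.
  apply: (measurable_limn_einf (f := fun j (z : n.-tuple R * T) => `|g j z.1 z.2|%:E)) => j.
  by apply/measurable_EFinP; exact: measurableT_comp.
have aeP : {ae mu, forall w, {ae leb n, forall x, P (x, w)}}.
  apply: (@ae_swap _ _ _ _ _ (@leb_sf R n) mu P mP).
  exists N; split => // x /= hx; apply: contrapT => Nx; apply: hx.
  apply: (approximation_ae Xz (Xf x)) => j; rewrite -dlr; apply: le_powR.
  - exact: ltW.
  - by rewrite mulr_ge0 ?exprn_ge0//; apply: (qb_ge0 hX); exact: fs_sub.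
  - by rewrite ler_wpM2l ?exprn_ge0// ltW//; have [_ ] := hkap j; apply.
pose phi j w := average r D (fun x => (g j x w)%:E).
have mphi j : measurable_fun [set: T] (phi j) by exact: measurable_average.
have phi0 j w : 0 <= phi j w by exact: average_ge0.
have vi : (0 < v^-1)%R by rewrite invr_gt0.
have le1 : {ae mu, forall w, 0 <= average r D (fun x => (f x w)%:E) <= limn_einf (phi ^~ w)}.
  apply: filterS aeP => w hw; rewrite average_ge0/=.
  pose u j := v^-1%:E * \int[leb n]_(x in D) (`|(g j x w)%:E| `^ r).
  have u0 j : 0 <= u j.
    by rewrite mule_ge0 ?lee_fin ?(ltW vi)// integral_ge0// => x _; exact: poweR_ge0.
  have phiu : phi ^~ w = (fun j => u j `^ r^-1).
    by apply/funext => j; rewrite /phi /average Dv inver gt_eqF.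
  rewrite phiu; apply: le_trans (poweR_limn_einf r1 u0).
  rewrite /average Dv inver (gt_eqF v0); apply: le_poweR; first exact: ltW.
    by rewrite mule_ge0 ?lee_fin ?(ltW vi)// integral_ge0// => x _; exact: poweR_ge0.
  apply: le_trans (limn_einfZ_ge _ vi); rewrite lee_pmul2l//.
  have mgx j : measurable_fun D (fun x => `|(g j x w)%:E| `^ r).
    apply: measurable_funTS.
    exact: (fibers_comp (fun i => `|(zeta i w)%:E| `^ r) (hkap j).1).
  have mgx0 j x : D x -> 0 <= `|(g j x w)%:E| `^ r by move=> _; exact: poweR_ge0.
  apply: le_trans (fatou (leb n) mD mgx mgx0).
  apply: ae_le_lower_integral => [x _|x _|].
  - exact: poweR_ge0.
  - by apply: limn_einf_ge0 => j; exact: poweR_ge0.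
  apply: filterS hw => x Px _.
  apply: le_trans (poweR_limn_einf r0 _); last by move=> j; exact: abse_ge0.
  by apply: le_poweR => //; exact: ltW.
have mav : measurable_fun [set: T] (fun w => average r D (fun x => (f x w)%:E)).
  exact: measurable_average.
apply: (le_trans (enorm_le hX mav le1)).
pose al := v^-1%:E * \int[leb n]_(x in D) (h x `^ r)%:E.
have avE : average r D (efnorm X f) = al `^ r^-1.
  have IE : \int[leb n]_(x in D) (`|efnorm X f x| `^ r) = \int[leb n]_(x in D) (h x `^ r)%:E.
    apply: ae_eq_lower_integral => [x _|x _|]; first exact: poweR_ge0.
      by rewrite lee_fin powR_ge0.
    by apply: filterS fh => x fhx; rewrite /efnorm fhx poweR_EFin ger0_norm.
  by rewrite /average Dv inver (gt_eqF v0) IE.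
rewrite avE.
have al0 : 0 <= al.
  rewrite mule_ge0 ?lee_fin ?(ltW vi)// integral_ge0// => x _.
  by rewrite lee_fin powR_ge0.
have [alfin|] := boolP (al \is a fin_num); last first.
  by rewrite ge0_fin_numE// ltey negbK => /eqP ->; rewrite poweRyr ?gt_eqF// leey.
set E := enorm _ _ _; set a := fine al.
have a0 : (0 <= a)%R by rewrite fine_ge0.
have alE : al = a%:E by rewrite /a fineK.
(* Replacing f by an approximant multiplies the r-th power of the norm by c and adds C dl_j^r, which
   is at most e for late j. Afterwards c tends to 1 and e to 0. *)
have key (c e : R) : (1 < c)%R -> (0 < e)%R -> E <= ((c * a + e) `^ r^-1)%:E.
  move=> c1 e0.
  have c0 : (0 < c)%R by exact: lt_trans c1.
  have [C C0 gap] := fnorm_gap hX r0 cX c1.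
  have [J _ hJ] : \forall j \near \oo, (C * dl j `^ r <= e)%R.
    have g0 : (C * 2^-1 ^+ k)%R @[k --> \oo] --> (0%R : R).
      by apply: (@cvg_geometric R C 2^-1); rewrite ger0_norm ?invr_ge0// invf_lt1 ?ltr1n.
    move/cvgrPdist_le : g0 => /(_ e e0); apply: filterS => j.
    rewrite sub0r normrN ger0_norm ?mulr_ge0 ?exprn_ge0 ?(ltW C0)//.
    apply: le_trans; rewrite ler_wpM2l ?(ltW C0)//.
    apply: (@le_trans _ _ ((2 ^+ j * dl j) `^ r)%R).
      apply: le_powR; [exact: ltW|exact: ltW|].
      by rewrite ler_peMl ?(ltW (dl0 j))// exprn_ege1// ler1n.
    by rewrite dlr exprS ler_piMl ?exprn_ge0// invf_le1// ler1n.
  apply: (enorm_einf hX) => // k.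
  exists (maxn k J); first exact: leq_maxl.
  set j := maxn k J.
  have [fk kd] := hkap j.
  apply: (le_trans (minkowski_fibers hX r0 cX mD Dv v0 fk Xz)).
  rewrite /average Dv inver (gt_eqF v0) -poweR_EFin; apply: le_poweR; first exact: ltW.
    by rewrite mule_ge0 ?lee_fin ?(ltW vi)// integral_ge0// => x _; exact: poweR_ge0.
  have mhr : measurable_fun D (fun x => (h x `^ r)%:E).
    apply/measurable_EFinP; apply: measurable_funTS.
    exact: (measurableT_comp (measurable_powR _)).
  have hr0 x : 0 <= (h x `^ r)%:E by rewrite lee_fin powR_ge0.
  have Iv : \int[leb n]_(x in D) (h x `^ r)%:E = (v * a)%:E.
    rewrite EFinM -alE /al muleA -EFinM mulfV ?gt_eqF// mul1e//.
  have -> : (c * a + e)%:E =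
      v^-1%:E * \int[leb n]_(x in D) (c%:E * (h x `^ r)%:E + (cst e%:E x)).
    have I1 : \int[leb n]_(x in D) (c%:E * (h x `^ r)%:E) = (c * (v * a))%:E.
      by rewrite ge0_integralZl//; [rewrite Iv|rewrite lee_fin ltW].
    have I2 : \int[leb n]_(x in D) cst e%:E x = (e * v)%:E.
      by rewrite integral_cst// Dv.
    rewrite ge0_integralD//.
    - by rewrite I1 I2 -EFinD -EFinM; congr EFin; field; rewrite gt_eqF.
    - by move=> x _; rewrite mule_ge0// lee_fin ltW.
    - exact: emeasurable_funM.
    - by move=> x _; rewrite lee_fin ltW.
  rewrite lee_pmul2l//; apply: ae_le_lower_integral => [x _|x _|].
  - exact: poweR_ge0.
  - by rewrite adde_ge0 ?lee_fin ?(ltW e0)// mulr_ge0 ?powR_ge0 ?(ltW c0).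
  have aeN : {ae leb n, forall x, ~ N x}.
    by exists N; split => // x /=; apply: contrapT.
  apply: filterS2 aeN fh => x Nx fhx _.
  rewrite poweR_EFin ger0_norm; last exact: (qb_ge0 hX).
  rewrite /cst -EFinM -EFinD lee_fin -fhx.
  have Xd := fs_sub (Xz (kap j x)) (Xf x).
  have := gap _ _ (Xf x) Xd.
  rewrite (_ : (fun w => _) = zeta (kap j x)); last first.
    by apply/funext => w; rewrite addrC subrK.
  move=> hg; apply: (le_trans hg); rewrite lerD2l.
  apply: le_trans (hJ j (leq_maxr _ _)); rewrite ler_wpM2l ?(ltW C0)//.
  by apply: le_powR; [exact: ltW|exact: (qb_ge0 hX)|exact/ltW/kd].
have E0 : 0 <= E by exact: enorm_ge0.
have Efin : E \is a fin_num.
  rewrite ge0_fin_numE// (le_lt_trans (key 2%R 1%R _ _)) ?ltr1n ?ltry//.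
rewrite alE poweR_EFin -(fineK Efin) lee_fin.
have y0 : (0 <= fine E)%R by rewrite fine_ge0.
rewrite -[leLHS](powRKV r0 y0); apply: le_powR; [exact: ltW|exact: powR_ge0|].
apply/ler_addgt0Pr => e e0.
pose e' := (e / (a + 1))%R.
have a1 : (0 < a + 1)%R by rewrite ltr_wpDl.
have e'0 : (0 < e')%R by rewrite divr_gt0.
have c1 : (1 < 1 + e')%R by rewrite ltrDl.
have := key _ _ c1 e'0; rewrite -(fineK Efin) lee_fin => hE.
have : (fine E `^ r <= ((1 + e') * a + e')%R)%R.
  have nn : (0 <= (1 + e') * a + e')%R.
    by rewrite addr_ge0 ?(ltW e'0)// mulr_ge0// addr_ge0// ltW.
  rewrite -[leRHS](powRVK r0 nn).
  by apply: le_powR; [exact: ltW| |].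
have -> : ((1 + e') * a + e' = a + e' * (a + 1))%R by ring.
by rewrite /e' divfK// gt_eqF.
Qed.

End strong_minkowski.

(** * Trees of dyadic cubes *)

Section dyadic_splitting.
Context {R : realType} (d : nat).
Notation param := (d.-tuple R * R)%type.
Notation E := {ffun 'I_d -> bool}.

Definition dyadic_child (e : E) (p : param) : param :=
  ([tuple tnth p.1 i + p.2 / 2 * (e i)%:R | i < d], p.2 / 2).

Lemma dyadic_pos e p : 0 < p.2 -> 0 < (dyadic_child e p).2.
Proof. by move=> p0; rewrite divr_gt0. Qed.

Lemma dyadic_childP e p y : cubep (dyadic_child e p) y <->
  forall i, tnth p.1 i + p.2 / 2 * (e i)%:R <= tnth y i
    < tnth p.1 i + p.2 / 2 * (e i)%:R + p.2 / 2.
Proof.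
split=> [/cubeP h i|h]; first by have := h i; rewrite tnth_mktuple.
by apply/cubeP => i; have := h i; rewrite tnth_mktuple.
Qed.

Lemma dyadic_cover p y : 0 < p.2 ->
  cubep p y <-> exists e, cubep (dyadic_child e p) y.
Proof.
move=> p0; split => [/cubeP h|[e /dyadic_childP h]].
  exists [ffun i => tnth p.1 i + p.2 / 2 <= tnth y i].
  apply/dyadic_childP => i; rewrite ffunE; have /andP[h1 h2] := h i.
  case: (leP (tnth p.1 i + p.2 / 2) (tnth y i)) => h3.
    by rewrite mulr1 h3/= -addrA -splitr.
  by rewrite mulr0 addr0 h1 h3.
apply/cubeP => i; have := h i; case: (e i); rewrite ?mulr1 ?mulr0 ?addr0.
  rewrite -addrA -splitr => /andP[h1 ->]; rewrite andbT (le_trans _ h1)//.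
  by rewrite lerDl ltW// divr_gt0.
move=> /andP[-> h2]; rewrite (lt_le_trans h2)// lerD2l.
by rewrite ler_pdivrMr// ler_peMr ?ler1n// ltW.
Qed.

Lemma dyadic_disj p y e e' : 0 < p.2 ->
  cubep (dyadic_child e p) y -> cubep (dyadic_child e' p) y -> e = e'.
Proof.
move=> p0 /dyadic_childP h /dyadic_childP h'; apply/ffunP => i.
have /andP[h1 h2] := h i; have /andP[h3 h4] := h' i.
move: h1 h2 h3 h4; case: (e i); case: (e' i) => //;
  rewrite ?mulr1 ?mulr0 ?addr0 => h1 h2 h3 h4.
  by have := le_lt_trans h1 h4; rewrite ltxx.
by have := le_lt_trans h3 h2; rewrite ltxx.
Qed.

Lemma dyadic_vol p e : 0 < p.2 -> vol (dyadic_child e p) = #|{: E}|%:R^-1 * vol p.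
Proof.
move=> _; rewrite /vol /= exprMn card_ffun card_bool card_ord natrX exprVn.
by rewrite mulrC.
Qed.

End dyadic_splitting.

Section tree_of_functions.
Context {R : realType} {dT : measure_display} {T : measurableType dT}.
Variable mu : {measure set T -> \bar R}.
Variables (m d : nat) (X : 'I_m -> fspace R T) (r : 'I_m -> R) (P : fspace R T).
Hypothesis hX : forall j, quasi_banach mu (X j).
Hypothesis hP : quasi_banach mu P.
Hypothesis PX : forall xi : 'I_m -> T -> R,
  (forall j, X j (xi j)) -> (forall j w, 0 <= xi j w) ->
  P (fun w => \prod_j xi j w) /\
  fnorm P (fun w => \prod_j xi j w) <= \prod_j fnorm (X j) (xi j).
Hypothesis cX : forall j, pconvex (r j) (X j).
Hypothesis r0 : forall j, 0 < r j.
Notation param := (d.-tuple R * R)%type.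
Notation E := {ffun 'I_d -> bool}.
Notation ch := (@dyadic_child R d).
Notation e0 := ([ffun=> false] : E).
Notation tree := (@tree R T E m).

Definition cube_int (phi : d.-tuple R -> \bar R) (p : param) : R :=
  fine (\int[leb d]_(y in cubep p) phi y).

Lemma cube_int_mean phi p : 0 < p.2 -> measurable_fun [set: d.-tuple R] phi ->
  (forall y, 0 <= phi y)%E -> (\int[leb d]_(y in cubep p) phi y < +oo)%E ->
  cube_int phi p / vol p = mean (fun e : E => cube_int phi (ch e p) / vol (ch e p)).
Proof.
move=> p0 mphi phi0 fin.
have sub (e : E) : cubep (ch e p) `<=` cubep p.
  by move=> y ye; apply/(dyadic_cover _ p0); exists e.
have fine_e (e : E) : (\int[leb d]_(y in cubep (ch e p)) phi y \is a fin_num)%E.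
  rewrite ge0_fin_numE; last exact: integral_ge0.
  apply: le_lt_trans fin; apply: ge0_subset_integral => //; try exact: measurable_cubep.
  exact: measurable_funTS.
rewrite {1}/cube_int (integral_split (@dyadic_cover R d) (@dyadic_disj R d) p0)//; last first.
  exact: measurable_funTS.
under eq_bigr do rewrite -(fineK (fine_e _)).
rewrite sumEFin big_enum /= /mean mulr_suml mulr_sumr; apply: eq_bigr => e _.
rewrite dyadic_vol// invfM invrK -/(cube_int phi (ch e p)).
have E0 : #|{: E}|%:R != 0 :> R.
  by rewrite pnatr_eq0 -lt0n; apply/card_gt0P; exists e0.
by rewrite [RHS]mulrCA mulKf.
Qed.

Lemma average_cube_int (rho : R) (h : d.-tuple R -> \bar R) p : 0 < p.2 ->
  (\int[leb d]_(y in cubep p) (`|h y| `^ rho) < +oo)%E ->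
  average rho (cubep p) h =
  ((cube_int (fun y => `|h y| `^ rho)%E p / vol p) `^ rho^-1)%:E.
Proof.
move=> p0 fin; rewrite /average leb_cubep// inver (gt_eqF (vol_gt0 p0)) -poweR_EFin.
congr (_ `^ _)%E; rewrite EFinM muleC; congr (_ * _)%E.
rewrite /cube_int fineK// ge0_fin_numE//.
by apply: integral_ge0 => y _; exact: poweR_ge0.
Qed.

Variables (f : 'I_m -> d.-tuple R -> T -> R) (h : 'I_m -> d.-tuple R -> R).
Variables (q : R) (g : d.-tuple R -> R).
Hypothesis q0 : 0 < q.
Hypothesis mf : forall j, measurable_fun [set: d.-tuple R * T] (fun z => f j z.1 z.2).
Hypothesis mh : forall j, measurable_fun [set: d.-tuple R] (h j).
Hypothesis mg : measurable_fun [set: d.-tuple R] g.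
Hypothesis fin_h : forall j p, 0 < p.2 ->
  (\int[leb d]_(y in cubep p) (`|(h j y)%:E| `^ r j) < +oo)%E.
Hypothesis fin_g : forall p, 0 < p.2 ->
  (\int[leb d]_(y in cubep p) (`|(g y)%:E| `^ q) < +oo)%E.
Hypothesis fX : forall j p, 0 < p.2 ->
  (enorm mu (X j) (fun w => average (r j) (cubep p) (fun y => (f j y w)%:E))
   <= average (r j) (cubep p) (EFin \o h j))%E.

Let hpow j y := (`|(h j y)%:E| `^ r j)%E.
Let gpow y := (`|(g y)%:E| `^ q)%E.
Let fpow j w y := (`|(f j y w)%:E| `^ r j)%E.

Definition avh j p := (cube_int (hpow j) p / vol p) `^ (r j)^-1.
Definition avf j p w := fine (average (r j) (cubep p) (fun y => (f j y w)%:E)).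
Definition cube_weight p := cube_int gpow p / vol p.

(** The leaves store averages over the smallest cubes; Minkowski's inequality, in the form [fX],
    makes [avh] a bound for the norm of [avf], as [good] requires. *)
Fixpoint mk k p : tree := if k is k'.+1 then Node (fun e => mk k' (ch e p))
  else Leaf (avf^~ p) (avh^~ p) (cube_weight p).

Lemma avhE j p : 0 < p.2 -> average (r j) (cubep p) (EFin \o h j) = (avh j p)%:E.
Proof. by move=> p0; rewrite average_cube_int//; exact: fin_h. Qed.

Lemma avf_fin j p : 0 < p.2 -> {ae mu, forall w,
  average (r j) (cubep p) (fun y => (f j y w)%:E) \is a fin_num} /\
  X j (avf j p) /\ fnorm (X j) (avf j p) <= avh j p.
Proof. by move=> p0; have := fX j p0; rewrite avhE// => /enorm_fin[]. Qed.

Lemma good_mk k p : 0 < p.2 -> good X (mk k p).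
Proof.
elim: k p => [|k IH] p p0 /=; last by move=> e; apply: IH; exact: dyadic_pos.
split=> [j|j w|j|].
- exact: (avf_fin j p0).2.1.
- by rewrite fine_ge0// average_ge0.
- exact: (avf_fin j p0).2.2.
- rewrite divr_ge0 ?(ltW (vol_gt0 p0))// fine_ge0// integral_ge0// => y _.
  exact: poweR_ge0.
Qed.

Lemma measurable_hpow j : measurable_fun [set: d.-tuple R] (hpow j).
Proof.
apply: (measurableT_comp (measurable_poweR _)).
by apply/measurable_EFinP; exact: measurableT_comp.
Qed.

Lemma measurable_gpow : measurable_fun [set: d.-tuple R] gpow.
Proof.
apply: (measurableT_comp (measurable_poweR _)).
by apply/measurable_EFinP; exact: measurableT_comp.
Qed.

Lemma measurable_fpow j w : measurable_fun [set: d.-tuple R] (fpow j w).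
Proof.
apply: (measurableT_comp (measurable_poweR _)).
apply/measurable_EFinP; apply: measurableT_comp => //.
exact: (measurableT_comp (mf j) (measurable_pair2 w)).
Qed.

Lemma treeW_mk k p : 0 < p.2 -> treeW (mk k p) = cube_weight p.
Proof.
elim: k p => [//|k IH] p p0 /=; rewrite /cube_weight cube_int_mean//.
- by congr mean; apply/funext => e; rewrite IH//; exact: dyadic_pos.
- exact: measurable_gpow.
- by move=> y; exact: poweR_ge0.
- exact: fin_g.
Qed.

Lemma powN_mk j k p : 0 < p.2 -> powN r j (mk k p) = cube_int (hpow j) p / vol p.
Proof.
elim: k p => [|k IH] p p0 /=.
  rewrite powRVK// divr_ge0 ?(ltW (vol_gt0 p0))// fine_ge0// integral_ge0// => y _.
  exact: poweR_ge0.
rewrite cube_int_mean//.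
- by congr mean; apply/funext => e; rewrite IH//; exact: dyadic_pos.
- exact: measurable_hpow.
- by move=> y; exact: poweR_ge0.
- exact: fin_h.
Qed.

Lemma treeN_mk j k p : 0 < p.2 -> treeN r j (mk k p) = avh j p.
Proof. by move=> p0; rewrite /treeN powN_mk. Qed.

Lemma powA_mk j k p w : 0 < p.2 -> (\int[leb d]_(y in cubep p) fpow j w y < +oo)%E ->
  powA r j (mk k p) w = cube_int (fpow j w) p / vol p.
Proof.
elim: k p => [|k IH] p p0 fin /=.
  rewrite /avf average_cube_int//= powRVK// divr_ge0 ?(ltW (vol_gt0 p0))//.
  by rewrite fine_ge0// integral_ge0// => y _; exact: poweR_ge0.
rewrite cube_int_mean//; last 2 first.
- exact: measurable_fpow.
- by move=> y; exact: poweR_ge0.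
congr mean; apply/funext => e; rewrite IH//; first exact: dyadic_pos.
apply: le_lt_trans fin; apply: ge0_subset_integral; try exact: measurable_cubep.
- by apply: measurable_funTS; exact: measurable_fpow.
- by move=> y _; exact: poweR_ge0.
- by move=> y ye; apply/(dyadic_cover _ p0); exists e.
Qed.

(** The identity is only almost everywhere because [avf] sends an infinite average to 0; the norm
    bounds confine this to a null set. *)
Lemma prodA_mk k p : 0 < p.2 -> {ae mu, forall w,
  (prodA r (mk k p) w)%:E = \prod_j average (r j) (cubep p) (fun y => (f j y w)%:E)}%E.
Proof.
move=> p0.
have fin : {ae mu, forall w, forall j : 'I_m,
    average (r j) (cubep p) (fun y => (f j y w)%:E) \is a fin_num}.
  by apply: filter_forall => j; exact: (avf_fin j p0).1.
apply: filterS fin => w fw; rewrite /prodA -prodEFin; apply: eq_bigr => j _.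
have finI : (\int[leb d]_(y in cubep p) fpow j w y < +oo)%E.
  rewrite ltey; apply/eqP => I; have := fw j.
  rewrite /average leb_cubep// inver (gt_eqF (vol_gt0 p0)) I gt0_muley.
    by rewrite poweRyr// gt_eqF// invr_gt0.
  by rewrite lte_fin invr_gt0; exact: vol_gt0.
by rewrite average_cube_int// /treeA powA_mk.
Qed.

Definition cubeG p := (\prod_j avh j p) `^ q * cube_weight p.

Lemma treeG_mk k p : 0 < p.2 -> treeG r q (mk k p) = cubeG p.
Proof.
move=> p0.
have NE : prodN r (mk k p) = \prod_j avh j p by apply: eq_bigr => j _; exact: treeN_mk.
by rewrite /treeG (treeW_mk k p0) NE.
Qed.

Lemma nodes_self (t : tree) p : p \in nodes ch t p.
Proof. by case: t => [a v w|c]; rewrite inE eqxx. Qed.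

Lemma nodes_child (c : E -> tree) p e q' :
  q' \in nodes ch (c e) (ch e p) -> q' \in nodes ch (Node c) p.
Proof.
move=> q'n; rewrite inE; apply/orP; right; apply/flattenP.
by exists (nodes ch (c e) (ch e p)) => //; apply: map_f; rewrite mem_enum.
Qed.

Lemma nodes_pos (t : tree) p q' : 0 < p.2 -> q' \in nodes ch t p -> 0 < q'.2.
Proof.
elim: t p => [a v x|c IH] p p0; first by rewrite inE => /eqP ->.
rewrite inE => /orP[/eqP -> //|/flattenP[_ /mapP[e _ ->]]].
by apply: IH; exact: dyadic_pos.
Qed.

Lemma nodes_sub (t : tree) p q' : 0 < p.2 -> q' \in nodes ch t p -> cubep q' `<=` cubep p.
Proof.
elim: t p => [a v x|c IH] p p0; first by rewrite inE => /eqP ->.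
rewrite inE => /orP[/eqP -> //|/flattenP[_ /mapP[e _ ->] q'n] y q'y].
by apply/(dyadic_cover _ p0); exists e; exact: (IH e _ (dyadic_pos e p0) q'n).
Qed.

(** A point of a leaf cell lies in all the cubes above it, so [Phi] dominates the running maximum
    there; [gam] carries that maximum down the tree. The intended [Phi] is the q-th power of
    M_(r,q). *)
Lemma treeH_integral (Phi : d.-tuple R -> \bar R) k p (gam : R) : 0 < p.2 -> 0 <= gam ->
  measurable_fun [set: d.-tuple R] Phi -> (forall y, 0 <= Phi y)%E ->
  (forall y, cubep p y -> gam%:E <= Phi y)%E ->
  (forall q', q' \in nodes ch (mk k p) p -> forall y, cubep q' y ->
     (cubeG q')%:E <= Phi y)%E ->
  ((vol p * treeH r q (mk k p) gam)%:E <= \int[leb d]_(y in cubep p) Phi y)%E.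
Proof.
elim: k p gam => [|k IH] p gam p0 gam0 mPhi Phi0 gP nP.
  have -> : treeH r q (mk 0 p) gam = Num.max gam (cubeG p).
    by rewrite -(treeG_mk 0 p0).
  rewrite mulrC EFinM -(leb_cubep p0) -integral_cst; last exact: measurable_cubep.
  apply: le_lower_integral => y py; first by rewrite lee_fin le_max gam0.
  by rewrite /cst EFin_max ge_max gP// nP//; exact: nodes_self.
rewrite [treeH _ _ _ _]/= -(mean_vol (@dyadic_vol R d) _ p0).
rewrite (integral_split (@dyadic_cover R d) (@dyadic_disj R d) p0)//; last exact: measurable_funTS.
rewrite -sumEFin big_enum/=; apply: lee_sum => e _.
apply: IH => //.
- exact: dyadic_pos.
- by rewrite le_max gam0.
- move=> y ye; have py : cubep p y by apply/(dyadic_cover _ p0); exists e.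
  rewrite EFin_max ge_max gP//=.
  have -> : treeG r q (Node (fun e1 => mk k (ch e1 p))) = cubeG p by exact: (treeG_mk k.+1).
  by apply: nP => //; exact: nodes_self.
- by move=> q' q'n; apply: nP; exact: (nodes_child (c := fun e => mk k (ch e p)) q'n).
Qed.

(** On each leaf cell [Psi] is |g|^q times the q-th power of the norm of the running maximum [zeta]
    of that cell; this gives a measurable majorant. *)
Lemma treeS_integral k p (xi : T -> R) : 0 < p.2 -> P xi -> (forall w, 0 <= xi w) ->
  exists Psi : d.-tuple R -> \bar R,
  [/\ measurable_fun [set: d.-tuple R] Psi, forall y, (0 <= Psi y)%E,
    (\int[leb d]_(y in cubep p) Psi y <= (vol p * treeS r P q (mk k p) xi)%:E)%E &
    forall y, cubep p y -> exists zeta,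
    [/\ P zeta, forall w, xi w <= zeta w,
      forall q', q' \in nodes ch (mk k p) p -> cubep q' y -> {ae mu, forall w,
        \prod_j average (r j) (cubep q') (fun y => (f j y w)%:E) <= (zeta w)%:E}%E &
      ((fnorm P zeta `^ q)%:E * gpow y <= Psi y)%E]].
Proof.
elim: k p xi => [|k IH] p xi p0 Pxi xi0.
  have gt := good_mk 0 p0.
  have Ps : P (supA r xi (mk 0 p)) by exact: (supA_in hX r0 cX hP PX).
  exists (fun y => (fnorm P (supA r xi (mk 0 p)) `^ q)%:E * gpow y)%E; split.
  - by apply: emeasurable_funM => //; exact: measurable_gpow.
  - by move=> y; rewrite mule_ge0 ?lee_fin ?powR_ge0// poweR_ge0.
  - rewrite ge0_integralZl//; last 4 first.
    + exact: measurable_cubep.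
    + by apply: measurable_funTS; exact: measurable_gpow.
    + by move=> y _; exact: poweR_ge0.
    + by rewrite lee_fin powR_ge0.
    have gE : (\int[leb d]_(y in cubep p) gpow y)%E = (vol p * cube_weight p)%:E.
      rewrite /cube_weight mulrCA mulfV ?mulr1 ?gt_eqF ?vol_gt0//.
      rewrite /cube_int fineK// ge0_fin_numE; first exact: fin_g.
      by apply: integral_ge0 => y _; exact: poweR_ge0.
    by rewrite gE -EFinM lee_fin mulrCA.
  move=> y py; exists (supA r xi (mk 0 p)); split => //.
  + by move=> w; rewrite le_max lexx.
  + move=> q'; rewrite inE => /eqP -> _.
    apply: filterS (prodA_mk 0 p0) => w <-.
    by rewrite lee_fin le_max lexx orbT.
have gt := good_mk k.+1 p0.
have Ps : P (supA r xi (mk k.+1 p)) by exact: (supA_in hX r0 cX hP PX).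
have s0 w : 0 <= supA r xi (mk k.+1 p) w by exact: supA_ge0.
have /choice[Ps_ hPs] (e : E) := IH (ch e p) _ (dyadic_pos e p0) Ps s0.
pose Psi y := (\sum_(e : E) (\1_(cubep (ch e p)) y)%:E * Ps_ e y)%E.
have mI (e : E) : measurable_fun [set: d.-tuple R] (fun y => (\1_(cubep (ch e p)) y)%:E : \bar R).
  by apply/measurable_EFinP; apply: measurable_indic; exact: measurable_cubep.
have mPsi : measurable_fun [set: d.-tuple R] Psi.
  apply: emeasurable_sum => e; apply: emeasurable_funM => //.
  by have [] := hPs e.
have PsiE y e : cubep (ch e p) y -> Psi y = Ps_ e y.
  move=> ye; rewrite /Psi (bigD1 e)//= indicE mem_set// mul1e big1 ?adde0// => e' ne.
  rewrite indicE memNset ?mul0e// => ye'; move/eqP: ne; apply.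
  exact: dyadic_disj p0 ye' ye.
have Psi0 y : (0 <= Psi y)%E.
  apply: sume_ge0 => e _; rewrite mule_ge0 ?lee_fin//.
  by have [] := hPs e.
exists Psi; split => //.
  rewrite (integral_split (@dyadic_cover R d) (@dyadic_disj R d) p0)//; last exact: measurable_funTS.
  rewrite [treeS _ _ _ _ _]/= -(mean_vol (@dyadic_vol R d) _ p0).
  rewrite -sumEFin big_enum/=; apply: lee_sum => e _.
  have [_ _ h1 _] := hPs e; apply: le_trans h1.
  rewrite le_eqVlt; apply/orP; left; apply/eqP.
  by apply: eq_integral => y /set_mem ye; exact: PsiE.
move=> y py; have [e ye] := (dyadic_cover y p0).1 py.
have [_ _ _ /(_ y ye)[zeta [Pz xz nz hz]]] := hPs e.
exists zeta; split => //.
- by move=> w; apply: le_trans (xz w); rewrite le_max lexx.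
- move=> q'; rewrite inE => /orP[/eqP -> _|/flattenP[_ /mapP[e' _ ->] q'n] q'y].
    apply: filterS (prodA_mk k.+1 p0) => w <-.
    by rewrite lee_fin; apply: le_trans (xz w); rewrite le_max lexx orbT.
  have e'e : e' = e.
    apply: (dyadic_disj p0 _ ye).
    exact: (nodes_sub (dyadic_pos e' p0) q'n).
  by rewrite e'e in q'n; exact: nz.
by rewrite (PsiE y e ye).
Qed.

End tree_of_functions.

(** * Rational cubes and shifted dyadic grids *)

Section enlarging.
Context {R : realType} (d : nat).
Local Open Scope ereal_scope.
Notation param := (d.-tuple R * R)%type.

Lemma subset_lower_integral (A B : set (d.-tuple R)) (phi : d.-tuple R -> \bar R) :
  A `<=` B -> (forall y, 0 <= phi y) ->
  \int[leb d]_(y in A) phi y <= \int[leb d]_(y in B) phi y.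
Proof.
move=> AB phi0; rewrite integral_mkcond [leRHS]integral_mkcond.
apply: le_lower_integral => y _; rewrite !patchE; case: ifPn => yA //.
  by rewrite ifT// mem_set//; apply: AB; exact: set_mem.
by case: ifPn => // _; exact: phi0.
Qed.

Lemma average_enlarge (rho c : R) (p p' : param) (h : d.-tuple R -> \bar R) :
  (0 < rho)%R -> (0 < c)%R -> (0 < p.2)%R -> (0 < p'.2)%R ->
  cubep p `<=` cubep p' -> (p'.2 <= c * p.2)%R ->
  average rho (cubep p) h <= ((c ^+ d) `^ rho^-1)%:E * average rho (cubep p') h.
Proof.
move=> rho0 c0 p0 p'0 pp' le_c; have vp := vol_gt0 p0; have vp' := vol_gt0 p'0.
rewrite /average !leb_cubep// !inver (gt_eqF vp) (gt_eqF vp') -poweR_EFin -poweRM.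
- apply: le_poweR; first by rewrite invr_ge0 ltW.
    by rewrite mule_ge0 ?lee_fin ?invr_ge0 ?(ltW vp)// integral_ge0// => y _; exact: poweR_ge0.
  rewrite muleA -EFinM; apply: lee_pmul.
  + by rewrite lee_fin invr_ge0 ltW.
  + by apply: integral_ge0 => y _; exact: poweR_ge0.
  + rewrite lee_fin ler_pdivlMr// mulrC ler_pdivrMr// /vol -exprMn.
    by apply: lerXn2r => //; rewrite nnegrE ?mulr_ge0 ?ltW.
  + by apply: subset_lower_integral => // y; exact: poweR_ge0.
- by rewrite lee_fin exprn_ge0// ltW.
- by rewrite mule_ge0 ?lee_fin ?invr_ge0 ?(ltW vp')// integral_ge0// => y _; exact: poweR_ge0.
Qed.

Lemma prod_average_enlarge m (rho : 'I_m -> R) (c : R) (p p' : param)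
    (h : 'I_m -> d.-tuple R -> \bar R) :
  (forall j, (0 < rho j)%R) -> (0 < c)%R -> (0 < p.2)%R -> (0 < p'.2)%R ->
  cubep p `<=` cubep p' -> (p'.2 <= c * p.2)%R ->
  \prod_j average (rho j) (cubep p) (h j) <=
  ((c ^+ d) `^ \sum_j (rho j)^-1)%:E * \prod_j average (rho j) (cubep p') (h j).
Proof.
move=> rho0 c0 p0 p'0 pp' le_c.
have -> : ((c ^+ d) `^ \sum_j (rho j)^-1)%:E = \prod_j ((c ^+ d) `^ (rho j)^-1)%:E.
  rewrite prodEFin; congr EFin; elim/big_rec2 : _ => [|j x y _ <-]; first by rewrite powRr0.
  by rewrite powRD//; apply/implyP => _; rewrite gt_eqF// exprn_gt0.
rewrite -big_split/=; apply: le_prode => j; rewrite average_ge0/=.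
exact: average_enlarge.
Qed.

Definition rational_cube (i : nat) : param :=
  if @unpickle (d.-tuple rat * rat)%type i is Some (a, l) then
    if (0 < l)%R then ([tuple ratr (tnth a k) | k < d], ratr l) else ([tuple 0%R | k < d], 1%R)
  else ([tuple 0%R | k < d], 1%R).

Lemma rational_cube_pos i : (0 < (rational_cube i).2)%R.
Proof.
rewrite /rational_cube; case: (unpickle i) => [[a l]|]//; case: ifP => // l0.
by rewrite /= ltr0q.
Qed.

Lemma rational_cube_cover (p : param) (c : R) : (0 < p.2)%R -> (1 < c)%R ->
  exists i, cubep p `<=` cubep (rational_cube i) /\ ((rational_cube i).2 <= c * p.2)%R.
Proof.
move=> p0 c1; pose dl := ((c - 1) * p.2 / 2)%R.
have dl0 : (0 < dl)%R by rewrite divr_gt0// mulr_gt0// subr_gt0.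
have /choice[a ha] (k : 'I_d) : exists x : rat, ratr x \in `]tnth p.1 k - dl, tnth p.1 k[%R.
  by apply: rat_in_itvoo; rewrite ltrBlDr ltrDl.
have [l hl] : exists x : rat, ratr x \in `]p.2 + dl, c * p.2[%R.
  apply: rat_in_itvoo; rewrite /dl.
  have : (0 < (c - 1) * p.2)%R by rewrite mulr_gt0// subr_gt0.
  lra.
have l0 : (0 < l)%R.
  have := hl; rewrite in_itv/= => /andP[h _].
  by rewrite -(ltr0q R); apply: lt_trans h; rewrite addr_gt0.
exists (pickle ([tuple a k | k < d], l)).
rewrite /rational_cube pickleK l0; split; last by have := hl; rewrite in_itv/= => /andP[_ /ltW].
move=> y /cubeP yp; apply/cubeP => k; have /andP[h1 h2] := yp k.
rewrite !tnth_mktuple /=.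
have := ha k; rewrite in_itv/= => /andP[h3 h4].
have := hl; rewrite in_itv/= => /andP[h5 h6].
apply/andP; split; [exact: le_trans (ltW h4) h1|apply: (lt_trans h2)].
lra.
Qed.

Lemma sumr_gt0_ord m (a : 'I_m -> R) : (0 < m)%N -> (forall j, (0 < a j)%R) ->
  (0 < \sum_j a j)%R.
Proof.
case: m a => // m a _ a0; rewrite big_ord_recl ltr_pwDl// sumr_ge0// => j _.
exact: ltW.
Qed.

(** Each cube lies in a rational cube larger by a factor as close to 1 as desired, so nothing is
    lost in the supremum. Countably many cubes thus give the measurability of M and a pointwise form
    of the lattice supremum. *)
Lemma prod_average_rational m (rho : 'I_m -> R) (h : 'I_m -> d.-tuple R -> \bar R) x Q :
  (0 < d)%N -> (0 < m)%N -> (forall j, (0 < rho j)%R) -> cubes d Q ->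
  (\prod_j average (rho j) Q (h j)) * (\1_Q x)%:E <=
  ereal_sup (range (fun i => (\prod_j average (rho j) (cubep (rational_cube i)) (h j))
    * (\1_(cubep (rational_cube i)) x)%:E)).
Proof.
move=> d0 m0 rho0 [a [l [l0 ->]]].
pose p : param := (a, l); rewrite -/(cube a l) -/(cubep p).
set S := ereal_sup _.
have S0 : 0 <= S.
  apply: (@le_trans _ _ ((\prod_j average (rho j) (cubep (rational_cube 0)) (h j))
    * (\1_(cubep (rational_cube 0)) x)%:E)).
    by rewrite mule_ge0 ?lee_fin// prode_ge0// => j _; exact: average_ge0.
  by apply: ereal_sup_ubound; exists 0%N.
rewrite indicE; have [px|px] := boolP (x \in cubep p); last by rewrite mule0.
rewrite mule1; set A := \prod_j _.
have A0 : 0 <= A by apply: prode_ge0 => j _; exact: average_ge0.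
pose s : R := (\sum_j (rho j)^-1)%R.
have s0 : (0 < s)%R by rewrite sumr_gt0_ord// => j; rewrite invr_gt0.
have ds0 : (0 < d%:R * s)%R by rewrite mulr_gt0// ltr0n.
apply/lee_mul01Pr => // t /andP[t0 t1].
(* Enlarging the side by c costs c^(d s), which is 1/t for this c; t then tends to 1. *)
pose c := ((t^-1) `^ (d%:R * s)^-1)%R.
have c1 : (1 < c)%R.
  have -> : (1 = 1 `^ (d%:R * s)^-1 :> R)%R by rewrite powR1.
  apply: gt0_ltr_powR; rewrite ?invr_gt0 ?nnegrE ?invr_ge0 ?(ltW t0)//.
  by rewrite invf_gt1.
have [i [pi ci]] := rational_cube_cover (p := p) l0 c1.
have := prod_average_enlarge h rho0 (lt_trans ltr01 c1) (p := p) l0 (rational_cube_pos i) pi ci.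
rewrite -/s -/A.
have -> : ((c ^+ d) `^ s = t^-1)%R.
  rewrite -powR_mulrn ?(ltW (lt_trans ltr01 c1))// /c -!powRrM.
  rewrite mulVf ?powRr1 ?invr_ge0 ?(ltW t0)//; exact: lt0r_neq0.
move=> hA; have : t%:E * A <= \prod_j average (rho j) (cubep (rational_cube i)) (h j).
  by rewrite -lee_pdivlMl.
move/le_trans; apply; rewrite -[leLHS]mule1.
have xi : x \in cubep (rational_cube i) by apply: mem_set; apply: pi; exact: set_mem.
apply: ereal_sup_ubound; exists i => //; by rewrite indicE xi.
Qed.

End enlarging.

Section rational_maximal.
Context {R : realType} {dT : measure_display} {T : measurableType dT}.
Variable mu : {measure set T -> \bar R}.
Variables (d m : nat) (rho : 'I_m -> R).
Hypotheses (d0 : (0 < d)%N) (m0 : (0 < m)%N) (rho0 : forall j, 0 < rho j).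
Local Open Scope ereal_scope.

Definition rational_term (h : 'I_m -> d.-tuple R -> \bar R) (x : d.-tuple R) (i : nat) :=
  (\prod_j average (rho j) (cubep (rational_cube d i)) (h j))
  * (\1_(cubep (rational_cube d i)) x)%:E.

Lemma rational_term_ge0 h x i : 0 <= rational_term h x i.
Proof. by rewrite mule_ge0 ?lee_fin// prode_ge0// => j _; exact: average_ge0. Qed.

Lemma maximal_rational h x : maximal rho h x = ereal_sup (range (rational_term h x)).
Proof.
apply/le_anti/andP; split; apply: ge_ereal_sup => _ [Q cQ <-].
  exact: prod_average_rational.
move: Q cQ => i _; apply: ereal_sup_ubound; exists (cubep (rational_cube d i)) => //.
by apply: cubes_cube; exact: rational_cube_pos.
Qed.

Lemma measurable_maximal h : measurable_fun [set: d.-tuple R] (maximal rho h).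
Proof.
have -> : maximal rho h = fun x => ereal_sup (range ((fun i x => rational_term h x i) ^~ x)).
  by apply/funext => x; exact: maximal_rational.
apply: measurable_ereal_sup => i; apply: emeasurable_funM => //.
by apply/measurable_EFinP; apply: measurable_indic; exact: measurable_cubep.
Qed.

Lemma lattice_maximal_rational (f : 'I_m -> d.-tuple R -> T -> R) x :
  (forall j, measurable_fun [set: d.-tuple R * T] (fun z => f j z.1 z.2)) ->
  [/\ measurable_fun [set: T] (lattice_maximal mu (cubes d) rho f x),
      forall w, 0 <= lattice_maximal mu (cubes d) rho f x w &
      {ae mu, forall w, lattice_maximal mu (cubes d) rho f x w =
        ereal_sup (range (rational_term (fun j y => (f j y w)%:E) x))}].
Proof.
move=> mf.
apply: (lattice_supP (h := fun i w => rational_term (fun j y => (f j y w)%:E) x i)).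
- move=> i; apply: emeasurable_funM => //; apply: measurable_prode => j.
  by apply: measurable_average => //; exact: measurable_cubep.
- by move=> i w; exact: rational_term_ge0.
- move=> i; left; exists (cubep (rational_cube d i)) => //.
  by apply: cubes_cube; exact: rational_cube_pos.
- by move=> _ [Q cQ <-]; apply: nearW => w; exact: prod_average_rational.
Qed.

End rational_maximal.

(** * The one-third trick *)

Section one_third.
Context {R : realType} (d : nat).
Notation param := (d.-tuple R * R)%type.
Notation E := {ffun 'I_d -> bool}.

Fixpoint descend (es : seq E) (p : param) : param :=
  if es is e :: es' then descend es' (dyadic_child e p) else p.

(** The binary digits of the [z i], leading digit first, select the successive children. *)
Lemma descend_grid s (z : 'I_d -> nat) (p : param) : (forall i, (z i < 2 ^ s)%N) ->
  exists2 es : seq E, size es = s & descend es p =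
    ([tuple tnth p.1 i + p.2 / 2 ^+ s * (z i)%:R | i < d], p.2 / 2 ^+ s).
Proof.
elim: s z p => [|s IH] z p zs.
  exists [::] => //=; rewrite divr1; case: p => c L /=; congr pair.
  apply: eq_from_tnth => i; rewrite tnth_mktuple.
  by have := zs i; rewrite expn0 ltnS leqn0 => /eqP ->; rewrite mulr0 addr0.
pose e : E := [ffun i => (2 ^ s <= z i)%N].
have zE i : (z i = e i * 2 ^ s + (z i - e i * 2 ^ s))%N.
  rewrite ffunE; case: (leqP (2 ^ s) (z i)) => h; last by rewrite mul0n subn0.
  by rewrite mul1n subnKC.
have z's i : (z i - e i * 2 ^ s < 2 ^ s)%N.
  rewrite ffunE; case: (leqP (2 ^ s) (z i)) => h; last by rewrite mul0n subn0.
  by rewrite mul1n ltn_subLR// addnn -mul2n -expnS.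
have [es size_es hes] := IH _ (dyadic_child e p) z's.
exists (e :: es); first by rewrite /= size_es.
rewrite [LHS]/= hes /=; congr pair; last by rewrite exprS invfM mulrA.
apply: eq_from_tnth => i; rewrite !tnth_mktuple [in RHS](zE i) natrD natrM natrX.
by rewrite exprS; field; rewrite expf_neq0.
Qed.

(* If each of the two grids of mesh L/2^s, which differ by a shift of L/3, had a
   point inside (a, a+l), then L/3 would be closer than a third of the mesh to a
   multiple of the mesh; but 3 does not divide 2^s. *)
Lemma one_third_grid (L a l : R) (s : nat) : 0 < l -> 3 * l <= L / 2 ^+ s ->
  - L / 8 <= a -> a + l <= L / 8 ->
  exists (b : bool) (z : nat), [/\ (z < 2 ^ s)%N,
    - L / 2 + b%:R * (L / 3) + L / 2 ^+ s * z%:R <= a &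
    a + l <= - L / 2 + b%:R * (L / 3) + L / 2 ^+ s * z%:R + L / 2 ^+ s].
Proof.
move=> l0; set dl := L / 2 ^+ s => ldl aL alL.
have dl0 : 0 < dl by apply: lt_le_trans ldl; rewrite mulr_gt0.
have LE : L = dl * (2 ^ s)%:R by rewrite natrX /dl divfK// expf_neq0.
have L0 : 0 < L by rewrite LE mulr_gt0// ltr0n expn_gt0.
pose c (b : bool) := - L / 2 + b%:R * (L / 3).
have cb b : c b <= - L / 6 /\ - L / 2 <= c b by rewrite /c; case: b => /=; lra.
have ac b : 0 <= (a - c b) / dl.
  by rewrite divr_ge0 ?(ltW dl0)// subr_ge0; have := cb b; lra.
pose z b := Num.truncn ((a - c b) / dl).
have zb b : c b + dl * (z b)%:R <= a /\ a < c b + dl * (z b)%:R + dl.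
  have /andP[] := truncn_itv (ac b); rewrite -/(z b) ler_pdivlMr// ltr_pdivrMr// -natr1.
  by rewrite mulrDl mul1r mulrC; lra.
have zs b : (z b < 2 ^ s)%N.
  rewrite -(ltr_nat R) -(ltr_pM2l dl0) -LE.
  by have := zb b; have := cb b; lra.
case: (leP (a + l) (c false + dl * (z false)%:R + dl)) => h0.
  by exists false, (z false); split; [exact: zs|exact: (zb false).1|].
case: (leP (a + l) (c true + dl * (z true)%:R + dl)) => h1.
  by exists true, (z true); split; [exact: zs|exact: (zb true).1|].
exfalso.
have [h00 h01] := zb false; have [h10 h11] := zb true.
have diff : c true - c false = dl * (2 ^ s)%:R / 3 by rewrite -LE /c /=; lra.
have lt1 : dl * ((2 ^ s + 3 * z true)%:R - (3 * z false)%:R) < dl * 1.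
  by rewrite natrD !natrM; lra.
have lt2 : dl * ((3 * z false)%:R - (2 ^ s + 3 * z true)%:R) < dl * 1.
  by rewrite natrD !natrM; lra.
rewrite !(ltr_pM2l dl0) !ltrBlDr !nat1r !ltr_nat !ltnS in lt1 lt2.
have e3 : (2 ^ s + 3 * z true = 3 * z false)%N by apply/eqP; rewrite eqn_leq lt1 lt2.
have : (3 %| 2 ^ s)%N by rewrite -(@dvdn_addl (3 * z true)) ?e3 dvdn_mulr.
by rewrite Euclid_dvdX.
Qed.

Lemma dyadic_scale (L l : R) : 0 < l -> 3 * l <= L ->
  exists s, 3 * l <= L / 2 ^+ s /\ L / 2 ^+ s <= 6 * l.
Proof.
move=> l0 lL; have l30 : 0 < 3 * l by rewrite mulr_gt0.
have ex : exists n, L < 3 * l * 2 ^+ n.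
  exists (Num.bound (L / (3 * l))); rewrite mulrC -ltr_pdivrMr//.
  apply: lt_trans (archi_boundP _) _; first by rewrite divr_ge0// ltW// (lt_le_trans l30).
  by rewrite -natrX ltr_nat ltn_expl.
case: (ex_minnP ex) => -[|s] h hmin; first by move: h; rewrite expr0 mulr1 ltNge lL.
have s2 : 0 < 2 ^+ s :> R by rewrite exprn_gt0.
exists s; split.
  rewrite ler_pdivlMr//; case: leP => // /hmin; by rewrite ltnn.
rewrite ler_pdivrMr// ltW//; move: h; rewrite exprS mulrA; congr (_ < _); ring.
Qed.

Lemma one_third_cubes (Q : nat -> param) (N : nat) : (forall i, 0 < (Q i).2) ->
  exists (tops : E -> param) (n : nat), (forall tau, 0 < (tops tau).2) /\
    forall i, (i < N)%N -> exists tau es, [/\ (size es <= n)%N,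
      cubep (Q i) `<=` cubep (descend es (tops tau)) &
      (descend es (tops tau)).2 <= 6 * (Q i).2].
Proof.
move=> Q0.
pose S i := \sum_(k < d) `|tnth (Q i).1 k| + 3 * (Q i).2.
have S0 i : 0 <= S i by rewrite addr_ge0 ?sumr_ge0// mulr_ge0// ltW.
(* So large that the first N cubes lie in [-L/8, L/8]^d and have side at most L/3. *)
pose L := 8 * (1 + \sum_(i < N) S i).
have L0 : 0 < L by rewrite mulr_gt0// ltr_pwDl// sumr_ge0.
have SL i : (i < N)%N -> S i <= L / 8.
  move=> iN; rewrite /L mulrC mulKf// (bigD1 (Ordinal iN))//= addrCA lerDl.
  by rewrite addr_ge0// sumr_ge0.
have /choice[s hs] i : exists s, (i < N)%N ->
    3 * (Q i).2 <= L / 2 ^+ s /\ L / 2 ^+ s <= 6 * (Q i).2.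
  case: (ltnP i N) => iN; last by exists 0%N.
  have [|s hs] := @dyadic_scale L (Q i).2 (Q0 i); last by exists s.
  have := SL i iN; have : 0 <= \sum_(k < d) `|tnth (Q i).1 k| by exact: sumr_ge0.
  rewrite /S; lra.
(* In each coordinate the top is [-L/2, L/2) or [-L/6, 5L/6); both contain [-L/8, L/8]. Independent
   choices give 2^d tops. *)
pose top (tau : E) : param := ([tuple - L / 2 + (tau i)%:R * (L / 3) | i < d], L).
exists top, (\max_(i < N) s i); split=> // i iN.
have [h1 h2] := hs i iN.
have aL k : - L / 8 <= tnth (Q i).1 k /\ tnth (Q i).1 k + (Q i).2 <= L / 8.
  have : `|tnth (Q i).1 k| + 3 * (Q i).2 <= L / 8.
    apply: le_trans (SL i iN); rewrite lerD2r (bigD1 k)//= lerDl.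
    by rewrite sumr_ge0.
  have := ler_norm (tnth (Q i).1 k); have := ler_norm (- tnth (Q i).1 k).
  by rewrite normrN; have := Q0 i; lra.
have /choice[b hb] k := one_third_grid (Q0 i) h1 (aL k).1 (aL k).2.
have /choice[z hz] := hb.
pose tau : E := [ffun k => b k].
have [|es size_es des] := @descend_grid (s i) z (top tau); first by move=> k; have [] := hz k.
exists tau, es; split.
- by rewrite size_es; exact: (leq_bigmax (Ordinal iN)).
- rewrite des => y /cubeP yQ; apply/cubeP => k; rewrite !tnth_mktuple ffunE.
  have [_ hz1 hz2] := hz k; have /andP[y1 y2] := yQ k.
  by rewrite /= (le_trans hz1 y1)/= (lt_le_trans y2 hz2).
- by rewrite des.
Qed.

End one_third.

(** * Domination of the lattice maximal function *)

Section snoc.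
Context {R : realType}.

Lemma snoc_widen (A : Type) m (a : 'I_m -> A) b (i : 'I_m) :
  snoc a b (widen_ord (leqnSn m) i) = a i.
Proof.
have -> : widen_ord (leqnSn m) i = lift ord_max i.
  by apply: val_inj; rewrite /= /bump leqNgt ltn_ord.
by rewrite /snoc liftK.
Qed.

Lemma snoc_max (A : Type) m (a : 'I_m -> A) b : snoc a b ord_max = b.
Proof. by rewrite /snoc unlift_none. Qed.

Lemma snoc_gt0 m (r : 'I_m -> R) q : (forall j, 0 < r j) -> 0 < q ->
  forall i, 0 < snoc r q i.
Proof. by move=> r0 q0 i; rewrite /snoc; case: (unlift _ _) => /=. Qed.

Lemma prod_average_snoc d m (r : 'I_m -> R) q (h : 'I_m -> d.-tuple R -> \bar R) k Q :
  (\prod_i average (snoc r q i) Q (snoc h k i) =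
   (\prod_j average (r j) Q (h j)) * average q Q k)%E.
Proof.
rewrite big_ord_recr /= !snoc_max; congr (_ * _)%E.
by apply: eq_bigr => j _; rewrite !snoc_widen.
Qed.

End snoc.

Section descend.
Context {R : realType} {dT : measure_display} {T : measurableType dT}.
Variables (m d : nat) (r : 'I_m -> R) (f : 'I_m -> d.-tuple R -> T -> R).
Variables (h : 'I_m -> d.-tuple R -> R) (q : R) (g : d.-tuple R -> R).
Notation E := {ffun 'I_d -> bool}.

Lemma descend_pos (es : seq E) (p : d.-tuple R * R) : 0 < p.2 -> 0 < (descend es p).2.
Proof. by elim: es p => //= e es IH p p0; apply: IH; exact: dyadic_pos. Qed.

Lemma descend_nodes (es : seq E) n (p : d.-tuple R * R) : (size es <= n)%N ->
  descend es p \in nodes (@dyadic_child R d) (mk r f h q g n p) p.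
Proof.
elim: es n p => [|e es IH] [|n] p //= sz; try by rewrite inE eqxx.
by apply: (nodes_child (c := fun e => mk r f h q g n (dyadic_child e p))); exact: IH.
Qed.

End descend.

Section domination.
Context {R : realType} {dT : measure_display} {T : measurableType dT}.
Variable mu : {sigma_finite_measure set T -> \bar R}.
Variables (d m : nat) (X : 'I_m -> fspace R T) (r : 'I_m -> R).
Hypotheses (d0 : (0 < d)%N) (m0 : (0 < m)%N).
Hypothesis hX : forall j, quasi_banach mu (X j).
Notation P := (prod_space mu X).
Hypothesis hP : quasi_banach mu P.
Hypothesis r0 : forall j, 0 < r j.
Hypothesis cX : forall j, pconvex (r j) (X j).
Notation param := (d.-tuple R * R)%type.
Notation E := {ffun 'I_d -> bool}.
Notation e0 := ([ffun=> false] : E).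
Variables (K Lam : R).
Hypothesis K1 : 1 <= K.
Hypothesis Lam1 : 1 <= Lam.
Hypothesis LamE : \sum_j Lam `^ (- r j) <= 4^-1.
Hypothesis HT : forall (t : @tree R T E m) (B : 'I_m -> R), good X t ->
  (forall j, 0 < B j) -> leaves_le B t ->
  exceed r P (K * \prod_j B j) t (fun=> 0) <= 4^-1.
Let Lam' := K * \prod_j (#|{: E}|%:R `^ (r j)^-1 * Lam).

Variables (q : R) (f : 'I_m -> d.-tuple R -> T -> R) (g : d.-tuple R -> R).
Hypothesis q0 : 0 < q.
Hypothesis cP : pconvex q P.
Hypothesis hf : forall j, in_Lploc (r j) (X j) (f j).
Hypothesis hg : in_Lploc_scalar q g.
Let M := maximal (snoc r q) (snoc (fun j => efnorm (X j) (f j)) (EFin \o g)).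

Lemma measurable_majorant : measurable_fun [set: d.-tuple R] (fun y => M y `^ q)%E.
Proof.
apply: (measurableT_comp (measurable_poweR _)).
by apply: measurable_maximal => //; exact: snoc_gt0.
Qed.

(** Chains three estimates on one tree: the integral of [Psi] is at most the volume times [treeS],
    [treeS] is at most a constant times [treeH], and the volume times [treeH] is at most the
    integral of M^q. *)
Lemma tree_domination (p : param) n : 0 < p.2 -> exists Psi : d.-tuple R -> \bar R,
  [/\ measurable_fun [set: d.-tuple R] Psi, forall y, (0 <= Psi y)%E,
    (\int[leb d]_y Psi y <= (2 * Lam' `^ q)%:E * \int[leb d]_y (M y `^ q))%E &
    forall y, exists zeta, [/\ P zeta,
      forall es, (size es <= n)%N -> cubep (descend es p) y -> {ae mu, forall w,
        \prod_j average (r j) (cubep (descend es p)) (fun y => (f j y w)%:E)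
          <= (zeta w)%:E}%E &
      ((fnorm P zeta `^ q)%:E * `|(g y)%:E| `^ q <= Psi y)%E]].
Proof.
move=> p0.
have /choice[h hh] j := efnorm_measurable (hX j) (r0 j) (@cX j) (hf j).1.
have mh j : measurable_fun [set: d.-tuple R] (h j) by have [] := hh j.
have mf j : measurable_fun [set: d.-tuple R * T] (fun z => f j z.1 z.2).
  by have [[]] := hf j.
have mg := hg.1.
have intE j p' : (\int[leb d]_(y in cubep p') (`|efnorm (X j) (f j) y| `^ r j) =
    \int[leb d]_(y in cubep p') (`|(h j y)%:E| `^ r j))%E.
  apply: ae_eq_lower_integral => [y _|y _|]; try exact: poweR_ge0.
  by have [_ _] := hh j; apply: filterS => y e; rewrite /efnorm e.
have avE j p' : average (r j) (cubep p') (efnorm (X j) (f j)) =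
    average (r j) (cubep p') (EFin \o h j) by rewrite /average intE.
have fin_h j p' : 0 < p'.2 -> (\int[leb d]_(y in cubep p') (`|(h j y)%:E| `^ r j) < +oo)%E.
  move=> p'0; rewrite -intE; apply: le_lt_trans ((hf j).2 _ (cubes_cube p'.1 p'0)).
  apply: le_lower_integral => y _; first exact: poweR_ge0.
  rewrite gee0_abs// lee_fin; apply: (qb_ge0 (hX j)).
  by have [[]] := hf j.
have fin_g p' : 0 < p'.2 -> (\int[leb d]_(y in cubep p') (`|(g y)%:E| `^ q) < +oo)%E.
  move=> p'0; apply: le_lt_trans (hg.2 _ (cubes_cube p'.1 p'0)).
  by apply: le_lower_integral => y _; [exact: poweR_ge0|rewrite poweR_EFin].
have fX j p' : 0 < p'.2 ->
    (enorm mu (X j) (fun w => average (r j) (cubep p') (fun y => (f j y w)%:E))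
     <= average (r j) (cubep p') (EFin \o h j))%E.
  move=> p'0; rewrite -avE; apply: (strong_minkowski (hX j) (r0 j) (@cX j) (hf j).1).
  - exact: measurable_cubep.
  - exact: leb_cubep.
  - exact: vol_gt0.
have PX xi (h1 : forall j, X j (xi j)) h2 := fs_prod_le hX h1 h2.
have Phi_ge q' y : 0 < q'.2 -> cubep q' y -> ((cubeG r h q g q')%:E <= M y `^ q)%E.
  move=> q'0 q'y.
  have v0 := vol_gt0 q'0.
  have w0 : 0 <= cube_weight q g q'.
    rewrite divr_ge0 ?(ltW v0)// fine_ge0// integral_ge0// => z _; exact: poweR_ge0.
  have a0 : 0 <= \prod_j avh r h j q' by apply: prodr_ge0 => j _; exact: powR_ge0.
  have -> : cubeG r h q g q' = (\prod_j avh r h j q' * cube_weight q g q' `^ q^-1) `^ q.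
    by rewrite powRM ?powR_ge0// powRVK.
  rewrite -poweR_EFin; apply: le_poweR; first exact: ltW.
    by rewrite lee_fin mulr_ge0 ?powR_ge0.
  apply: ereal_sup_ubound; exists (cubep q'); first exact: cubes_cube.
  rewrite prod_average_snoc indicE mem_set// mule1 EFinM; congr (_ * _)%E.
    by rewrite -prodEFin; apply: eq_bigr => j _; rewrite avE (avhE fin_h).
  by rewrite (average_cube_int (h := EFin \o g) q'0 (fin_g _ q'0)).
have [Psi [mPsi Psi0 iPsi zPsi]] := treeS_integral hX hP PX cX r0 mf mg fin_h fin_g fX
  n p0 (fs_0 hP) (fun=> lexx 0).
exists (fun y => (\1_(cubep p) y)%:E * Psi y)%E; split.
- apply: emeasurable_funM => //; apply/measurable_EFinP; apply: measurable_indic.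
  exact: measurable_cubep.
- by move=> y; rewrite mule_ge0 ?lee_fin.
- have -> : (\int[leb d]_y ((\1_(cubep p) y)%:E * Psi y) =
      \int[leb d]_(y in cubep p) Psi y)%E.
    rewrite [RHS]integral_mkcond; apply: eq_integral => y _; rewrite patchE indicE.
    by case: ifP => _; rewrite ?mul1e ?mul0e.
  apply: (le_trans iPsi).
  have gt : good X (mk r f h q g n p) by apply: (good_mk (mu := mu)) => // j.
  have [tS _] := treeS_descent e0 hX r0 cX hP PX q0 cP K1 Lam1 LamE HT gt.
  apply: (@le_trans _ _ ((2 * Lam' `^ q)%:E *
      (vol p * treeH r q (mk r f h q g n p) 0)%:E)%E).
    rewrite -EFinM lee_fin [leRHS]mulrCA ler_wpM2l//.
    by rewrite ltW// vol_gt0.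
  apply: lee_wpmul2l; first by rewrite lee_fin mulr_ge0// powR_ge0.
  apply: (@le_trans _ _ (\int[leb d]_(y in cubep p) (M y `^ q))%E).
    apply: (treeH_integral r0 mh mg fin_h fin_g) => //.
    + exact: measurable_majorant.
    + by move=> y; exact: poweR_ge0.
    + by move=> y _; exact: poweR_ge0.
    + by move=> q' /(nodes_pos p0) q'0 y; exact: Phi_ge.
  by apply: subset_lower_integral => // y; exact: poweR_ge0.
move=> y; have [py|py] := pselect (cubep p y); last first.
  exists (fun=> 0); split; first exact: (fs_0 hP).
    move=> es sz ey; exfalso; apply: py.
    by apply: (nodes_sub p0 _ ey); exact: (descend_nodes r f h q g p sz).
  by rewrite (fs_norm0 hP) powR0 ?(gt_eqF q0)// mul0e mule_ge0// lee_fin.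
have [zeta [Pz _ nz hz]] := zPsi y py.
exists zeta; split => //.
  by move=> es sz ey; apply: nz => //; exact: descend_nodes.
by rewrite indicE mem_set// mul1e.
Qed.

(** The loss, over all m averages together, in replacing a cube by a dyadic one of at most 6 times
    its side. *)
Let C0 : R := (6 ^+ d) `^ \sum_j (r j)^-1.

Let term y w := rational_term r (fun j y => (f j y w)%:E) y.

Lemma measurable_term y i : measurable_fun [set: T] (term y ^~ i).
Proof.
apply: emeasurable_funM => //; apply: measurable_prode => j.
by apply: measurable_average; [exact: measurable_cubep|have [[]] := hf j].
Qed.

Definition truncated_maximal y N w :=
  ereal_sup (range (fun i => if (i < N)%N then term y w i else 0%E)).

Lemma truncated_maximal_ge0 y N w : (0 <= truncated_maximal y N w)%E.
Proof.
apply: (@le_trans _ _ (if (0 < N)%N then term y w 0%N else 0%E)).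
  by case: ifP => // _; exact: rational_term_ge0.
by apply: ereal_sup_ubound; exists 0%N.
Qed.

Lemma measurable_truncated_maximal y N : measurable_fun [set: T] (truncated_maximal y N).
Proof.
apply: (measurable_ereal_sup (h := fun i w => if (i < N)%N then term y w i else 0%E)) => i.
by case: (i < N)%N; [exact: measurable_term|exact: measurable_cst].
Qed.

Lemma truncated_maximal_homo y w :
  {homo (truncated_maximal y) ^~ w : k l / (k <= l)%N >-> (k <= l)%E}.
Proof.
move=> k l kl; apply: ge_ereal_sup => _ [i _ <-]; case: ifP => ik; last exact: truncated_maximal_ge0.
by apply: ereal_sup_ubound; exists i; rewrite // (leq_trans ik kl).
Qed.

Lemma truncated_maximal_sup y w :
  ereal_sup (range (term y w)) = ereal_sup (range ((truncated_maximal y) ^~ w)).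
Proof.
apply/le_anti/andP; split; apply: ge_ereal_sup => _ [N _ <-].
  apply: (@le_trans _ _ (truncated_maximal y N.+1 w)); apply: ereal_sup_ubound.
    by exists N; rewrite // ltnSn.
  by exists N.+1.
apply: ge_ereal_sup => _ [i _ <-]; case: ifP => _; first by apply: ereal_sup_ubound; exists i.
apply: (@le_trans _ _ (term y w 0%N)); first exact: rational_term_ge0.
by apply: ereal_sup_ubound; exists 0%N.
Qed.

Lemma truncated_domination N : exists Psi : d.-tuple R -> \bar R,
  [/\ measurable_fun [set: d.-tuple R] Psi, forall y, (0 <= Psi y)%E,
    (\int[leb d]_y Psi y <=
      (C0 `^ q * (#|{: E}|%:R * (2 * Lam' `^ q)))%:E * \int[leb d]_y (M y `^ q))%E &
    forall y, (enorm mu P (truncated_maximal y N) `^ q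
      * `|(g y)%:E| `^ q <= Psi y)%E].
Proof.
have [tops [n [tops0 cover]]] := one_third_cubes N (@rational_cube_pos R d).
have /choice[Ps hPs] tau := tree_domination n (tops0 tau).
have C00 : 0 <= C0 by exact: powR_ge0.
have Cq0 : 0 <= C0 `^ q by exact: powR_ge0.
have mS : measurable_fun [set: d.-tuple R] (fun y => \sum_tau Ps tau y)%E.
  by apply: emeasurable_sum => tau; have [] := hPs tau.
have S0 y : (0 <= \sum_tau Ps tau y)%E by apply: sume_ge0 => tau _; have [] := hPs tau.
exists (fun y => (C0 `^ q)%:E * \sum_tau Ps tau y)%E; split.
- by apply: emeasurable_funM.
- by move=> y; rewrite mule_ge0// lee_fin.
- rewrite ge0_integralZl//.
  rewrite EFinM -muleA; apply: lee_wpmul2l; first by rewrite lee_fin.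
  rewrite ge0_integral_sum//; last 2 first.
    by move=> tau; have [] := hPs tau.
    by move=> tau y _; have [] := hPs tau.
  apply: (@le_trans _ _ (\sum_(tau : E) (2 * Lam' `^ q)%:E * \int[leb d]_y (M y `^ q))%E).
    by apply: lee_sum => tau _; have [] := hPs tau.
  have cE : (\sum_(tau : E) 1%:E = #|{: E}|%:R%:E :> \bar R)%E by rewrite sumEFin sumr_const.
  rewrite (EFinM #|{: E}|%:R) -muleA -cE ge0_sume_distrl//.
  by apply: lee_sum => tau _; rewrite mul1e.
move=> y.
have /choice[zeta hz] tau : exists zeta, [/\ P zeta,
    forall es, (size es <= n)%N -> cubep (descend es (tops tau)) y -> {ae mu, forall w,
      \prod_j average (r j) (cubep (descend es (tops tau))) (fun y => (f j y w)%:E)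
        <= (zeta w)%:E}%E &
    ((fnorm P zeta `^ q)%:E * `|(g y)%:E| `^ q <= Ps tau y)%E].
  by have [_ _ _] := hPs tau; exact.
have Pz tau : P (zeta tau) by have [] := hz tau.
(* The 2^d trees are merged by the l^q sum of their maxima: it dominates each of them, and
   q-convexity bounds its cost by the sum of the majorants. *)
have [Peta neta] := pconvex_fin hP q0 cP Pz.
set eta := (fun w => _) in Peta neta.
have le_eta tau w : zeta tau w <= eta w.
  apply: (le_trans (ler_norm _)); rewrite -[leLHS](powRKV q0)//.
  apply: le_powR; [by rewrite invr_ge0 ltW|exact: powR_ge0|].
  by rewrite (bigD1 tau)//= lerDl sumr_ge0// => ? _; exact: powR_ge0.
have eta0 w : 0 <= eta w by exact: powR_ge0.
have dom : {ae mu, forall w, 0 <= truncated_maximal y N w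
    <= (EFin \o (fun w => C0 * eta w)%R) w}%E.
  have : {ae mu, forall w, forall i : 'I_N, term y w i <= (C0 * eta w)%:E}%E.
    apply: filter_forall => i.
    have [yi|yi] := pselect (cubep (rational_cube d i) y); last first.
      apply: nearW => w; rewrite /term /rational_term indicE memNset// mule0.
      by rewrite lee_fin mulr_ge0.
    have [tau [es [sz sub le6]]] := cover i (ltn_ord i).
    have [_ /(_ es sz (sub y yi)) az _] := hz tau.
    apply: filterS az => w le_z; rewrite /term /rational_term indicE mem_set// mule1.
    apply: (le_trans (prod_average_enlarge (p := rational_cube d i)
      (p' := descend es (tops tau)) (c := 6) _ r0 _ _ _ sub le6)) => //.
    + exact: rational_cube_pos.
    + exact: descend_pos.
    rewrite -/C0 EFinM; apply: lee_wpmul2l; first by rewrite lee_fin.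
    by apply: (le_trans le_z); rewrite lee_fin.
  apply: filterS => w le_w; rewrite truncated_maximal_ge0/=.
  apply: ge_ereal_sup => _ [i _ <-]; case: ifP => iN; first exact: (le_w (Ordinal iN)).
  by rewrite lee_fin mulr_ge0.
have := enorm_le hP (measurable_truncated_maximal y N) dom.
rewrite (enorm_EFin mu (qb_scale hP C0 Peta)) (fs_normZ hP C00 Peta) => le_en.
apply: (@le_trans _ _ ((C0 `^ q)%:E * (fnorm P eta `^ q)%:E * `|(g y)%:E| `^ q)%E).
  apply: lee_wpmul2r; first exact: poweR_ge0.
  rewrite -EFinM -powRM//; last exact: (qb_ge0 hP).
  by rewrite -poweR_EFin; apply: le_poweR => //; [exact: ltW|exact: enorm_ge0].
rewrite -muleA; apply: lee_wpmul2l; first by rewrite lee_fin.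
apply: (@le_trans _ _ ((\sum_tau fnorm P (zeta tau) `^ q)%:E * `|(g y)%:E| `^ q)%E).
  by apply: lee_wpmul2r; [exact: poweR_ge0|rewrite lee_fin].
rewrite -sumEFin ge0_sume_distrl; last by move=> tau _; rewrite lee_fin powR_ge0.
by apply: lee_sum => tau _; have [] := hz tau.
Qed.

Lemma lattice_maximal_domination :
  (\int[leb d]_x ((`|enorm mu P (lattice_maximal mu (cubes d) r f x) * (g x)%:E|) `^ q)
   <= (C0 `^ q * (#|{: E}|%:R * (2 * Lam' `^ q)))%:E * \int[leb d]_y (M y `^ q))%E.
Proof.
have /choice[Psi hPsi] := truncated_domination.
have mPsi N : measurable_fun [set: d.-tuple R] (Psi N) by have [] := hPsi N.
have Psi0 N y : (0 <= Psi N y)%E by have [] := hPsi N.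
(* The majorants are chosen separately for each N and may fail to increase, hence a lower limit
   instead of monotone convergence. *)
apply: (@le_trans _ _ (\int[leb d]_x limn_einf (Psi ^~ x))%E); last first.
  apply: (le_trans (fatou _ _ _ _)) => //.
  rewrite limn_einf_ereal_sup; apply: ge_ereal_sup => _ [N _ <-].
  apply: (@le_trans _ _ (\int[leb d]_x Psi N x)%E); last by have [] := hPsi N.
  by apply: ereal_inf_lbound; exists N => /=.
apply: le_lower_integral => x _; first exact: poweR_ge0.
have mf j : measurable_fun [set: d.-tuple R * T] (fun z => f j z.1 z.2).
  by have [[]] := hf j.
have [mL L0 aL] := lattice_maximal_rational mu d0 m0 r0 x mf.
(* Where g vanishes the norm may be infinite; the product is then 0 by convention. *)
have [->|gx] := eqVneq (g x) 0.
  rewrite mule0 abse0 poweR0r ?(gt_eqF q0)//.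
  exact: limn_einf_ge0.
have g0 : 0 < `|g x| by rewrite normr_gt0.
have c0 : (0 <= limn_einf (Psi ^~ x))%E by exact: limn_einf_ge0.
case cE : (limn_einf (Psi ^~ x)) => [c| |]; last 2 first.
- exact: leey.
- by rewrite cE in c0.
rewrite cE lee_fin in c0.
pose B := c `^ q^-1 / `|g x|.
have enM N : (enorm mu P (truncated_maximal x N) <= B%:E)%E.
  have bd : (enorm mu P (truncated_maximal x N) `^ q * `|(g x)%:E| `^ q <= c%:E)%E.
    rewrite -cE; apply: (@le_trans _ _ (einfs (Psi ^~ x) N)).
      apply: le_ereal_inf_tmp => _ [k Nk <-].
      have [_ _ _ /(_ x)] := hPsi k; apply: le_trans.
      apply: lee_wpmul2r; first exact: poweR_ge0.
      apply: le_poweR; [exact: ltW|exact: enorm_ge0|].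
      apply: enorm_le => //; first exact: measurable_truncated_maximal.
      by apply: nearW => w; rewrite truncated_maximal_ge0 truncated_maximal_homo.
    by rewrite limn_einf_ereal_sup; apply: ereal_sup_ubound; exists N.
  rewrite -poweRM ?enorm_ge0// in bd.
  have Eg0 : (0 <= enorm mu P (truncated_maximal x N) * `|(g x)%:E|)%E.
    by rewrite mule_ge0 ?enorm_ge0.
  have qV0 : 0 <= q^-1 by rewrite invr_ge0 ltW.
  have := le_poweR qV0 (poweR_ge0 _ _) bd; rewrite (poweRKV q0 Eg0) poweR_EFin => le_c.
  by rewrite /B EFinM lee_pdivlMr.
have enL : (enorm mu P (lattice_maximal mu (cubes d) r f x) <= B%:E)%E.
  apply: le_trans (enorm_fatou hP (measurable_truncated_maximal x)
    (truncated_maximal_ge0 x) (truncated_maximal_homo x) enM).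
  apply: enorm_le => //; apply: filterS aL => w aw.
  by rewrite L0 aw -truncated_maximal_sup lexx.
have -> : c%:E = ((B * `|g x|)%:E `^ q)%E.
  by rewrite /B divfK ?gt_eqF// poweR_EFin powRVK.
rewrite abseM gee0_abs ?enorm_ge0//; apply: le_poweR; [exact: ltW|by rewrite mule_ge0 ?enorm_ge0|].
by rewrite EFinM; apply: lee_wpmul2r; rewrite ?lee_fin.
Qed.

End domination.

(** * Constants, the weight 1 and the conclusion *)

Section constants.
Context {R : realType}.

(** A height above (4m)^(1/r_j) for every j makes each of the m terms at most 1/(4m). *)
Lemma stopping_height m (r : 'I_m -> R) : (0 < m)%N -> (forall j, 0 < r j) ->
  exists2 Lam : R, 1 <= Lam & \sum_j Lam `^ (- r j) <= 4^-1.
Proof.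
move=> m0 r0; pose N : R := 4 * m%:R.
have N0 : 0 < N by rewrite mulr_gt0// ltr0n.
have a0 j : 0 <= N `^ (r j)^-1 by exact: powR_ge0.
exists (1 + \sum_j N `^ (r j)^-1); first by rewrite lerDl sumr_ge0.
have le1 j : (1 + \sum_j N `^ (r j)^-1) `^ (- r j) <= N^-1.
  rewrite powRN lef_pV2 ?posrE ?powR_gt0 ?ltr_pwDl ?sumr_ge0//.
  rewrite -[leLHS](powRVK (r0 j) (ltW N0)); apply: le_powR; [exact: ltW|exact: a0|].
  by rewrite (bigD1 j)//= addrCA lerDl addr_ge0// sumr_ge0.
apply: (le_trans (ler_sum _ (fun j _ => le1 j))).
rewrite sumr_const card_ord /N -[_ *+ _]mulr_natr invfM -mulrA mulVf ?mulr1//.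
by rewrite pnatr_eq0 -lt0n.
Qed.

End constants.

Section unweighted.
Context {R : realType} (d : nat).
Local Open Scope ereal_scope.

Lemma average_cst1 (q : R) Q : cubes d Q -> average q Q (cst 1) = 1.
Proof.
move=> [a [l [l0 ->]]]; rewrite -/(cube a l) -[cube a l]/(cubep (a, l)).
have v0 : (0 < vol ((a, l) : d.-tuple R * R))%R by exact: vol_gt0.
rewrite /average leb_cubep// (eq_integral (cst 1)); last first.
  by move=> y _; rewrite /cst abse1 poweR1r.
rewrite integral_cst; last exact: measurable_cubep.
by rewrite leb_cubep// inver (gt_eqF v0) mul1e -EFinM mulVf ?gt_eqF// poweR1r.
Qed.

Lemma maximal_snoc1 m (r : 'I_m -> R) q (h : 'I_m -> d.-tuple R -> \bar R) :
  maximal (snoc r q) (snoc h (cst 1)) = maximal r h.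
Proof.
apply/funext => x; congr ereal_sup.
by apply/seteqP; split => _ [Q cQ <-]; exists Q => //;
  rewrite prod_average_snoc average_cst1// mule1.
Qed.

Lemma in_Lploc_scalar_cst1 (q : R) : in_Lploc_scalar q (cst 1%R : d.-tuple R -> R).
Proof.
split=> [|_ [a [l [l0 ->]]]]; first exact: measurable_cst.
rewrite (eq_integral (cst 1)); last by move=> y _; rewrite /cst normr1 powR1.
rewrite integral_cst; last exact: measurable_box.
by rewrite mul1e -/(cube a l) leb_cube ?ltry// ltW.
Qed.

End unweighted.

Theorem theorem3p4 (R : realType) (dT : measure_display) (T : measurableType dT)
    (mu : {sigma_finite_measure set T -> \bar R}) (d m : nat)
    (X : 'I_m -> fspace R T) (r : 'I_m -> R) :
  (0 < d)%N -> (0 < m)%N ->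
  (forall j, quasi_banach mu (X j)) ->
  quasi_banach mu (prod_space mu X) ->
  order_continuous mu (prod_space mu X) ->
  (forall j, 0 < r j) ->
  HL mu r X ->
  exists2 C : R, 0 < C &
    forall q : R, (\sum_(j < m) (r j)^-1)^-1 <= q ->
    pconvex q (prod_space mu X) ->
    forall f : 'I_m -> d.-tuple R -> T -> R,
    (forall j, in_Lploc (r j) (X j) (f j)) ->
    (forall g : d.-tuple R -> R, in_Lploc_scalar q g ->
      (Lnorm (leb d) q%:E (fun x =>
         enorm mu (prod_space mu X) (lattice_maximal mu (cubes d) r f x)
         * (g x)%:E)
       <= C%:E * Lnorm (leb d) q%:E
           (maximal (snoc r q)
             (snoc (fun j => efnorm (X j) (f j)) (fun x => (g x)%:E))))%E)
    /\
    (Lnorm (leb d) q%:E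
       (fun x => enorm mu (prod_space mu X) (lattice_maximal mu (cubes d) r f x))
     <= C%:E * Lnorm (leb d) q%:E (maximal r (fun j => efnorm (X j) (f j))))%E.
Proof.
move=> d0 m0 hX hP _ r0 hHL.
have [K K1 HT] := HL_exceed ([ffun=> false] : {ffun 'I_d -> bool}) hX r0 hP hHL.
have [Lam Lam1 LamE] := stopping_height m0 r0.
have cX := hHL.1.
pose s := \sum_j (r j)^-1.
have s0 : 0 < s by apply: sumr_gt0_ord => // j; rewrite invr_gt0.
pose b : R := #|{: {ffun 'I_d -> bool}}|%:R.
have b1 : 1 <= b.
  by rewrite ler1n; apply/card_gt0P; exists [ffun=> false].
pose L := K * \prod_j (b `^ (r j)^-1 * Lam).
have L1 : 1 <= L := tree_const_ge1 ([ffun=> false] : {ffun 'I_d -> bool}) r0 K1 Lam1.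
have L0 : 0 < L by exact: lt_le_trans L1.
pose C0 : R := (6 ^+ d) `^ s.
have C00 : 0 < C0 by rewrite powR_gt0// exprn_gt0.
have b20 : 0 < b * 2 by rewrite mulr_gt0// (lt_le_trans ltr01 b1).
(* [C0] and [L] enter the domination as q-th powers, so their roots do not depend on q. The b = 2^d
   grids and the 2 of [kappa] leave (2b)^(1/q), bounded by (2b)^s because q >= r means 1/q <= s. *)
exists (C0 * ((b * 2) `^ s * L)); first exact: mulr_gt0 C00 (mulr_gt0 (powR_gt0 s b20) L0).
move=> q sq cP f hf.
have q0 : 0 < q by apply: lt_le_trans sq; rewrite invr_gt0.
have qs : q^-1 <= s by rewrite -[s]invrK lef_pV2 ?posrE ?invr_gt0.
have key (g : d.-tuple R -> R) : in_Lploc_scalar q g ->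
  (Lnorm (leb d) q%:E (fun x =>
     enorm mu (prod_space mu X) (lattice_maximal mu (cubes d) r f x) * (g x)%:E)
   <= (C0 * ((b * 2) `^ s * L))%:E * Lnorm (leb d) q%:E
       (maximal (snoc r q) (snoc (fun j => efnorm (X j) (f j)) (fun x => (g x)%:E))))%E.
  move=> hg; rewrite unlock.
  have := lattice_maximal_domination d0 m0 hX hP r0 cX K1 Lam1 LamE HT q0 cP hf hg.
  set A := (\int[leb d]_x _)%E; rewrite -/s -/b -/L -/C0 => dom.
  set I := (\int[leb d]_y _)%E in dom.
  have I0 : (0 <= I)%E by apply: integral_ge0 => y _; exact: poweR_ge0.
  have qV0 : 0 <= q^-1 by rewrite invr_ge0 ltW.
  have A0 : (0 <= A)%E by apply: integral_ge0 => y _; exact: poweR_ge0.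
  apply: (le_trans (le_poweR qV0 A0 dom)).
  rewrite poweRM//; last first.
    by rewrite lee_fin mulr_ge0 ?powR_ge0// mulr_ge0 ?(le_trans ler01 b1)// mulr_ge0 ?powR_ge0.
  apply: lee_pmul; try exact: poweR_ge0.
    have CL0 : 0 <= C0 * L by rewrite mulr_ge0 ?ltW.
    have -> : C0 `^ q * (b * (2 * L `^ q)) = (C0 * L) `^ q * (b * 2).
      by rewrite (powRM _ (ltW C00) (ltW L0)); ring.
    rewrite poweR_EFin lee_fin (powRM _ (powR_ge0 _ _) (ltW b20)) (powRKV q0 CL0).
    have -> : C0 * ((b * 2) `^ s * L) = C0 * L * (b * 2) `^ s by ring.
    by apply: ler_wpM2l => //; apply: ler_powR => //; move: b1; lra.
  apply: le_poweR => //; apply: le_lower_integral => y _; first exact: poweR_ge0.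
  apply: le_poweR; [exact: ltW| |exact: lee_abs].
  rewrite maximal_rational//; last exact: snoc_gt0.
  apply: le_trans (rational_term_ge0 _ _ _ 0%N) _; apply: ereal_sup_ubound.
  by exists 0%N.
split=> //.
(* The unweighted estimate is the case g = 1, all of whose averages are 1. *)
have := key _ (in_Lploc_scalar_cst1 d q).
have -> : (fun x => enorm mu (prod_space mu X) (lattice_maximal mu (cubes d) r f x)
    * (cst 1 x)%:E)%E =
    (fun x => enorm mu (prod_space mu X) (lattice_maximal mu (cubes d) r f x)).
  by apply/funext => x; rewrite mule1.
by rewrite -[fun x => (cst 1 x)%:E]/(cst 1%E) maximal_snoc1.
Qed.
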